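(* Let $\Lambda=\Lambda_4^{\mathcal{H}}$ be the quaternionic Barnes-Wall lattice and $L=\Lambda\oplus II_{1,1}^{\mathcal{H}}\cong I_{5,1}^{\mathcal{H}}$. (i) If $v\in L$ is a primitive isotropic vector not equivalent under $\mathrm{Reflec}_0\,L$ to a multiple of $\rho$ then $v^\perp/\langle v\rangle$ contains a short root. (ii) The index of $\mathrm{Reflec}\,L$ in $\mathrm{Aut}\,L$ is at most $4$, so that $L$ is reflective. More precisely, coset representatives for $\mathrm{Reflec}\,L$ in $\mathrm{Aut}\,L$ may be taken from $\{T_{0,0},T_{0,i},T_{0,j},T_{0,k}\}$.
   Context: $\mathcal{H}$ is the ring of Hurwitz integers, the integral span of its $24$ units $\pm1,\pm i,\pm j,\pm k,(\pm1\pm i\pm j\pm k)/2$ in the quaternions $\mathbb{H}$. An $\mathcal{H}$-lattice is a free right $\mathcal{H}$-module of finite rank with a biadditive $\mathcal{H}$-valued pairing satisfying $\langle x|y\rangle=\overline{\langle y|x\rangle}$ and $\langle x|y\alpha\rangle=\langle x|y\rangle\alpha$; isomorphism means isometry. $I_{5,1}^{\mathcal{H}}$ is $\mathcal{H}^6$ with form $\mathrm{diag}[1,1,1,1,1,-1]$. The quaternionic Barnes-Wall lattice is $$\Lambda_4^{\mathcal{H}}=\tfrac{1}{1+i}\{(x_1,\dots,x_4)\in\mathcal{H}^4: x_i\equiv x_j\ (\mathrm{mod}\ (1+i)\mathcal{H}),\ \textstyle\sum x_i\in2\mathcal{H}\}$$ with form $\sum\bar x_iy_i$. $II_{1,1}^{\mathcal{H}}$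 is $\mathcal{H}^2$ with inner product matrix $\begin{pmatrix}0&1\\1&0\end{pmatrix}$. Elements of $L$ are written $(\lambda;\mu,\nu)$ with $\lambda\in\Lambda$, $\mu,\nu\in\mathcal{H}$; $\rho=(0;0,1)$. The norm of $v$ is $v^2=\langle v|v\rangle$; $v$ is isotropic if $v^2=0$; a short root is a vector of norm $1$. A nonzero $v\in L$ is primitive if $v=w\alpha$ with $w\in L$, $\alpha\in\mathcal{H}$ implies $\alpha$ is a unit. $\langle v\rangle$ is the $\mathcal{H}$-span of $v$, and $v^\perp$ its orthogonal complement in $L$; $v^\perp/\langle v\rangle$ carries the induced form. For $r\in L\otimes\mathbb{R}$ of nonzero norm and a root of unity $\xi\ne1$ in $\mathbb{H}$, the $\xi$-reflection in $r$ is $v\mapsto v-r(1-\xi)\langle r|v\rangle/r^2$. $\mathrm{Reflec}\,L$ is the subgroup of $\mathrm{Aut}\,L$ generated by those elements of $\mathrm{Aut}\,L$ that are reflections in positive-norm vectors; $L$ is reflective if this has finite index in $\mathrm{Aut}\,L$. $\mathrm{Reflec}_0\,L$ is the subgroup generated by the reflections ($\xi$-reflections for units $\xi$ of $\mathcal{H}$) in the short roots of $L$. For $x\in\Lambda\otimes\mathbb{R}$ and $z$ a purely imaginary quaternion, $T_{x,z}$ is the isometry $(\lambda;\mu,\nu)\mapsto(\lambda+x\mu;\ \mu,\ \nu-\langle x|\lambda\rangle+(z-x^2/2)\mu)$ of $L\otimes\mathbb{R}$. *)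

(* Defs.v *)
From HB Require Import structures.
From mathcomp Require Import all_boot all_order all_algebra.
From mathcomp Require Import ring lra.
From mathcomp Require Import mathcomp_extra boolp classical_sets functions.
From mathcomp Require Import cardinality reals.

Set Implicit Arguments.
Unset Strict Implicit.
Unset Printing Implicit Defensive.

Import Order.TTheory GRing.Theory Num.Theory.

Local Open Scope classical_set_scope.
Local Open Scope ring_scope.

(* Quat a b c d is a + b i + c j + d k. *)
Record quat (R : Type) := Quat { qre : R; qi : R; qj : R; qk : R }.

Section QuaternionRing.
Variable R : realFieldType.
Local Notation Q := (quat R).

Definition quat_tuple (x : Q) : R * R * R * R := (qre x, qi x, qj x, qk x).
Definition tuple_quat (t : R * R * R * R) : Q :=
  let: (a, b, c, d) := t in Quat a b c d.
Lemma quat_tupleK : cancel quat_tuple tuple_quat. Proof. by case. Qed.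
HB.instance Definition _ := Choice.copy Q (can_type quat_tupleK).

Definition qzero : Q := Quat 0 0 0 0.
Definition qone : Q := Quat 1 0 0 0.
Definition qopp (x : Q) : Q :=
  let: Quat a b c d := x in Quat (- a) (- b) (- c) (- d).
Definition qadd (x y : Q) : Q :=
  let: Quat a b c d := x in let: Quat e f g h := y in
  Quat (a + e) (b + f) (c + g) (d + h).
Definition qmul (x y : Q) : Q :=
  let: Quat a b c d := x in let: Quat e f g h := y in
  Quat (a * e - b * f - c * g - d * h)
       (a * f + b * e + c * h - d * g)
       (a * g - b * h + c * e + d * f)
       (a * h + b * g - c * f + d * e).
Definition qconj (x : Q) : Q :=
  let: Quat a b c d := x in Quat a (- b) (- c) (- d).
Definition qinv (x : Q) : Q :=
  let: Quat a b c d := x in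
  let n := a ^+ 2 + b ^+ 2 + c ^+ 2 + d ^+ 2 in
  Quat (a / n) (- b / n) (- c / n) (- d / n).

Lemma qaddA : associative qadd.
Proof. by move=> [a b c d] [e f g h] [p q r s] /=; rewrite !addrA. Qed.
Lemma qaddC : commutative qadd.
Proof.
by move=> [a b c d] [e f g h] /=;
   rewrite (addrC a) (addrC b) (addrC c) (addrC d).
Qed.
Lemma qadd0 : left_id qzero qadd.
Proof. by move=> [a b c d] /=; rewrite !add0r. Qed.
Lemma qaddN : left_inverse qzero qopp qadd.
Proof. by move=> [a b c d] /=; rewrite !addNr. Qed.
HB.instance Definition _ := GRing.isZmodule.Build Q qaddA qaddC qadd0 qaddN.

Lemma qmulA : associative qmul.
Proof. by move=> [a b c d] [e f g h] [p q r s] /=; congr Quat; ring. Qed.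
Lemma qmul1 : left_id qone qmul.
Proof. by move=> [a b c d] /=; congr Quat; ring. Qed.
Lemma qmulr1 : right_id qone qmul.
Proof. by move=> [a b c d] /=; congr Quat; ring. Qed.
Lemma qmulDl : left_distributive qmul +%R.
Proof. by move=> [a b c d] [e f g h] [p q r s] /=; congr Quat; ring. Qed.
Lemma qmulDr : right_distributive qmul +%R.
Proof. by move=> [a b c d] [e f g h] [p q r s] /=; congr Quat; ring. Qed.
Lemma qone_neq0 : qone != 0.
Proof. by apply/eqP => -[] /eqP; rewrite oner_eq0. Qed.
HB.instance Definition _ := GRing.Zmodule_isNzRing.Build Q
  qmulA qmul1 qmulr1 qmulDl qmulDr qone_neq0.

Lemma qnorm_neq0 (a b c d : R) : Quat a b c d != 0 ->
  a ^+ 2 + b ^+ 2 + c ^+ 2 + d ^+ 2 != 0.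
Proof.
apply: contraNN; rewrite !paddr_eq0 ?addr_ge0 ?sqr_ge0 // !sqrf_eq0.
by move=> /andP[/andP[/andP[/eqP-> /eqP->] /eqP->] /eqP->].
Qed.

Lemma qmulV : {in [pred x : Q | x != 0], left_inverse 1 qinv *%R}.
Proof.
move=> [a b c d]; rewrite inE => /qnorm_neq0 n0.
by rewrite /GRing.mul /=; congr Quat; field.
Qed.
Lemma qdivv : {in [pred x : Q | x != 0], right_inverse 1 qinv *%R}.
Proof.
move=> [a b c d]; rewrite inE => /qnorm_neq0 n0.
by rewrite /GRing.mul /=; congr Quat; field.
Qed.
Lemma qunitP (x y : Q) : y * x = 1 /\ x * y = 1 -> x \in [pred x : Q | x != 0].
Proof.
case=> yx _; rewrite inE; apply/eqP => x0.
by move: yx; rewrite x0 mulr0 => /esym/eqP; rewrite oner_eq0.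
Qed.
Lemma qinv_out : {in [predC [pred x : Q | x != 0]], qinv =1 id}.
Proof.
move=> x; rewrite !inE negbK => /eqP ->.
by rewrite /GRing.zero /= /qzero; congr Quat; rewrite ?oppr0 mul0r.
Qed.
HB.instance Definition _ := GRing.NzRing_hasMulInverse.Build Q
  qmulV qdivv qunitP qinv_out.

End QuaternionRing.

Section Hurwitz.
Variable R : realType.
Local Notation Q := (quat R).

Definition qI : Q := Quat 0 1 0 0.
Definition qJ : Q := Quat 0 0 1 0.
Definition qK : Q := Quat 0 0 0 1.

Definition hurwitz_units : seq Q :=
  [:: 1; -1; qI; - qI; qJ; - qJ; qK; - qK] ++
  [seq Quat ab.1 ab.2 cd.1 cd.2
     | ab <- [seq (a, b) | a <- [:: 2^-1; - 2^-1], b <- [:: 2^-1; - 2^-1]],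
       cd <- [seq (c, d) | c <- [:: 2^-1; - 2^-1], d <- [:: 2^-1; - 2^-1]]].

Definition hurwitz : set Q :=
  [set q | exists c : 'I_24 -> int,
             q = \sum_(n < 24) hurwitz_units`_n *~ c n].

Definition is_hunit : set Q :=
  [set x | hurwitz x /\ exists2 y, hurwitz y & x * y = 1 /\ y * x = 1].

End Hurwitz.

Section Lattices.
Variable R : realType.
Local Notation Q := (quat R).

(* A lattice is presented inside its real span L \otimes R, which is the right
   vector space 'cV_n over the quaternions; gram is the matrix of the form. *)
Record qlattice (n : nat) := QLattice {
  gram : 'M[Q]_n;
  points : set 'cV[Q]_n }.

Definition rscale n (v : 'cV[Q]_n) (a : Q) : 'cV[Q]_n := v *m a%:M.

Definition hform n (L : qlattice n) (x y : 'cV[Q]_n) : Q :=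
  ((map_mx (@qconj R) x)^T *m gram L *m y) 0 0.

Definition hnorm n (L : qlattice n) (v : 'cV[Q]_n) : Q := hform L v v.

(* Every H-linear isometry of lattices extends uniquely to a linear isometry of
   the real spans, so isometries are represented by these extensions. *)
Definition isometry m n (L : qlattice m) (M : qlattice n) :
    set ('cV[Q]_m -> 'cV[Q]_n) :=
  [set f | [/\ forall x y, f (x + y) = f x + f y,
               forall x a, f (rscale x a) = rscale (f x) a,
               forall x y, hform M (f x) (f y) = hform L x y,
               bijective f
             & f @` points L = points M]].

Definition isometric m n (L : qlattice m) (M : qlattice n) : Prop :=
  exists f, isometry L M f.

Definition AutL n (L : qlattice n) := isometry L L.

Definition dsum m n (L : qlattice m) (M : qlattice n) : qlattice (m + n) :=
  QLattice (block_mx (gram L) 0 0 (gram M))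
           [set v | points L (usubmx v) /\ points M (dsubmx v)].

Definition Hn n : set 'cV[Q]_n := [set x | forall i, hurwitz (x i 0)].

Definition I51 : qlattice (5 + 1) :=
  QLattice (diag_mx (row_mx (const_mx 1) (const_mx (-1)))) (@Hn (5 + 1)).

Definition II11 : qlattice (1 + 1) :=
  QLattice (block_mx 0 1%:M 1%:M 0) (@Hn (1 + 1)).

(* The factor 1/(1+i) acts by left multiplication on the coordinates. *)
Definition barnes_wall : qlattice 4 :=
  QLattice 1%:M
    [set map_mx (fun t => (1 + qI R)^-1 * t) x | x in
      [set x : 'cV[Q]_4 |
        [/\ Hn x,
            forall i j, exists2 h, hurwitz h &
              x i 0 - x j 0 = (1 + qI R) * h
          & exists2 h, hurwitz h & \sum_i x i 0 = 2 * h]]].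

Definition bw_hyperbolic : qlattice (4 + (1 + 1)) := dsum barnes_wall II11.

(* The element written (lambda; mu, nu). *)
Definition vec3 (l : 'cV[Q]_4) (mu nu : Q) : 'cV[Q]_(4 + (1 + 1)) :=
  col_mx l (col_mx mu%:M nu%:M).

Definition rho : 'cV[Q]_(4 + (1 + 1)) := vec3 0 0 1.

Definition translation (x : 'cV[Q]_4) (z : Q) (v : 'cV[Q]_(4 + (1 + 1))) :
    'cV[Q]_(4 + (1 + 1)) :=
  let l := usubmx v in
  let mu := usubmx (dsubmx v) 0 0 in
  let nu := dsubmx (dsubmx v) 0 0 in
  vec3 (l + rscale x mu) mu
       (nu - hform barnes_wall x l + (z - hnorm barnes_wall x / 2) * mu).

Section InLattice.
Variables (n : nat) (L : qlattice n).
Local Notation V := 'cV[Q]_n.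

Definition isotropic : set V := [set v | hnorm L v = 0].

Definition primitive : set V :=
  [set v | [/\ points L v, v <> 0 &
     forall w a, points L w -> hurwitz a -> v = rscale w a -> is_hunit a]].

Definition perp (v : V) : set V := [set w | points L w /\ hform L v w = 0].

Definition hspan (v : V) : set V := [set rscale v a | a in @hurwitz R].

(* The elements of v^perp / <v> are the cosets of <v>; the induced form is
   computed on chosen representatives (see quot_formE). *)
Definition quot_coset (v w : V) : set V := [set w + u | u in hspan v].

Definition perp_quot (v : V) : set (set V) := [set quot_coset v w | w in perp v].

Definition quot_form (C D : set V) : Q := hform L (xget 0 C) (xget 0 D).

Definition quot_short_root (v : V) : set (set V) :=
  [set C | perp_quot v C /\ quot_form C C = 1].

(* The norm of r is a real quaternion, so its sign is that of its real part. *)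
Definition positive_norm : set V := [set r | 0 < qre (hnorm L r)].

Definition root_of_unity : set Q := [set xi | exists2 m, (0 < m)%N & xi ^+ m = 1].

Definition reflection (xi : Q) (r v : V) : V :=
  v - rscale r ((1 - xi) * hform L r v / hnorm L r).

Definition is_subgroup (G : set (V -> V)) : Prop :=
  [/\ G id,
      forall f g, G f -> G g -> G (f \o g)
    & forall f g, G f -> cancel f g -> cancel g f -> G g].

Definition generated (S : set (V -> V)) : set (V -> V) :=
  smallest is_subgroup S.

Definition Reflec : set (V -> V) :=
  generated [set g | AutL L g /\ exists xi r,
    [/\ root_of_unity xi, xi <> 1, positive_norm r & g = reflection xi r]].

Definition short_root : set V := [set r | points L r /\ hnorm L r = 1].

Definition Reflec0 : set (V -> V) :=
  generated [set g | exists xi r,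
    [/\ is_hunit xi, xi <> 1, short_root r & g = reflection xi r]].

Definition lcoset (H : set (V -> V)) (g : V -> V) : set (V -> V) :=
  [set g \o h | h in H].

Definition lcosets (G H : set (V -> V)) : set (set (V -> V)) :=
  [set lcoset H g | g in G].

Definition index_le (G H : set (V -> V)) (m : nat) : Prop :=
  (lcosets G H #<= `I_m)%card.

Definition coset_representatives (G H S : set (V -> V)) : Prop :=
  S `<=` G /\
  forall C, lcosets G H C -> exists! s, S s /\ C s.

Definition reflective : Prop := finite_set (lcosets (AutL L) Reflec).

End InLattice.
End Lattices.

Section QuotientForm.
Variable R : realType.
Local Notation Q := (quat R).

Lemma qconjD (x y : Q) : qconj (x + y) = qconj x + qconj y.
Proof.
by case: x y => [a b c d] [e f g h]; rewrite /GRing.add /=; congr Quat; ring.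
Qed.

Lemma qconjM (x y : Q) : qconj (x * y) = qconj y * qconj x.
Proof.
by case: x y => [a b c d] [e f g h]; rewrite /GRing.mul /=; congr Quat; ring.
Qed.

Lemma qconjK : involutive (@qconj R).
Proof. by case=> [a b c d] /=; rewrite !opprK. Qed.

Lemma qconj0 : qconj (0 : Q) = 0.
Proof. by congr Quat; rewrite oppr0. Qed.

Lemma qconj1 : qconj (1 : Q) = 1.
Proof. by congr Quat; rewrite oppr0. Qed.

Lemma qconj_sum (I : finType) (F : I -> Q) :
  qconj (\sum_i F i) = \sum_i qconj (F i).
Proof. exact: (big_morph _ qconjD qconj0). Qed.

Section Form.
Variables (n : nat) (L : qlattice R n).
Local Notation V := 'cV[Q]_n.

Lemma hformE (x y : V) :
  hform L x y = \sum_j \sum_i qconj (x i 0) * gram L i j * y j 0.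
Proof.
rewrite /hform mxE; apply: eq_bigr => j _; rewrite mxE big_distrl /=.
by apply: eq_bigr => i _; rewrite !mxE.
Qed.

Lemma hformDr (x y z : V) : hform L x (y + z) = hform L x y + hform L x z.
Proof. by rewrite /hform mulmxDr mxE. Qed.

Lemma hformDl (x y z : V) : hform L (x + y) z = hform L x z + hform L y z.
Proof.
rewrite !hformE -big_split; apply: eq_bigr => j _ /=.
by rewrite -big_split; apply: eq_bigr => i _; rewrite mxE qconjD !mulrDl.
Qed.

Lemma hformZr (x y : V) a : hform L x (rscale y a) = hform L x y * a.
Proof. by rewrite /hform /rscale mulmxA mxE big_ord1 [a%:M _ _]mxE eqxx. Qed.

Lemma quot_coset_repr (v w : V) : exists a,
  xget 0 (quot_coset v w) = w + rscale v a.
Proof.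
have h0 : hurwitz (0 : Q).
  by exists (fun=> 0); rewrite big1 // => i _; rewrite mulr0z.
have [|_ [a _ <-] <-] := @xgetI _ 0 (quot_coset v w) (w + rscale v 0).
  by exists (rscale v 0) => //; exists 0.
by exists a.
Qed.

Hypothesis gramC : forall i j, qconj (gram L i j) = gram L j i.

Lemma hformC (x y : V) : qconj (hform L x y) = hform L y x.
Proof.
rewrite !hformE exchange_big qconj_sum; apply: eq_bigr => i _.
rewrite qconj_sum; apply: eq_bigr => j _.
by rewrite !qconjM qconjK gramC mulrA.
Qed.

Lemma quot_formE (v w w' : V) : hnorm L v = 0 -> perp L v w -> perp L v w' ->
  quot_form L (quot_coset v w) (quot_coset v w') = hform L w w'.
Proof.
move=> v0 [_ vw] [_ vw'].
rewrite /quot_form; have [a ->] := quot_coset_repr v w.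
have [b ->] := quot_coset_repr v w'.
have wv : hform L w v = 0 by rewrite -hformC vw qconj0.
have av u : hform L v u = 0 -> hform L (rscale v a) u = 0.
  by move=> vu; rewrite -hformC hformZr -hformC vu qconj0 mul0r qconj0.
have vvb : hform L v (rscale v b) = 0 by rewrite hformZr [hform _ _ _]v0 mul0r.
by rewrite hformDl !hformDr (hformZr w) wv mul0r (av _ vw') (av _ vvb) !addr0.
Qed.
End Form.

Lemma bw_hyperbolic_gramC i j :
  qconj (gram (bw_hyperbolic R) i j) = gram (bw_hyperbolic R) j i.
Proof.
have conj1 m : (map_mx (@qconj R) (1%:M : 'M_m))^T = 1%:M.
  apply/matrixP => a b; rewrite !mxE eq_sym.
  by case: eqP => _; rewrite ?qconj1 ?qconj0.
have conj0 m n : (map_mx (@qconj R) (0 : 'M_(m, n)))^T = 0.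
  by apply/matrixP => a b; rewrite !mxE qconj0.
suff {2}<- : (map_mx (@qconj R) (gram (bw_hyperbolic R)))^T
             = gram (bw_hyperbolic R) by rewrite !mxE.
by rewrite /= !(map_block_mx, tr_block_mx) !conj1 !conj0.
Qed.
End QuotientForm.

(* Main.v *)
(**
  A null vector v = (l; m, n) of L is measured by the norm N of m = <rho|v>, and
  compared with the point x = l / m of the real span of the Barnes-Wall lattice.
  If x lies within distance 1 of a lattice point, then some short root lying over
  that point is orthogonal to v, or one of its reflections decreases N.  Otherwise,
  by a covering argument resting on the E8 lattice, x lies within distance 1 of a
  translate of a point e of norm 1 such that e (1+i) is in the lattice; all these
  are equivalent to the first basis vector, because the biflections act
  transitively on the vectors of norm 2.  In that case N decreases when rho is
  replaced by a null vector with lattice part e (1+i).  Either this vector belongs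
  to the orbit of rho, or it has the type of the vector rho of a second model of L,
  over H^4, in which the same descent is governed by the 24-cell tessellation and
  by the fact that H^4 is generated by orthonormal short roots.  The descent ends
  at a multiple of rho or at a short root orthogonal to v, which is (i).

  For (ii), the first part moves g rho back to rho, since no short root is
  orthogonal to rho.  Commutators give all translations up to central ones, so g
  becomes an isometry of the Barnes-Wall summand times a central translation; the
  transitivity on norm 2 vectors makes it fix the second null vector as well, whose
  stabilizer is visibly generated by reflections in the model over H^4.  The
  central translations by 2i, 2j, 2k and i+j+k are products of reflections, which
  leaves the four cosets.
*)

Require Import Defs.
From HB Require Import structures.
From mathcomp Require Import all_boot all_order all_algebra.
From mathcomp Require Import boolp classical_sets functions cardinality reals.
From mathcomp Require Import ring lra zify.

Import Defs.

Set Implicit Arguments.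
Unset Strict Implicit.
Unset Printing Implicit Defensive.

Import Order.TTheory GRing.Theory Num.Theory.

Local Open Scope classical_set_scope.
Local Open Scope ring_scope.

(** * Hurwitz quaternions *)

Section Quaternions.
Variable R : realType.
Local Notation Q := (quat R).
Implicit Types x y : Q.

(** Both descents use the formula [cusp_bf]: replacing [rho] by the null vector (D [pp]; [pp], s
    [pp]) multiplies N by 2 (r^2/4 + d), where r is the squared distance from x to D and d the
    squared distance from the imaginary part of s to a prescribed point. The admissible imaginary
    parts have squared covering radius 1/4, so r <= 1 allows a factor at most 1, with equality only
    if r = 1 and the imaginary part is at a deep hole. Over H^4 the failure of the root step forces
    r < 1, hence a strict decrease. In the Barnes-Wall model equality can occur. If s is a Hurwitz
    integer, a factor at most 1 is already enough, because the descent over H^4 then starts from a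
    value at most N and its exit is strict. The one remaining borderline configuration is settled by
    an extra short root in [hole_case]. Reflections of order 6 are the ones that decrease N: for a
    unit f of order 6 the factor 1 - f is again a unit. *)

Definition nq x : R := qre x ^+ 2 + qi x ^+ 2 + qj x ^+ 2 + qk x ^+ 2.
Definition rq (r : R) : Q := Quat r 0 0 0.

Lemma quatP x y : qre x = qre y -> qi x = qi y -> qj x = qj y ->
  qk x = qk y -> x = y.
Proof. by case: x y => [a b c d] [e f g h] /= -> -> -> ->. Qed.

Lemma addqE (a b c d e f g h : R) :
  Quat a b c d + Quat e f g h = Quat (a + e) (b + f) (c + g) (d + h).
Proof. by []. Qed.
Lemma oppqE (a b c d : R) : - Quat a b c d = Quat (- a) (- b) (- c) (- d).
Proof. by []. Qed.
Lemma mulqE (a b c d e f g h : R) : Quat a b c d * Quat e f g h =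
  Quat (a * e - b * f - c * g - d * h) (a * f + b * e + c * h - d * g)
       (a * g - b * h + c * e + d * f) (a * h + b * g - c * f + d * e).
Proof. by []. Qed.
Lemma qconjE (a b c d : R) : qconj (Quat a b c d) = Quat a (- b) (- c) (- d).
Proof. by []. Qed.
Lemma zeroqE : 0 = Quat 0 0 0 0 :> Q. Proof. by []. Qed.
Lemma oneqE : 1 = Quat 1 0 0 0 :> Q. Proof. by []. Qed.
Definition qE := (addqE, oppqE, mulqE, zeroqE, oneqE).

Lemma qreD x y : qre (x + y) = qre x + qre y. Proof. by case: x y => [????] []. Qed.
Lemma qiD x y : qi (x + y) = qi x + qi y. Proof. by case: x y => [????] []. Qed.
Lemma qjD x y : qj (x + y) = qj x + qj y. Proof. by case: x y => [????] []. Qed.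
Lemma qkD x y : qk (x + y) = qk x + qk y. Proof. by case: x y => [????] []. Qed.
Lemma qreN x : qre (- x) = - qre x. Proof. by case: x. Qed.
Lemma qiN x : qi (- x) = - qi x. Proof. by case: x. Qed.
Lemma qjN x : qj (- x) = - qj x. Proof. by case: x. Qed.
Lemma qkN x : qk (- x) = - qk x. Proof. by case: x. Qed.
Definition qcoordE := (qreD, qiD, qjD, qkD, qreN, qiN, qjN, qkN).

Lemma qre_conj x : qre (qconj x) = qre x. Proof. by case: x. Qed.
Lemma qi_conj x : qi (qconj x) = - qi x. Proof. by case: x. Qed.
Lemma qj_conj x : qj (qconj x) = - qj x. Proof. by case: x. Qed.
Lemma qk_conj x : qk (qconj x) = - qk x. Proof. by case: x. Qed.

Lemma qreM x y : qre (x * y) = qre x * qre y - qi x * qi y - qj x * qj y - qk x * qk y.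
Proof. by case: x y => [????] []. Qed.
Lemma qiM x y : qi (x * y) = qre x * qi y + qi x * qre y + qj x * qk y - qk x * qj y.
Proof. by case: x y => [????] []. Qed.
Lemma qjM x y : qj (x * y) = qre x * qj y - qi x * qk y + qj x * qre y + qk x * qi y.
Proof. by case: x y => [????] []. Qed.
Lemma qkM x y : qk (x * y) = qre x * qk y + qi x * qj y - qj x * qi y + qk x * qre y.
Proof. by case: x y => [????] []. Qed.
Lemma qre0 : qre (0 : Q) = 0. Proof. by []. Qed.
Lemma qi0 : qi (0 : Q) = 0. Proof. by []. Qed.
Lemma qj0 : qj (0 : Q) = 0. Proof. by []. Qed.
Lemma qk0 : qk (0 : Q) = 0. Proof. by []. Qed.
Lemma qre1 : qre (1 : Q) = 1. Proof. by []. Qed.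
Lemma qi1 : qi (1 : Q) = 0. Proof. by []. Qed.
Lemma qj1 : qj (1 : Q) = 0. Proof. by []. Qed.
Lemma qk1 : qk (1 : Q) = 0. Proof. by []. Qed.
Lemma rqE (r : R) : (qre (rq r) = r) * (qi (rq r) = 0) * (qj (rq r) = 0) * (qk (rq r) = 0).
Proof. by []. Qed.
Definition qprojE := (qcoordE, qreM, qiM, qjM, qkM, qre0, qi0, qj0, qk0,
  qre1, qi1, qj1, qk1, qre_conj, qi_conj, qj_conj, qk_conj).

Lemma qreC x y : qre (x * y) = qre (y * x).
Proof. by case: x y => [a b c d] [e f g h] /=; ring. Qed.

Lemma qconjN x : qconj (- x) = - qconj x. Proof. by case: x. Qed.
Lemma qconjB x y : qconj (x - y) = qconj x - qconj y.
Proof. by rewrite qconjD qconjN. Qed.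

Lemma nqM x y : nq (x * y) = nq x * nq y.
Proof. by case: x y => [a b c d] [e f g h]; rewrite mulqE /nq /=; ring. Qed.
Lemma nq_conj x : nq (qconj x) = nq x.
Proof. by case: x => [a b c d]; rewrite /nq /=; ring. Qed.
Lemma nqN x : nq (- x) = nq x.
Proof. by case: x => [a b c d]; rewrite /nq /=; ring. Qed.
Lemma nq0 : nq 0 = 0. Proof. by rewrite /nq /= expr0n /= !addr0. Qed.
Lemma nq1 : nq 1 = 1. Proof. by rewrite /nq /= expr0n expr1n /= !addr0. Qed.
Lemma nq_ge0 x : 0 <= nq x. Proof. by rewrite !addr_ge0 ?sqr_ge0. Qed.
Lemma nq_eq0 x : (nq x == 0) = (x == 0).
Proof.
apply/idP/eqP => [|->]; last by rewrite nq0.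
case: x => a b c d; rewrite /nq /= => nx; apply/eqP; apply: contraLR nx.
exact: qnorm_neq0.
Qed.
Lemma nq_gt0 x : (0 < nq x) = (x != 0).
Proof. by rewrite lt_def nq_ge0 andbT nq_eq0. Qed.

Lemma mulq_conj x : x * qconj x = rq (nq x).
Proof. by case: x => [a b c d]; rewrite mulqE /rq /nq /=; congr Quat; ring. Qed.
Lemma mul_conjq x : qconj x * x = rq (nq x).
Proof. by case: x => [a b c d]; rewrite mulqE /rq /nq /=; congr Quat; ring. Qed.
Lemma rqC r x : rq r * x = x * rq r.
Proof. by case: x => [a b c d]; rewrite !mulqE; congr Quat; ring. Qed.
Lemma rqM r s : rq (r * s) = rq r * rq s.
Proof. by rewrite mulqE; congr Quat; ring. Qed.
Lemma rqD r s : rq (r + s) = rq r + rq s.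
Proof. by rewrite addqE; congr Quat; ring. Qed.
Lemma rqN r : rq (- r) = - rq r.
Proof. by rewrite oppqE; congr Quat; ring. Qed.
Lemma rq1 : rq 1 = 1. Proof. by []. Qed.
Lemma rq0 : rq 0 = 0. Proof. by []. Qed.
Lemma nq_rq r : nq (rq r) = r ^+ 2. Proof. by rewrite /nq /=; ring. Qed.
Lemma qre_rqM r x : qre (rq r * x) = r * qre x.
Proof. by case: x => [a b c d] /=; ring. Qed.
Lemma natq n : n%:R = rq n%:R :> Q.
Proof. by elim: n => [|n IH] //; rewrite -natr1 IH -rq1 -rqD natr1. Qed.
Lemma qconj_rq r : qconj (rq r) = rq r.
Proof. by rewrite /rq /=; congr Quat; rewrite oppr0. Qed.

Lemma mulq2 x : rq 2 * x = x + x.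
Proof. by rewrite -(natq 2) mulr_natl. Qed.

Lemma unitq x : (x \is a GRing.unit) = (x != 0). Proof. by []. Qed.
Lemma quat_mulxV x : x != 0 -> x * x^-1 = 1.
Proof. by move=> x0; rewrite mulrV // unitq. Qed.
Lemma quat_mulVx x : x != 0 -> x^-1 * x = 1.
Proof. by move=> x0; rewrite mulVr // unitq. Qed.
Lemma nqV x : nq x^-1 = (nq x)^-1.
Proof.
have [->|x0] := eqVneq x 0; first by rewrite invr0 nq0 invr0.
have n0 : nq x != 0 by rewrite nq_eq0.
by apply: (mulfI n0); rewrite -nqM quat_mulxV // nq1 divff.
Qed.
Lemma qVE x : x != 0 -> x^-1 = qconj x * rq (nq x)^-1.
Proof.
move=> x0; apply: (mulrI (x := x)); first by rewrite unitq.
rewrite quat_mulxV // mulrA mulq_conj -rqM divff ?rq1 //; by rewrite nq_eq0.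
Qed.
Lemma nqB x y : nq (x - y) = nq x + nq y - 2 * qre (qconj x * y).
Proof. by case: x y => [a b c d] [e f g h]; rewrite /nq /=; ring. Qed.
End Quaternions.
Arguments rq {R}.

Ltac qring := apply: quatP; rewrite !qprojE ?rqE; ring.
Ltac qfield := apply: quatP; rewrite !qprojE ?rqE; field.

Section Hurwitz.
Variable R : realType.
Local Notation Q := (quat R).
Local Notation i_ := (qI R).
Local Notation j_ := (qJ R).
Local Notation k_ := (qK R).
Implicit Types x y : Q.

(** Coordinates in the integral basis (1+i+j+k)/2, i, j, k, which turns membership in the Hurwitz
    integers into integrality without any parity condition. *)
Definition hquat (a b c d : int) : Q :=
  @Quat R (a%:~R / 2) (a%:~R / 2 + b%:~R) (a%:~R / 2 + c%:~R) (a%:~R / 2 + d%:~R).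

Lemma hurwitzD x y : hurwitz x -> hurwitz y -> hurwitz (x + y).
Proof.
move=> [c ->] [d ->]; exists (fun n => c n + d n).
by rewrite -big_split; apply: eq_bigr => n _; rewrite mulrzDr.
Qed.
Lemma hurwitzN x : hurwitz x -> hurwitz (- x).
Proof.
move=> [c ->]; exists (fun n => - c n).
by rewrite -sumrN; apply: eq_bigr => n _; rewrite mulrNz.
Qed.
Lemma hurwitzB x y : hurwitz x -> hurwitz y -> hurwitz (x - y).
Proof. by move=> hx hy; apply: hurwitzD => //; apply: hurwitzN. Qed.

Lemma hurwitz_gen (m : 'I_24) (a : int) : hurwitz ((hurwitz_units R)`_m *~ a).
Proof.
exists (fun n => if n == m then a else 0).
rewrite (bigD1 m) //= eqxx big1 ?addr0 // => n /negbTE ->.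
by rewrite mulr0z.
Qed.

Lemma mulrzqE (a b c d : R) (n : int) : Quat a b c d *~ n =
  Quat (a * n%:~R) (b * n%:~R) (c * n%:~R) (d * n%:~R).
Proof.
have nat_ (m : nat) : Quat a b c d *+ m = Quat (a *+ m) (b *+ m) (c *+ m) (d *+ m).
  by elim: m => [|m IH] //; rewrite !mulrS IH.
by rewrite !mulrzr; case: n => m; rewrite /intmul nat_.
Qed.

Lemma hquat_hurwitz a b c d : hurwitz (hquat a b c d).
Proof.
have e8 : (hurwitz_units R)`_8 = Quat 2^-1 2^-1 2^-1 2^-1 by [].
have e2 : (hurwitz_units R)`_2 = Quat 0 1 0 0 by [].
have e4 : (hurwitz_units R)`_4 = Quat 0 0 1 0 by [].
have e6 : (hurwitz_units R)`_6 = Quat 0 0 0 1 by [].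
have -> : hquat a b c d = (hurwitz_units R)`_8 *~ a + (hurwitz_units R)`_2 *~ b
    + (hurwitz_units R)`_4 *~ c + (hurwitz_units R)`_6 *~ d.
  rewrite e8 e2 e4 e6 !mulrzqE !addqE /hquat.
  by congr Quat; ring.
do !apply: hurwitzD.
- exact: (@hurwitz_gen (@Ordinal 24 8 isT)).
- exact: (@hurwitz_gen (@Ordinal 24 2 isT)).
- exact: (@hurwitz_gen (@Ordinal 24 4 isT)).
- exact: (@hurwitz_gen (@Ordinal 24 6 isT)).
Qed.

Lemma hurwitzP x : hurwitz x <-> exists a b c d, x = hquat a b c d.
Proof.
split=> [[c ->]|[a [b [c [d ->]]]]]; last exact: hquat_hurwitz.
have addh u v : (exists a b c d, u = hquat a b c d) ->
    (exists a b c d, v = hquat a b c d) -> exists a b c d, u + v = hquat a b c d.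
  move=> [a1 [b1 [c1 [d1 ->]]]] [a2 [b2 [c2 [d2 ->]]]].
  exists (a1 + a2), (b1 + b2), (c1 + c2), (d1 + d2).
  by rewrite /hquat addqE !rmorphD; congr Quat; lra.
have zh : exists a b c d, 0 = hquat a b c d.
  by exists 0, 0, 0, 0; rewrite /hquat zeroqE; congr Quat; lra.
elim/big_ind: _ => // n _.
have scal (m : int) u : (exists a b c d, u = hquat a b c d) ->
    exists a b c d, u *~ m = hquat a b c d.
  move=> [a1 [b1 [c1 [d1 ->]]]]; exists (a1 * m), (b1 * m), (c1 * m), (d1 * m).
  by rewrite /hquat mulrzqE !rmorphM /=; congr Quat; ring.
apply: scal.
suff H u : u \in hurwitz_units R -> exists a b c d, u = hquat a b c d.
  by apply: H; apply: mem_nth; case: n.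
have half (t : R * R) : t \in [seq (a, b) | a <- [:: 2^-1; - 2^-1],
      b <- [:: 2^-1; - 2^-1]] -> exists e f : int, t = (2^-1 + e%:~R, 2^-1 + f%:~R).
  have e0 : 2^-1 = 2^-1 + (0 : int)%:~R :> R by rewrite addr0.
  have e1 : - 2^-1 = 2^-1 + (-1 : int)%:~R :> R by rewrite rmorphN; lra.
  rewrite /= !inE; case/or4P=> /eqP->.
  - by exists 0, 0; rewrite -e0.
  - by exists 0, (-1); rewrite -e0 -e1.
  - by exists (-1), 0; rewrite -e0 -e1.
  - by exists (-1), (-1); rewrite -e1.
rewrite mem_cat => /orP[|/allpairsP[[ab cd] [hab hcd ->]]]; last first.
  have [ea [eb ->]] := half _ hab; have [ec [ed ->]] := half _ hcd.
  exists (1 + 2 * ea), (eb - ea), (ec - ea), (ed - ea).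
  by rewrite /hquat !(rmorphD, rmorphM, rmorphB, rmorphN) /=; congr Quat; lra.
have E a b c' d : exists a' b' c'' d' : int,
    Quat a%:~R b%:~R c'%:~R d%:~R = hquat a' b' c'' d'.
  exists (2 * a), (b - a), (c' - a), (d - a).
  by rewrite /hquat !(rmorphD, rmorphM, rmorphB, rmorphN) /=; congr Quat; lra.
have E1 : (1 : int)%:~R = 1 :> R by [].
have E0 : (0 : int)%:~R = 0 :> R by [].
have EN : (-1 : int)%:~R = -1 :> R by rewrite rmorphN.
have [[[h1 h2] [h3 h4]] [[h5 h6] [h7 h8]]] :=
  (((E 1 0 0 0, E (-1) 0 0 0), (E 0 1 0 0, E 0 (-1) 0 0)),
  ((E 0 0 1 0, E 0 0 (-1) 0), (E 0 0 0 1, E 0 0 0 (-1)))).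
rewrite !EN !E1 !E0 in h1 h2 h3 h4 h5 h6 h7 h8.
rewrite !inE /qI /qJ /qK !(oneqE, oppqE) !oppr0.
by repeat (case/orP; [by move/eqP-> |]); move/eqP->.
Qed.

Lemma hurwitzM x y : hurwitz x -> hurwitz y -> hurwitz (x * y).
Proof.
move=> /hurwitzP[a [b [c [d ->]]]] /hurwitzP[e [f [g [h ->]]]]; apply/hurwitzP.
(* The witnesses are the coordinates of the product in the basis of [hquat]; the first one is twice
   its real part. *)
pose t := b * f + c * g + d * h.
exists (- a * e - a * (f + g + h) - e * (b + c + d) - 2 * t),
  (a * e + a * f + e * b + a * h + e * c + t + c * h - d * g),
  (a * e + a * g + e * c + a * f + e * d + t + d * f - b * h),
  (a * e + a * h + e * d + a * g + e * b + t + b * g - c * f).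
rewrite /hquat mulqE /t !(rmorphD, rmorphB, rmorphM, rmorphN) /=.
by congr Quat; field.
Qed.

Lemma hurwitz_conj x : hurwitz x -> hurwitz (qconj x).
Proof.
move=> /hurwitzP[a [b [c [d ->]]]]; apply/hurwitzP.
exists a, (- a - b), (- a - c), (- a - d).
by rewrite /hquat /= !(rmorphB, rmorphN) /=; congr Quat; field.
Qed.

Lemma hurwitz_int (a b c d : int) : hurwitz (Quat a%:~R b%:~R c%:~R d%:~R : Q).
Proof.
apply/hurwitzP; exists (2 * a), (b - a), (c - a), (d - a).
by rewrite /hquat !(rmorphB, rmorphM) /=; congr Quat; field.
Qed.
Lemma hurwitz0 : hurwitz (0 : Q). Proof. exact: (hurwitz_int 0 0 0 0). Qed.
Lemma hurwitz1 : hurwitz (1 : Q). Proof. exact: (hurwitz_int 1 0 0 0). Qed.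
Lemma hurwitzI : hurwitz i_. Proof. exact: (hurwitz_int 0 1 0 0). Qed.
Lemma hurwitzJ : hurwitz j_. Proof. exact: (hurwitz_int 0 0 1 0). Qed.
Lemma hurwitzK : hurwitz k_. Proof. exact: (hurwitz_int 0 0 0 1). Qed.

Definition qeta : Q := Quat 2^-1 2^-1 2^-1 2^-1.
Lemma hurwitz_eta : hurwitz qeta.
Proof.
apply/hurwitzP; exists 1, 0, 0, 0; rewrite /hquat /qeta.
by congr Quat; rewrite ?addr0 div1r.
Qed.

Lemma hurwitz_half (a b c d : int) : hurwitz (Quat (2^-1 + a%:~R)
  (2^-1 + b%:~R) (2^-1 + c%:~R) (2^-1 + d%:~R) : Q).
Proof.
have -> : Quat (2^-1 + a%:~R) (2^-1 + b%:~R) (2^-1 + c%:~R) (2^-1 + d%:~R) =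
  qeta + Quat a%:~R b%:~R c%:~R d%:~R :> Q by [].
by apply: hurwitzD; [exact: hurwitz_eta|exact: hurwitz_int].
Qed.

Lemma hurwitz_nat n : hurwitz (n%:R : Q).
Proof.
elim: n => [|n IH]; first exact: hurwitz0.
by rewrite -natr1; apply: hurwitzD => //; exact: hurwitz1.
Qed.

Lemma nq_hquat a b c d : nq (hquat a b c d) =
  (a ^+ 2 + a * (b + c + d) + b ^+ 2 + c ^+ 2 + d ^+ 2)%:~R.
Proof.
by rewrite /nq /= !(rmorphD, rmorphM, rmorphXn) /=; field.
Qed.

Lemma hurwitz_nq x : hurwitz x -> exists n : nat, nq x = n%:R.
Proof.
move=> /hurwitzP[a [b [c [d xE]]]].
have := nq_ge0 x; rewrite xE nq_hquat ler0z => /gez0_abs <-.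
by eexists; rewrite pmulrn.
Qed.

Lemma hurwitz_nq_lt1 x : hurwitz x -> nq x < 1 -> x = 0.
Proof.
move=> /hurwitz_nq[n nE]; rewrite nE (ltr_nat _ n 1) ltnS leqn0 => /eqP n0.
by apply/eqP; rewrite -nq_eq0 nE n0.
Qed.
Lemma hurwitz_nq_ge1 x : hurwitz x -> x != 0 -> 1 <= nq x.
Proof.
move=> hx; apply: contraNT; rewrite -ltNge => /(hurwitz_nq_lt1 hx) ->.
exact: eqxx.
Qed.

Lemma hurwitz_re x : hurwitz x -> exists m : int, 2 * qre x = m%:~R.
Proof. by move=> /hurwitzP[a [b [c [d ->]]]]; exists a => /=; field. Qed.

Lemma is_hunitP x : is_hunit x <-> hurwitz x /\ nq x = 1.
Proof.
split=> [[hx [y hy [xy _]]]|[hx nx]].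
  split=> //; have x0 : x != 0.
    by apply/eqP => x0; move: xy => /eqP; rewrite x0 mul0r eq_sym oner_eq0.
  have y0 : y != 0.
    by apply/eqP => y0; move: xy => /eqP; rewrite y0 mulr0 eq_sym oner_eq0.
  have := hurwitz_nq_ge1 hx x0; have := hurwitz_nq_ge1 hy y0.
  have : nq x * nq y = 1 by rewrite -nqM xy nq1.
  by move=> h1 h2 h3; nra.
split=> //; exists (qconj x); first exact: hurwitz_conj.
by rewrite mulq_conj mul_conjq nx.
Qed.

Lemma sqr_quat x : x * x = rq (2 * qre x) * x - rq (nq x).
Proof.
case: x => a b c d; rewrite /rq /nq !mulqE oppqE addqE /=; congr Quat; ring.
Qed.

(** A unit satisfies x^2 = m x - 1, where m is twice the real part, an integer with m^2 <= 4. The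
    values 0, 1, -1, 2, -2 of m give the orders 4, 6, 3, 1, 2. *)
Lemma hunit_root x : is_hunit x -> root_of_unity x.
Proof.
move=> /is_hunitP[hx nx].
have [m mE] := hurwitz_re hx.
have x2 : x * x = rq m%:~R * x - 1 by rewrite sqr_quat mE nx.
have m2 : m%:~R ^+ 2 <= 4%:~R :> R.
  rewrite -mE; move: nx; case: (x) => a b c d; rewrite /nq /= => nx.
  have := sqr_ge0 b; have := sqr_ge0 c; have := sqr_ge0 d; nra.
have m2z : m ^+ 2 <= 4 by rewrite -(ler_int R) rmorphXn.
have sgn (s : R) : s ^+ 2 = 1 -> x = rq s -> root_of_unity x.
  by move=> s2 ->; exists 2 => //; rewrite expr2 -rqM -expr2 s2.
have re_ext (s : R) : s ^+ 2 = 1 -> qre x = s -> x = rq s.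
  move=> s2; move: nx; case: (x) => a b c d; rewrite /nq /= => nx as_.
  move: nx; rewrite as_ s2 => nx.
  have := sqr_ge0 b; have := sqr_ge0 c; have := sqr_ge0 d => d0 c0 b0.
  have z (t : R) : t ^+ 2 = 0 -> t = 0 by move/eqP; rewrite sqrf_eq0 => /eqP.
  by rewrite /rq; congr Quat; apply: z; lra.
have : m = 0 \/ m = 1 \/ m = -1 \/ m = 2 \/ m = -2 by nia.
move=> [m0|[m1|[m1|[m1|m1]]]].
- exists 4 => //; rewrite (exprM x 2 2) (expr2 x) x2 m0 rq0 mul0r sub0r.
  by rewrite expr2 mulrNN mulr1.
- exists 6 => //; rewrite (exprM x 3 2).
  have -> : x ^+ 3 = -1.
    by rewrite exprS expr2 x2 m1 rq1 mul1r mulrBr mulr1 x2 m1 rq1 mul1r addrAC subrr add0r.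
  by rewrite expr2 mulrNN mulr1.
- exists 3 => //; rewrite exprS expr2 x2 m1 rmorphN rqN rq1 mulN1r.
  by rewrite mulrBr mulrN x2 m1 rmorphN rqN rq1 mulN1r mulr1 opprB opprK addrK.
- apply: (sgn 1); first by rewrite expr1n.
  by apply: re_ext; rewrite ?expr1n //; move: mE; rewrite m1 => mE; lra.
- apply: (sgn (-1)); first by rewrite sqrrN expr1n.
  by apply: re_ext; rewrite ?sqrrN ?expr1n //; move: mE; rewrite m1 rmorphN => mE; lra.
Qed.
End Hurwitz.

(** * The prime above 2 and rounding to Hurwitz integers *)

Section EvenHurwitz.
Variable R : realType.
Local Notation Q := (quat R).
Local Notation i_ := (qI R).
Implicit Types x y : Q.

(* [inP] is the two-sided prime ideal above 2, with residue field of order 4. *)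
Definition pp : Q := 1 + i_.
Definition inP x := exists2 h, hurwitz h & x = pp * h.

Lemma ppE : pp = Quat 1 1 0 0.
Proof. by rewrite /pp oneqE addqE; congr Quat; rewrite ?addr0 ?add0r. Qed.
Lemma nq_pp : nq pp = 2.
Proof. by rewrite ppE /nq /=; ring. Qed.
Lemma hurwitz_pp : hurwitz pp.
Proof. by apply: hurwitzD; [exact: hurwitz1|exact: hurwitzI]. Qed.
Lemma pp_neq0 : pp != 0.
Proof. by rewrite -nq_eq0 nq_pp pnatr_eq0. Qed.
Lemma nq_ppV : nq pp^-1 = 2^-1.
Proof. by rewrite nqV nq_pp. Qed.

Lemma inP_hurwitz x : inP x -> hurwitz x.
Proof. by case=> h hh ->; apply: hurwitzM => //; exact: hurwitz_pp. Qed.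

Lemma int_parity (a : int) : exists A : int, a = 2 * A \/ a = 2 * A + 1.
Proof. by exists (a %/ 2)%Z; lia. Qed.

Lemma int_sqr_parity (a : int) : exists A : int, a ^+ 2 = a + 2 * A.
Proof.
have [A [->|->]] := int_parity a.
  by exists (2 * A ^+ 2 - A); ring.
by exists (2 * A ^+ 2 + A); ring.
Qed.

(** Parity of the norm does not distinguish left from right, so this criterion makes the ideal of
    left multiples of [pp] two-sided and stable under conjugation. *)
Lemma inP_nq x : hurwitz x -> (inP x <-> exists n : int, nq x = (2 * n)%:~R).
Proof.
move=> hx; split=> [[h hh ->]|[n nE]].
  have [n nE] := hurwitz_nq hh.
  by exists n; rewrite nqM nq_pp nE rmorphM.
have /hurwitzP[a [b [c [d xE]]]] := hx.
move: nE; rewrite xE nq_hquat => /intr_inj nE.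
have [B bE] := int_sqr_parity b; have [C cE] := int_sqr_parity c.
have [D dE] := int_sqr_parity d; rewrite bE cE dE in nE.
have [A [aE|aE]] := int_parity a; rewrite aE in nE; last first.
  exfalso; have : 2 * (2 * A ^+ 2 + 2 * A + A * (b + c + d) + (b + c + d) + B + C + D - n)
    + 1 = 0 by move: nE; lia.
  by move: (_ - n); lia.
(* An even norm forces a = 2 A and b + c + d = 2 e; the quotient by [pp] is then integral in the
   basis of [hquat]. *)
pose e := n - (2 * A ^+ 2 + A * (b + c + d) + B + C + D).
have dE' : d = 2 * e - b - c by rewrite /e; lia.
exists (hquat R (2 * A + b) (- A) (e - b) (e - b - c - A)).
  exact: hquat_hurwitz.
rewrite aE dE' ppE /hquat mulqE !(rmorphD, rmorphB, rmorphM, rmorphN) /=.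
by congr Quat; field.
Qed.

Lemma inP0 : inP 0.
Proof. by exists 0; rewrite ?mulr0 //; exact: hurwitz0. Qed.
Lemma inPD x y : inP x -> inP y -> inP (x + y).
Proof.
by move=> [a ha ->] [b hb ->]; exists (a + b); rewrite ?mulrDr //; apply: hurwitzD.
Qed.
Lemma inPN x : inP x -> inP (- x).
Proof. by move=> [a ha ->]; exists (- a); rewrite ?mulrN //; apply: hurwitzN. Qed.
Lemma inPB x y : inP x -> inP y -> inP (x - y).
Proof. by move=> hx hy; apply: inPD => //; apply: inPN. Qed.
Lemma inPMr x y : inP x -> hurwitz y -> inP (x * y).
Proof.
by move=> [a ha ->] hy; exists (a * y); rewrite ?mulrA //; apply: hurwitzM.
Qed.
Lemma inPMl x y : hurwitz x -> inP y -> inP (x * y).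
Proof.
move=> hx hy; have hyh := inP_hurwitz hy.
apply/inP_nq; first exact: hurwitzM.
have [n nE] := hurwitz_nq hx; have /(inP_nq hyh)[m mE] := hy.
by exists (n%:Z * m); rewrite nqM nE mE !rmorphM /= -pmulrn; ring.
Qed.
Lemma inP_conj x : inP x -> inP (qconj x).
Proof.
move=> hx; have hxh := inP_hurwitz hx.
apply/inP_nq; first exact: hurwitz_conj.
by rewrite nq_conj; apply/inP_nq.
Qed.
Lemma inP_pp : inP pp. Proof. by exists 1; rewrite ?mulr1 //; exact: hurwitz1. Qed.
Lemma inP_right x : inP x -> exists2 h, hurwitz h & x = h * pp.
Proof.
move=> /inP_conj[h hh xE]; exists (qconj h * qconj pp * pp^-1); last first.
  by rewrite -[RHS]mulrA quat_mulVx ?pp_neq0 // mulr1 -qconjM -xE qconjK.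
have -> : qconj h * qconj pp * pp^-1 = qconj h * - i_.
  rewrite -mulrA; congr (_ * _); rewrite ppE; apply: (mulIr (x := Quat 1 1 0 0)).
    by rewrite unitq -ppE pp_neq0.
  rewrite -mulrA -ppE quat_mulVx ?pp_neq0 // mulr1 ppE /qI oppqE mulqE /=.
  by congr Quat; ring.
by apply: hurwitzM; [apply: hurwitz_conj|apply: hurwitzN; exact: hurwitzI].
Qed.

Lemma inP_two x : hurwitz x -> inP (2 * x).
Proof.
move=> hx; exists (qconj pp * x).
  by apply: hurwitzM => //; apply: hurwitz_conj; exact: hurwitz_pp.
by rewrite mulrA mulq_conj nq_pp (natq R 2).
Qed.

Lemma hurwitz_nq1_notinP x : hurwitz x -> nq x = 1 -> ~ inP x.
Proof.
move=> hx nx /(inP_nq hx)[n]; rewrite nx => /(intr_inj (x1 := 1)).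
by lia.
Qed.

Lemma round_real (r : R) : exists m : int, `|r - m%:~R| <= 2^-1.
Proof.
exists (Num.floor (r + 2^-1)).
have /andP[h1 h2] := floor_itv (r + 2^-1).
move: h2; rewrite rmorphD /= => h2.
by rewrite ler_norml; apply/andP; split; lra.
Qed.

(** The Voronoi cell of the Hurwitz integers at 0, a regular 24-cell: the first four bounds are the
    facets of the units with one nonzero coordinate, the last one those of the sixteen units with
    half-integral coordinates. *)
Definition voronoi (e : Q) :=
  [/\ `|qre e| <= 2^-1, `|qi e| <= 2^-1, `|qj e| <= 2^-1, `|qk e| <= 2^-1
    & `|qre e| + `|qi e| + `|qj e| + `|qk e| <= 1].

(** Rounding each coordinate may leave errors of sum S > 1. Moving every coordinate by 1/2 towards
    the point replaces each error t by 1/2 - t, and the sum by 2 - S < 1. *)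
Lemma hurwitz_round x : exists2 a, hurwitz a & voronoi (x - a).
Proof.
case: x => a b c d.
have [a1 ha] := round_real a; have [b1 hb] := round_real b.
have [c1 hc] := round_real c; have [d1 hd] := round_real d.
pose e := Quat a b c d - Quat a1%:~R b1%:~R c1%:~R d1%:~R.
have [le1|gt1] := leP (`|qre e| + `|qi e| + `|qj e| + `|qk e|) 1.
  by exists (Quat a1%:~R b1%:~R c1%:~R d1%:~R); [exact: hurwitz_int|split].
have sgn (t : R) (m : int) : `|t - m%:~R| <= 2^-1 ->
    exists n : int, `|t - (2^-1 + n%:~R)| = 2^-1 - `|t - m%:~R|.
  move=> ht; have [t0|t0] := leP 0 (t - m%:~R).
    exists m; rewrite (ger0_norm t0) in ht *; rewrite ler0_norm; lra.
  exists (m - 1); rewrite (ltr0_norm t0) in ht *; rewrite rmorphB /= ger0_norm; lra.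
have [a2 ha2] := sgn _ _ ha; have [b2 hb2] := sgn _ _ hb.
have [c2 hc2] := sgn _ _ hc; have [d2 hd2] := sgn _ _ hd.
exists (Quat (2^-1 + a2%:~R) (2^-1 + b2%:~R) (2^-1 + c2%:~R) (2^-1 + d2%:~R)).
  exact: hurwitz_half.
have a0 := normr_ge0 (a - a1%:~R); have b0 := normr_ge0 (b - b1%:~R).
have c0 := normr_ge0 (c - c1%:~R); have d0 := normr_ge0 (d - d1%:~R).
move: gt1; rewrite /voronoi /e !oppqE !addqE /= ha2 hb2 hc2 hd2 => gt1.
by split; lra.
Qed.

Lemma voronoi_nq e : voronoi e -> nq e <= 2^-1.
Proof.
have le (t : R) : `|t| <= 2^-1 -> t ^+ 2 <= `|t| / 2.
  by rewrite -(real_normK (num_real t)); move: (normr_ge0 t); move: `|t| => s; nra.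
move=> [/le ha /le hb /le hc /le hd hs]; rewrite /nq; lra.
Qed.

Lemma voronoi_re_unit e u : voronoi e -> hurwitz u -> nq u = 1 ->
  qre (qconj u * e) <= 2^-1.
Proof.
case: e => a b c d [/= ha hb hc hd hs] /hurwitzP[m [x [y [z ->]]]].
have [M [mE|mE]] := int_parity m.
  have -> : hquat R m x y z =
      Quat M%:~R (M + x)%:~R (M + y)%:~R (M + z)%:~R.
    by rewrite /hquat mE !rmorphD !rmorphM /=; congr Quat; field.
  move: (M + x) (M + y) (M + z) => {}x {}y {}z {mE m}.
  rewrite /nq /= -!rmorphXn -!rmorphD /= => /(intr_inj (x2 := 1)) n1.
  have le (n : int) (t : R) : `|t| <= 2^-1 -> n%:~R * t <= (n ^+ 2)%:~R / 2.
    move=> ht; have h1 : n%:~R * t <= `|n%:~R| * `|t| by rewrite -normrM ler_norm.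
    apply: (le_trans h1); apply: ler_pM => //.
    rewrite -intr_norm ler_int -(real_normK (num_real n)).
    by move: (normr_ge0 n); move: `|n| => k; nia.
  have := le M _ ha; have := le x _ hb; have := le y _ hc; have := le z _ hd.
  have : (M ^+ 2 + x ^+ 2 + y ^+ 2 + z ^+ 2)%:~R = 1 :> R by rewrite n1.
  rewrite !rmorphD /=; lra.
have -> : hquat R m x y z = Quat (2^-1 + M%:~R) (2^-1 + (M + x)%:~R)
    (2^-1 + (M + y)%:~R) (2^-1 + (M + z)%:~R).
  by rewrite /hquat mE !rmorphD !rmorphM /=; congr Quat; field.
move: (M + x) (M + y) (M + z) => {}x {}y {}z {mE m}.
have hn (n : int) : 0 <= (n ^+ 2 + n)%:~R :> R by rewrite ler0z; nia.
have := hn M; have := hn x; have := hn y; have := hn z.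
rewrite /nq /= => hz hy hx hM n1.
have z0 (n : int) : (n ^+ 2 + n)%:~R = 0 :> R -> 2^-1 + n%:~R = 2^-1 :> R \/
    2^-1 + n%:~R = - 2^-1 :> R.
  move=> /eqP; rewrite intr_eq0 => /eqP n0.
  have [->|->] : n = 0 \/ n = -1 by nia.
    by left; rewrite addr0.
  by right; rewrite rmorphN; lra.
have eqz (n : int) : (2^-1 + n%:~R) ^+ 2 = (n ^+ 2 + n)%:~R + 4^-1 :> R.
  by rewrite rmorphD rmorphXn /=; field.
rewrite !eqz in n1.
have le (n : int) (t : R) : (n ^+ 2 + n)%:~R = 0 :> R ->
    (2^-1 + n%:~R) * t <= `|t| / 2.
  move=> /z0[]->; have := ler_norm t; have := ler_norm (- t); rewrite normrN; lra.
have := le M a; have := le x b; have := le y c; have := le z d.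
by lra.
Qed.
End EvenHurwitz.

(** * Approximation by Hurwitz integers *)

Section Approximation.
Variable R : realType.
Local Notation Q := (quat R).
Local Notation i_ := (qI R).
Local Notation j_ := (qJ R).
Local Notation k_ := (qK R).
Local Notation pp := (pp R).
Implicit Types x y : Q.

(** The quaternion group: the units congruent to 1 modulo [pp], so that multiplying by them
    preserves residue classes. *)
Definition q8 x := [\/ [\/ x = 1 | x = -1], [\/ x = i_ | x = - i_],
  [\/ x = j_ | x = - j_] | [\/ x = k_ | x = - k_]].

Lemma q8_props x : q8 x -> [/\ hurwitz x, nq x = 1, inP (x - 1) & inP (1 + x)].
Proof.
move=> hx; have [hh n1 [m mE]] : [/\ hurwitz x, nq x = 1 & exists m : int, qre x = m%:~R].
  have I (y : Q) (m : int) : hurwitz y -> nq y = 1 -> qre y = m%:~R ->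
      [/\ hurwitz y, nq y = 1 & exists m : int, qre y = m%:~R] by split=> //; exists m.
  have N (y : Q) : [/\ hurwitz y, nq y = 1 & exists m : int, qre y = m%:~R] ->
      [/\ hurwitz (- y), nq (- y) = 1 & exists m : int, qre (- y) = m%:~R].
    move=> [h n [m mE]]; split; [exact: hurwitzN|by rewrite nqN|].
    by exists (- m); rewrite qreN mE rmorphN.
  have K1 := I _ 1 (@hurwitz1 R) (@nq1 R) erefl.
  have KI := I i_ 0 (@hurwitzI R) ltac:(by rewrite /nq /=; ring) erefl.
  have KJ := I j_ 0 (@hurwitzJ R) ltac:(by rewrite /nq /=; ring) erefl.
  have KK := I k_ 0 (@hurwitzK R) ltac:(by rewrite /nq /=; ring) erefl.
  by case: hx => -[]-> //; exact: N.
have h1 := @hurwitz1 R; split=> //.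
  apply/inP_nq; first exact: hurwitzB.
  exists (1 - m); rewrite nqB n1 nq1 mulr1 qre_conj mE rmorphM rmorphB /=; ring.
apply/inP_nq; first exact: hurwitzD.
exists (1 + m); rewrite -[x]opprK nqB nqN n1 nq1 qconj1 mul1r qreN mE rmorphM rmorphD /=; ring.
Qed.

Lemma max_coord x : exists2 q, q8 q & forall c, c = qre (qconj q * x) ->
  [/\ `|qre x| <= c, `|qi x| <= c, `|qj x| <= c & `|qk x| <= c].
Proof.
case: x => a b c d.
have [q hq qE] : exists2 q, q8 q & qre (qconj q * Quat a b c d) =
    Num.max (Num.max `|a| `|b|) (Num.max `|c| `|d|).
  have sg (t : R) (q : Q) : (qre (qconj q * Quat a b c d) = t) ->
      q8 q -> q8 (- q) -> exists2 q, q8 q & qre (qconj q * Quat a b c d) = `|t|.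
    move=> qt h1 h2; have [t0|t0] := leP 0 t; [exists q|exists (- q)] => //.
      by rewrite ger0_norm.
    by rewrite ltr0_norm // qconjN mulNr qreN qt.
  have [Ha Hb Hc Hd] : [/\ exists2 q, q8 q & qre (qconj q * Quat a b c d) = `|a|,
    exists2 q, q8 q & qre (qconj q * Quat a b c d) = `|b|,
    exists2 q, q8 q & qre (qconj q * Quat a b c d) = `|c| &
    exists2 q, q8 q & qre (qconj q * Quat a b c d) = `|d|].
    split.
    - by apply: (sg _ 1); [rewrite /=; ring|constructor 1; left|constructor 1; right].
    - by apply: (sg _ i_); [rewrite /=; ring|constructor 2; left|constructor 2; right].
    - by apply: (sg _ j_); [rewrite /=; ring|constructor 3; left|constructor 3; right].
    - by apply: (sg _ k_); [rewrite /=; ring|constructor 4; left|constructor 4; right].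
  have mx (s t : R) : (exists2 q, q8 q & qre (qconj q * Quat a b c d) = s) ->
      (exists2 q, q8 q & qre (qconj q * Quat a b c d) = t) ->
      exists2 q, q8 q & qre (qconj q * Quat a b c d) = Num.max s t.
    by rewrite /Num.max; case: ifP.
  exact: (mx _ _ (mx _ _ Ha Hb) (mx _ _ Hc Hd)).
by exists q => // e ->; rewrite qE /= !le_max !lexx !orbT.
Qed.

Lemma max_coord_nq x : exists2 q, q8 q &
  nq x <= qre (qconj q * x) * (`|qre x| + `|qi x| + `|qj x| + `|qk x|) /\
  nq x <= 4 * qre (qconj q * x) ^+ 2 /\ 0 <= qre (qconj q * x).
Proof.
have [q hq /(_ _ erefl)[ha hb hc hd]] := max_coord x; exists q => //.
move: (qre (qconj q * x)) ha hb hc hd => m; rewrite /nq.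
move: (qre x) (qi x) (qj x) (qk x) => a b c d ha hb hc hd.
have sq (t : R) : `|t| <= m -> t ^+ 2 <= m * `|t| /\ t ^+ 2 <= m ^+ 2.
  rewrite -(real_normK (num_real t)); have := normr_ge0 t; move: `|t| => s; nra.
have [a1 a2] := sq _ ha; have [b1 b2] := sq _ hb.
have [c1 c2] := sq _ hc; have [d1 d2] := sq _ hd.
by have := normr_ge0 a; split; [lra|split; lra].
Qed.

(* The Voronoi cell is stable under multiplication by all 24 units, not only by
   the 8 units of [q8]. *)
Lemma voronoi_rot (e u : Q) : voronoi e -> hurwitz u -> nq u = 1 ->
  forall f : Q, f = qconj u * e -> `|qre f| + `|qi f| + `|qj f| + `|qk f| <= 1.
Proof.
move=> ve hu nu f fE.
have sg (t : R) : exists n : int, `|t| = 2 * ((2^-1 + n%:~R) * t) /\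
    (2^-1 + n%:~R) ^+ 2 = 4^-1 :> R.
  have [t0|t0] := leP 0 t.
    by exists 0; rewrite ger0_norm // addr0; split; field.
  by exists (-1); rewrite ltr0_norm // rmorphN; split; field.
have [a [aE a2]] := sg (qre f); have [b [bE b2]] := sg (qi f).
have [c [cE c2]] := sg (qj f); have [d [dE d2]] := sg (qk f).
pose v := Quat (2^-1 + a%:~R) (2^-1 + b%:~R) (2^-1 + c%:~R) (2^-1 + d%:~R) : Q.
have hv : hurwitz v by exact: hurwitz_half.
have nv : nq v = 1 by rewrite /nq /= a2 b2 c2 d2; field.
have := voronoi_re_unit ve (hurwitzM hu hv) (_ : nq (u * v) = 1).
rewrite nqM nu nv mulr1 => /(_ erefl).
rewrite qconjM -mulrA -fE aE bE cE dE.
by case: (f) => ????; rewrite /v /=; lra.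
Qed.

(** Rounding x / [pp] leaves a remainder of norm at most 2 times 1/2; it is a nonzero Hurwitz
    integer because x is outside the ideal, so its norm is 1. *)
Lemma inP_unit_rep x : hurwitz x -> ~ inP x ->
  exists2 y, hurwitz y & nq (x - y * pp) = 1.
Proof.
move=> hx nx; have [y hy /voronoi_nq vy] := hurwitz_round (x * pp^-1).
exists y => //.
have hr : hurwitz (x - y * pp).
  by apply: hurwitzB => //; apply: hurwitzM => //; exact: hurwitz_pp.
have le1 : nq (x - y * pp) <= 1.
  have -> : x - y * pp = (x * pp^-1 - y) * pp.
    by rewrite mulrBl -mulrA quat_mulVx ?pp_neq0 // mulr1.
  by rewrite nqM nq_pp; lra.
apply/eqP; rewrite eq_le le1 hurwitz_nq_ge1 //.
apply/eqP => /eqP; rewrite subr_eq0 => /eqP xE; apply: nx; rewrite xE.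
by apply: inPMl => //; exact: inP_pp.
Qed.

(** The pairs congruent modulo [pp] form the E8 lattice, of covering radius 1. Rounding separately
    leaves errors at most 1/2. If the residues differ, the coordinate with the larger error n is
    moved by a unit of the missing residue class; choosing this unit by its largest coordinate turns
    n into at most 1 - n, so the total is at most 1. *)
Lemma e8_covering x y : exists a b, [/\ hurwitz a, hurwitz b, inP (a - b) &
  nq (x - a) + nq (y - b) <= 1].
Proof.
have [a ha va] := hurwitz_round x; have [b hb vb] := hurwitz_round y.
have na := voronoi_nq va; have nb := voronoi_nq vb.
have [hab|nab] := pselect (inP (a - b)); first by exists a, b; split => //; lra.
have move_ (z c : Q) : voronoi (z - c) -> hurwitz c -> exists2 c' : Q, hurwitz c' &
    inP (c' - c - (a - b)) /\ nq (z - c') <= 1 - nq (z - c).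
  move=> vz hc; have [w hw nw] := inP_unit_rep (hurwitzB ha hb) nab.
  set u := a - b - w * pp in nw.
  have hu : hurwitz u.
    by do 2?[apply: hurwitzB] => //; apply: hurwitzM => //; exact: hurwitz_pp.
  have [q hq [le1 [_ t0]]] := max_coord_nq (qconj u * (z - c)).
  have [hqh nq1 q1 _] := q8_props hq.
  exists (c + u * q); first by apply: hurwitzD => //; apply: hurwitzM.
  split.
    have -> : c + u * q - c - (a - b) = u * (q - 1) - w * pp.
      by rewrite mulrBr mulr1 [c + _]addrC addrK -[RHS]addrA -opprD; congr (_ - _); rewrite subrK.
    apply: inPB; first exact: inPMl.
    by apply: inPMl => //; exact: inP_pp.
  rewrite opprD addrA (nqB (z - c) (u * q)) nqM nw nq1 mulr1.
  have l1 := voronoi_rot vz hu nw erefl.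
  have -> : qre (qconj (z - c) * (u * q)) = qre (qconj q * (qconj u * (z - c))).
    by rewrite -qre_conj !qconjM qconjK mulrA.
  move: le1 t0 l1; rewrite nqM nq_conj nw mul1r /=.
  set t := qre (qconj q * _); set l := _ + `|qk _| => le1 t0 l1.
  have l0 : 0 <= l by rewrite !addr_ge0 ?normr_ge0.
  have n0 := nq_ge0 (z - c).
  by nra.
have [le_|lt_] := leP (nq (y - b)) (nq (x - a)).
  have [c hc [ic nc]] := move_ _ _ va ha.
  exists c, b; split => //; last lra.
  have -> : c - b = (c - a - (a - b)) + 2 * (a - b).
    by rewrite (natq R 2); qring.
  by apply: inPD => //; apply: inP_two; apply: hurwitzB.
have [c hc [ic nc]] := move_ _ _ vb hb.
exists a, c; split => //; last lra.
have -> : a - c = - (c - b - (a - b)).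
  by qring.
exact: inPN.
Qed.
End Approximation.

(** * Vertices of the 24-cells *)

Section HalfIntegers.
Variable R : realType.
Local Notation Q := (quat R).
Local Notation pp := (pp R).
Implicit Types x y : Q.

Definition half_int (a b c d : int) : Q :=
  @Quat R (a%:~R / 2) (b%:~R / 2) (c%:~R / 2) (d%:~R / 2).

Lemma half_intE (a b c d : int) : (qre (half_int a b c d) = a%:~R / 2) *
  (qi (half_int a b c d) = b%:~R / 2) * (qj (half_int a b c d) = c%:~R / 2) *
  (qk (half_int a b c d) = d%:~R / 2).
Proof. by []. Qed.

(** Half-integral points of even coordinate sum lie in H [pp]^-1; those of norm 1/2 serve as the
    vertices of the 24-cell. *)
Lemma half_int_pp (a b c d e : int) : a + b + c + d = 2 * e ->
  hurwitz (half_int a b c d * pp).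
Proof.
move=> sE; have -> : d = 2 * e - a - b - c by lia.
apply/hurwitzP; exists (a - b), b, (e - a), (e - a - c).
rewrite /half_int /hquat ppE mulqE !(rmorphB, rmorphM) /=.
by congr Quat; field.
Qed.

Lemma real_sign (t : R) : exists s : int, (s = 1 \/ s = -1) /\ `|t| = s%:~R * t.
Proof.
have [t0|t0] := leP 0 t.
  by exists 1; split; [left|rewrite ger0_norm // mul1r].
by exists (-1); split; [right|rewrite ltr0_norm // rmorphN mulN1r].
Qed.

Lemma sum_sqr_le_top2 (a b c d : R) : 0 <= c -> 0 <= d -> a <= 2^-1 -> b <= 2^-1 ->
    a + b + c + d <= 1 -> c <= a -> d <= a -> c <= b -> d <= b ->
  a ^+ 2 + b ^+ 2 + c ^+ 2 + d ^+ 2 <= (a + b) / 2.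
Proof.
wlog ba : a b / b <= a => [W|] c0 d0 ha hb hs ca da cb db.
  have [/W|/ltW/W] := leP b a; first exact.
  by rewrite (addrC (b ^+ 2)) (addrC b a); apply.
(* The right side minus the left side is exactly the sum of the four products [h1], .., [h4]. *)
have h1 : 0 <= (2^-1 - a) * (a - b) by apply: mulr_ge0; lra.
have h2 : 0 <= b * (1 - a - b - c - d) by apply: mulr_ge0; lra.
have h3 : 0 <= c * (b - c) by apply: mulr_ge0; lra.
have h4 : 0 <= d * (b - d) by apply: mulr_ge0; lra.
by lra.
Qed.

Lemma top_two (P12 P13 P14 P23 P24 P34 : Prop) (a b c d : R) :
  (c <= a -> d <= a -> c <= b -> d <= b -> P12) ->
  (b <= a -> d <= a -> b <= c -> d <= c -> P13) ->
  (b <= a -> c <= a -> b <= d -> c <= d -> P14) ->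
  (a <= b -> d <= b -> a <= c -> d <= c -> P23) ->
  (a <= b -> c <= b -> a <= d -> c <= d -> P24) ->
  (a <= c -> b <= c -> a <= d -> b <= d -> P34) ->
  [\/ [\/ P12 | P13], [\/ P14 | P23] | [\/ P24 | P34]].
Proof.
move=> H12 H13 H14 H23 H24 H34.
have [ab|/ltW ba] := leP a b; have [cd|/ltW dc] := leP c d.
- have [h1|/ltW h1] := leP d a; first by constructor 1; left; apply: H12; lra.
  have [h2|/ltW h2] := leP b c; first by constructor 3; right; apply: H34; lra.
  by constructor 3; left; apply: H24; lra.
- have [h1|/ltW h1] := leP c a; first by constructor 1; left; apply: H12; lra.
  have [h2|/ltW h2] := leP b d; first by constructor 3; right; apply: H34; lra.
  by constructor 2; right; apply: H23; lra.
- have [h1|/ltW h1] := leP d b; first by constructor 1; left; apply: H12; lra.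
  have [h2|/ltW h2] := leP a c; first by constructor 3; right; apply: H34; lra.
  by constructor 2; left; apply: H14; lra.
- have [h1|/ltW h1] := leP c b; first by constructor 1; left; apply: H12; lra.
  have [h2|/ltW h2] := leP a d; first by constructor 3; right; apply: H34; lra.
  by constructor 1; right; apply: H13; lra.
Qed.

Lemma sum_sqr_le_pair (a b c d : R) : 0 <= a -> 0 <= b -> 0 <= c -> 0 <= d ->
    a <= 2^-1 -> b <= 2^-1 -> c <= 2^-1 -> d <= 2^-1 -> a + b + c + d <= 1 ->
  let s := a ^+ 2 + b ^+ 2 + c ^+ 2 + d ^+ 2 in
  [\/ [\/ s <= (a + b) / 2 | s <= (a + c) / 2],
      [\/ s <= (a + d) / 2 | s <= (b + c) / 2]
    | [\/ s <= (b + d) / 2 | s <= (c + d) / 2]].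
Proof.
move=> a0 b0 c0 d0 ha hb hc hd hs s.
have t2 (x y z t : R) : x ^+ 2 + y ^+ 2 + z ^+ 2 + t ^+ 2 = s -> 0 <= z -> 0 <= t -> x <= 2^-1 ->
    y <= 2^-1 -> x + y + z + t <= 1 -> z <= x -> t <= x -> z <= y -> t <= y -> s <= (x + y) / 2.
  by move=> <-; exact: sum_sqr_le_top2.
by apply: (@top_two _ _ _ _ _ _ a b c d) => h1 h2 h3 h4;
  [apply: (t2 a b c d)|apply: (t2 a c b d)|apply: (t2 a d b c)|apply: (t2 b c a d)
  |apply: (t2 b d a c)|apply: (t2 c d a b)] => //; rewrite /s; ring || lra.
Qed.

(* The points of norm 1/2 next to a Hurwitz integer are the vertices of its
   24-cell; the inequality says that the point lies in the ball having the
   segment from the centre to the closest vertex as a diameter. *)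
Lemma deep_pair x : exists a d, [/\ hurwitz a, hurwitz (d * pp), ~ hurwitz d &
  nq (x - a) + nq (x - d) <= 2^-1].
Proof.
have [a ha va] := hurwitz_round x.
(* For y = x - a and a vertex h of norm 1/2, nq y + nq (y - h) = 2 nq y - 2 qre (conj y h) + 1/2, so
   the bound on nq y is what is required. The vertex has the signs of the two largest coordinates of
   y. *)
suff [m [n [p [q [[s sE] n2 le]]]]] : exists m n p q : int,
    [/\ exists s : int, m + n + p + q = 2 * s, m ^+ 2 + n ^+ 2 + p ^+ 2 + q ^+ 2 = 2 &
    nq (x - a) <= qre (qconj (x - a) * half_int m n p q)].
  exists a, (a + half_int m n p q).
  have nh : nq (half_int m n p q) = 2^-1.
    have := congr1 (fun z : int => z%:~R : R) n2.
    by rewrite !rmorphD !rmorphXn /nq /= => n2'; lra.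
  split => //.
  - rewrite mulrDl; apply: hurwitzD; last exact: (half_int_pp sE).
    by apply: hurwitzM => //; exact: hurwitz_pp.
  - move=> hd; have hh : hurwitz (half_int m n p q).
      have -> : half_int m n p q = a + half_int m n p q - a by qring.
      exact: hurwitzB.
    have h0 : half_int m n p q = 0 by apply: hurwitz_nq_lt1 => //; rewrite nh; lra.
    by move: nh; rewrite h0 nq0; lra.
  - have -> : x - (a + half_int m n p q) = (x - a) - half_int m n p q by qring.
    by rewrite (nqB (x - a) (half_int m n p q)) nh; lra.
case: va; move: (x - a) => e; rewrite /nq.
have [s1 [o1 a1]] := real_sign (qre e); have [s2 [o2 a2]] := real_sign (qi e).
have [s3 [o3 a3]] := real_sign (qj e); have [s4 [o4 a4]] := real_sign (qk e).
move=> la lb lc ld ls.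
have sq (t : R) : t ^+ 2 = `|t| ^+ 2 by rewrite real_normK ?num_real.
have si (s : int) : s = 1 \/ s = -1 -> s ^+ 2 = 1 by case=> ->.
have odd_ (s t : int) : s = 1 \/ s = -1 -> t = 1 \/ t = -1 ->
    exists r, s + t = 2 * r.
  by move=> [->|->] [->|->]; [exists 1|exists 0|exists 0|exists (-1)].
rewrite (sq (qre e)) (sq (qi e)) (sq (qj e)) (sq (qk e)).
have fin (m n p q : int) : (exists r, m + n + p + q = 2 * r) ->
    m ^+ 2 + n ^+ 2 + p ^+ 2 + q ^+ 2 = 2 ->
    `|qre e| ^+ 2 + `|qi e| ^+ 2 + `|qj e| ^+ 2 + `|qk e| ^+ 2 <=
    (m%:~R * qre e + n%:~R * qi e + p%:~R * qj e + q%:~R * qk e) / 2 ->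
    exists m n p q : int,
    [/\ exists s : int, m + n + p + q = 2 * s, m ^+ 2 + n ^+ 2 + p ^+ 2 + q ^+ 2 = 2 &
    `|qre e| ^+ 2 + `|qi e| ^+ 2 + `|qj e| ^+ 2 + `|qk e| ^+ 2
      <= qre (qconj e * half_int m n p q)].
  move=> h1 h2 h3; exists m, n, p, q; split=> //; apply: (le_trans h3).
  by rewrite !qprojE !half_intE; lra.
have [r12 e12] := odd_ _ _ o1 o2; have [r13 e13] := odd_ _ _ o1 o3.
have [r14 e14] := odd_ _ _ o1 o4; have [r23 e23] := odd_ _ _ o2 o3.
have [r24 e24] := odd_ _ _ o2 o4; have [r34 e34] := odd_ _ _ o3 o4.
have z2 : (0 : int) ^+ 2 = 0 by [].
have f12 := fin s1 s2 0 0; have f13 := fin s1 0 s3 0; have f14 := fin s1 0 0 s4.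
have f23 := fin 0 s2 s3 0; have f24 := fin 0 s2 0 s4; have f34 := fin 0 0 s3 s4.
rewrite !mul0r !addr0 ?add0r ?z2 ?(si _ o1) ?(si _ o2) ?(si _ o3) ?(si _ o4) ?addr0 ?add0r -?a1 -?a2 -?a3 -?a4 in f12 f13 f14 f23 f24 f34.
move/(_ (ex_intro _ r12 e12) erefl) in f12.
move/(_ (ex_intro _ r13 e13) erefl) in f13.
move/(_ (ex_intro _ r14 e14) erefl) in f14.
move/(_ (ex_intro _ r23 e23) erefl) in f23.
move/(_ (ex_intro _ r24 e24) erefl) in f24.
move/(_ (ex_intro _ r34 e34) erefl) in f34.
have [] := sum_sqr_le_pair (normr_ge0 (qre e)) (normr_ge0 (qi e))
  (normr_ge0 (qj e)) (normr_ge0 (qk e)) la lb lc ld ls.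
- by case; [exact: f12|exact: f13].
- by case; [exact: f14|exact: f23].
- by case; [exact: f24|exact: f34].
Qed.
End HalfIntegers.

Section ImaginaryParts.
Variable R : realType.
Local Notation Q := (quat R).
Local Notation pp := (pp R).
Implicit Types x y b : Q.

Definition im_dist x y : R :=
  (qi x - qi y) ^+ 2 + (qj x - qj y) ^+ 2 + (qk x - qk y) ^+ 2.

Lemma nq_im x y : nq (x - y) = (qre x - qre y) ^+ 2 + im_dist x y.
Proof. by rewrite /nq /im_dist !qprojE; ring. Qed.

(** Rounding the coordinate of largest error u the other way changes the parity of the sum, at a
    cost of at most (1-u)^2 + 2 u^2 = 1 - u (2 - 3 u), which is below 1 unless u = 0. *)
Lemma flip1 (x y z : R) (l m n : int) :
  `|x - l%:~R| <= 2^-1 -> `|y - m%:~R| <= `|x - l%:~R| ->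
  `|z - n%:~R| <= `|x - l%:~R| ->
  exists s : int, (s = 1 \/ s = -1) /\
   let d := (x - (l + s)%:~R) ^+ 2 + (y - m%:~R) ^+ 2 + (z - n%:~R) ^+ 2 in
   d <= 1 /\ (d < 1 \/ [/\ x = l%:~R, y = m%:~R & z = n%:~R]).
Proof.
move=> hl hm hn.
have [s os sE] : exists2 s : int, s = 1 \/ s = -1 &
    (x - (l + s)%:~R) ^+ 2 = (1 - `|x - l%:~R|) ^+ 2.
  have [t0|t0] := leP 0 (x - l%:~R).
    by exists 1; [left|rewrite ger0_norm // rmorphD /=; ring].
  by exists (-1); [right|rewrite ltr0_norm // rmorphB /=; ring].
exists s; split=> // d.
have [u0|u0] := eqVneq x l%:~R.
  have z0 (t : R) : `|t| <= `|x - l%:~R| -> t = 0.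
    by rewrite u0 subrr normr0 normr_le0 => /eqP.
  have y0 := z0 _ hm; have {}z0 := z0 _ hn.
  rewrite /d sE y0 z0 u0 subrr normr0 !subr0 expr1n expr0n /= !addr0.
  by split=> //; right; split=> //; apply/eqP; rewrite -subr_eq0 ?y0 ?z0.
have {}u0 : 0 < `|x - l%:~R| by rewrite normr_gt0 subr_eq0.
suff dl : d < 1 by split; [exact: ltW|left].
have sq (t : R) : t ^+ 2 = `|t| ^+ 2 by rewrite real_normK ?num_real.
rewrite /d sE (sq (y - _)) (sq (z - _)).
move: hl hm hn u0 (normr_ge0 (y - m%:~R)) (normr_ge0 (z - n%:~R)).
move: `|x - l%:~R| `|y - m%:~R| `|z - n%:~R| => u v w u2 vu wu u0 v0 w0.
have h1 : v ^+ 2 <= u ^+ 2 by rewrite ler_pXn2r ?nnegrE //; lra.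
have h2 : w ^+ 2 <= u ^+ 2 by rewrite ler_pXn2r ?nnegrE //; lra.
have h3 : 0 < u * (2 - 3 * u) by apply: mulr_gt0; lra.
by lra.
Qed.

Lemma flip3 (x y z : R) (l m n : int) :
  `|x - l%:~R| <= 2^-1 -> `|y - m%:~R| <= 2^-1 -> `|z - n%:~R| <= 2^-1 ->
  exists l' m' n' s : int, [/\ s = 1 \/ s = -1, l' + m' + n' = l + m + n + s &
   let d := (x - l'%:~R) ^+ 2 + (y - m'%:~R) ^+ 2 + (z - n'%:~R) ^+ 2 in
   d <= 1 /\ (d < 1 \/ [/\ x = l%:~R, y = m%:~R & z = n%:~R])].
Proof.
move=> hl hm hn; set goal := ex _.
have X : `|y - m%:~R| <= `|x - l%:~R| -> `|z - n%:~R| <= `|x - l%:~R| -> goal.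
  move=> h1 h2; have [s [os [d1 d2]]] := flip1 hl h1 h2.
  by exists (l + s), m, n, s; split => //; ring.
have Y : `|x - l%:~R| <= `|y - m%:~R| -> `|z - n%:~R| <= `|y - m%:~R| -> goal.
  move=> h1 h2; have [s [os]] := flip1 hm h1 h2.
  rewrite (addrC _ ((x - _) ^+ 2)) => -[d1 d2].
  exists l, (m + s), n, s; split => //; first by ring.
  by split=> //; case: d2 => [|[]]; [left|right].
have Z : `|x - l%:~R| <= `|z - n%:~R| -> `|y - m%:~R| <= `|z - n%:~R| -> goal.
  move=> h1 h2; have [s [os]] := flip1 hn h1 h2.
  rewrite -addrA (addrC ((z - _) ^+ 2)) => -[d1 d2].
  exists l, m, (n + s), s; split => //; first by ring.
  by split=> //; case: d2 => [|[]]; [left|right].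
have [yx|/ltW xy] := leP `|y - m%:~R| `|x - l%:~R|.
  have [zx|/ltW xz] := leP `|z - n%:~R| `|x - l%:~R|; first exact: X.
  by apply: Z => //; apply: le_trans xz.
have [zy|/ltW yz] := leP `|z - n%:~R| `|y - m%:~R|; first exact: Y.
by apply: Z => //; apply: le_trans yz.
Qed.

(* The points sigma with sigma p integral and fixed real part form a coset of
   a scaled face-centred cubic lattice, whose covering radius is 1/2; the
   deep holes are the points of the second alternative. *)
Lemma approx_im (k : int) b : exists s, [/\ hurwitz (s * pp), 2 * qre s = k%:~R,
  im_dist s b <= 4^-1 &
  im_dist s b < 4^-1 \/ exists l m n e : int, k + l + m + n = 2 * e + 1 /\
    [/\ 2 * qi b = l%:~R, 2 * qj b = m%:~R & 2 * qk b = n%:~R]].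
Proof.
have [l hl] := round_real (2 * qi b); have [m hm] := round_real (2 * qj b).
have [n hn] := round_real (2 * qk b).
have dE (l' m' n' : int) : im_dist (half_int R k l' m' n') b =
   ((2 * qi b - l'%:~R) ^+ 2 + (2 * qj b - m'%:~R) ^+ 2 + (2 * qk b - n'%:~R) ^+ 2) / 4.
  by rewrite /im_dist !half_intE; field.
have reE (l' m' n' : int) : 2 * qre (half_int R k l' m' n') = k%:~R.
  by rewrite half_intE; field.
have sq (t : R) : t ^+ 2 = `|t| ^+ 2 by rewrite real_normK ?num_real.
have [e [eE|eE]] := int_parity (k + l + m + n).
  exists (half_int R k l m n).
  have d : im_dist (half_int R k l m n) b < 4^-1.
    rewrite dE !(sq (_ - _)).
    move: hl hm hn (normr_ge0 (2 * qi b - l%:~R)) (normr_ge0 (2 * qj b - m%:~R))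
      (normr_ge0 (2 * qk b - n%:~R)).
    have h (t : R) : t <= 2^-1 -> 0 <= t -> t ^+ 2 <= 4^-1 by nra.
    move=> /h hl /h hm /h hn /hl {}hl /hm {}hm /hn {}hn; lra.
  by split => //; [exact: (half_int_pp R eE)|exact: ltW|left].
have [l' [m' [n' [r [or rE [d1 d2]]]]]] := flip3 hl hm hn.
have [f fE] : exists f, k + l' + m' + n' = 2 * f.
  by case: or rE => -> rE; [exists (e + 1)|exists e]; lia.
exists (half_int R k l' m' n'); split => //; first exact: (half_int_pp R fE).
  by rewrite dE; lra.
rewrite dE; case: d2 => [d2|[x0 y0 z0]]; first by left; lra.
by right; exists l, m, n, e.
Qed.

(** At a deep hole of [approx_im] with k = -1 the doubled coordinates have even sum. Either all are
    even, which is the third alternative, or two are odd, and making the third one odd gives a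
    Hurwitz integer at squared distance exactly 1/4. *)
Lemma approx_im_neg1 b : exists s, [/\ hurwitz (s * pp), qre s = - 2^-1,
  im_dist s b <= 4^-1 &
  [\/ hurwitz s, im_dist s b < 4^-1 | exists l m n : int,
    [/\ qi b = l%:~R, qj b = m%:~R & qk b = n%:~R]]].
Proof.
have [s [h1 h2 h3 [h4|]]] := approx_im (-1) b.
  exists s; split => //; last by constructor 2.
  by move: h2; rewrite rmorphN => h2; lra.
move=> [l [m [n [e [eE [lE mE nE]]]]]].
have sol (a c d : int) : im_dist (half_int R (-1) (2*a+1) (2*c+1) (2*d+1)) b <= 4^-1 ->
  exists s, [/\ hurwitz (s * pp), qre s = - 2^-1,
  im_dist s b <= 4^-1 &
  [\/ hurwitz s, im_dist s b < 4^-1 | exists l m n : int,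
    [/\ qi b = l%:~R, qj b = m%:~R & qk b = n%:~R]]].
  move=> dd; exists (half_int R (-1) (2*a+1) (2*c+1) (2*d+1)).
  have hh : hurwitz (half_int R (-1) (2*a+1) (2*c+1) (2*d+1)).
    have -> : half_int R (-1) (2*a+1) (2*c+1) (2*d+1) =
      Quat (2^-1 + (-1)%:~R) (2^-1 + a%:~R) (2^-1 + c%:~R) (2^-1 + d%:~R).
      by apply: quatP; rewrite half_intE !(rmorphD, rmorphN, rmorphM) /=; field.
    exact: hurwitz_half.
  split => //; last by constructor 1.
    by apply: hurwitzM => //; exact: hurwitz_pp.
  by rewrite half_intE rmorphN; field.
have dE (l' m' n' : int) : im_dist (half_int R (-1) l' m' n') b =
   ((2 * qi b - l'%:~R) ^+ 2 + (2 * qj b - m'%:~R) ^+ 2 + (2 * qk b - n'%:~R) ^+ 2) / 4.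
  by rewrite /im_dist !half_intE; field.
have one_ (c : int) : (2 * c)%:~R - (2 * c + 1)%:~R = -1 :> R.
  by rewrite rmorphD /=; ring.
have [a [aE|aE]] := int_parity l; have [c [cE|cE]] := int_parity m;
  have [d [dE'|dE']] := int_parity n; try by exfalso; lia.
- exists s; split => //; first by move: h2; rewrite rmorphN => h2; lra.
  constructor 3; exists a, c, d; move: lE mE nE; rewrite aE cE dE' !rmorphM /= => *.
  by split; lra.
- by apply: (sol a c d); rewrite dE lE mE nE aE cE dE' one_ !subrr expr0n /=; lra.
- by apply: (sol a c d); rewrite dE lE mE nE aE cE dE' one_ !subrr expr0n /=; lra.
- by apply: (sol a c d); rewrite dE lE mE nE aE cE dE' one_ !subrr expr0n /=; lra.
Qed.

Lemma hurwitz_re_im (k : int) b : exists s, [/\ hurwitz s, 2 * qre s = k%:~R,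
  `|qi s - qi b| <= 2^-1, `|qj s - qj b| <= 2^-1 & `|qk s - qk b| <= 2^-1].
Proof.
have [K [->|->]] := int_parity k.
  have [l hl] := round_real (qi b); have [m hm] := round_real (qj b).
  have [n hn] := round_real (qk b).
  exists (Quat K%:~R l%:~R m%:~R n%:~R); rewrite /= (distrC _ (qi b)) (distrC _ (qj b)) (distrC _ (qk b)); split => //.
    exact: hurwitz_int.
  by rewrite rmorphM.
have [l hl] := round_real (qi b - 2^-1); have [m hm] := round_real (qj b - 2^-1).
have [n hn] := round_real (qk b - 2^-1).
exists (Quat (2^-1 + K%:~R) (2^-1 + l%:~R) (2^-1 + m%:~R) (2^-1 + n%:~R)).
rewrite /= (distrC _ (qi b)) (distrC _ (qj b)) (distrC _ (qk b)) !opprD !addrA; split => //; first exact: hurwitz_half.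
by rewrite rmorphD rmorphM /=; field.
Qed.

(** The units of order 6 are (1 ± i ± j ± k)/2. After the translation by s the point has real part
    in [0, 1/2] and imaginary coordinates in [-1/2, 1/2]; such a point is at distance less than 1
    from the unit with its signs, except 0, whose distance is exactly 1. *)
Lemma near_order6 (k : int) (w0 : Q) : 0 <= qre w0 + k%:~R / 2 <= 2^-1 ->
  exists s, [/\ hurwitz s, 2 * qre s = k%:~R & w0 + s = 0 \/
    exists f, [/\ hurwitz f, nq f = 1, 2 * qre f = 1 & nq (w0 + s - f) < 1]].
Proof.
move=> /andP[r0 r1]; have [s [hs ks hi hj hk]] := hurwitz_re_im k (- w0).
exists s; split => //.
have [E|N] := eqVneq (w0 + s) 0; [by left|right].
move: hi hj hk; rewrite !qcoordE !opprK (addrC (qi s)) (addrC (qj s)) (addrC (qk s)) => hi hj hk.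
have sg (t : R) : exists n : int, (t - (2^-1 + n%:~R)) ^+ 2 = (2^-1 - `|t|) ^+ 2 /\
    (2^-1 + n%:~R) ^+ 2 = 4^-1 :> R.
  have [t0|t0] := leP 0 t.
    by exists 0; rewrite ger0_norm // addr0; split; field.
  by exists (-1); rewrite ltr0_norm // rmorphN; split; field.
have [l [lE l2]] := sg (qi w0 + qi s); have [m [mE m2]] := sg (qj w0 + qj s).
have [n [nE n2]] := sg (qk w0 + qk s).
exists (Quat (2^-1 + 0%:~R) (2^-1 + l%:~R) (2^-1 + m%:~R) (2^-1 + n%:~R)).
split; first exact: hurwitz_half.
- by rewrite /nq /= l2 m2 n2 addr0; field.
- by rewrite /= addr0; field.
rewrite nq_im /im_dist !qcoordE /= lE mE nE addr0.
rewrite ltNge; apply/negP => ge1; move/eqP: N; apply.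
move: ge1 hi hj hk (normr_ge0 (qi w0 + qi s)) (normr_ge0 (qj w0 + qj s))
  (normr_ge0 (qk w0 + qk s)) => ge1 hi hj hk i0 j0 k0.
have a0 : 0 <= qre w0 + qre s by lra.
have a1 : qre w0 + qre s <= 2^-1 by lra.
have p (t : R) : 0 <= t -> t <= 2^-1 -> t / 2 <= t * (1 - t) by nra.
have pa := p _ a0 a1; have pi_ := p _ i0 hi; have pj := p _ j0 hj; have pk := p _ k0 hk.
have tot : (qre w0 + qre s) * (1 - (qre w0 + qre s)) +
  `|qi w0 + qi s| * (1 - `|qi w0 + qi s|) + `|qj w0 + qj s| * (1 - `|qj w0 + qj s|)
  + `|qk w0 + qk s| * (1 - `|qk w0 + qk s|) <= 0 by lra.
have z (t : R) : `|t| <= 0 -> t = 0 by rewrite normr_le0 => /eqP.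
apply: quatP; rewrite !qcoordE.
- by rewrite /=; lra.
- by apply: z; lra.
- by apply: z; lra.
- by apply: z; lra.
Qed.

(** With n the norm and c the largest absolute coordinate, the squared distance is n + 1 - 2 c. If
    it is not below 1, then 2 c <= n <= 4 c^2 yields c >= 1/2. *)
Lemma q8_near1 y : y != 0 -> nq y <= 1 -> exists2 q, q8 q &
  nq (qconj q * y - 1) < 1 \/ 2^-1 <= qre (qconj q * y).
Proof.
rewrite -nq_gt0 => y0 y1; have [q hq [_ [h4 c0]]] := max_coord_nq y.
exists q => //; have [_ q1 _ _] := q8_props hq.
have nE : nq (qconj q * y - 1) = nq y + 1 - 2 * qre (qconj q * y).
  rewrite nqB nqM nq_conj q1 nq1 mul1r mulr1; congr (_ - 2 * _).
  by rewrite qre_conj.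
rewrite nE; have [lt|ge] := ltP (nq y) (2 * qre (qconj q * y)); first by left; lra.
by right; nra.
Qed.
End ImaginaryParts.

(** * Reflection groups and hyperbolic lattices *)

Section Groups.
Variable R : realType.
Local Notation Q := (quat R).

Section Generated.
Variable n : nat.
Local Notation V := 'cV[Q]_n.
Implicit Types (S G : set (V -> V)) (f g h : V -> V).

Lemma generated_group S : is_subgroup (generated S).
Proof.
split; first by move=> G [[]].
- move=> f g hf hg G [gG sG]; have [_ comp _] := gG.
  by apply: comp; [exact: hf|exact: hg].
- by move=> f g hf fg gf G [gG sG]; have [_ _ inv] := gG; apply: (inv f) => //; exact: hf.
Qed.
Lemma generated_gen S g : S g -> generated S g.
Proof. by move=> Sg G [_]; exact. Qed.
Lemma generated_ind S G g : is_subgroup G -> S `<=` G -> generated S g -> G g.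
Proof. by move=> hG SG; apply. Qed.
End Generated.

Section Isometries.
Variables (m n : nat) (L : qlattice R m) (M : qlattice R n).
Variables (f : 'cV[Q]_m -> 'cV[Q]_n) (f' : 'cV[Q]_n -> 'cV[Q]_m).
Hypotheses (fI : isometry L M f) (fK : cancel f f') (f'K : cancel f' f).

Lemma isom_reflection xi r : f \o reflection L xi r \o f' = reflection M xi (f r).
Proof.
have [fD fZ fF _ _] := fI.
apply: funext => v /=; rewrite /reflection.
have fN x : f (- x) = - f x.
  have f0 : f 0 = 0 by apply: (addrI (f 0)); rewrite -fD !addr0.
  by apply: (addrI (f x)); rewrite -fD !subrr.
rewrite fD fN fZ f'K /hnorm -!fF f'K; congr (_ - rscale _ _).
Qed.

Lemma isom_inv : isometry M L f'.
Proof.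
have [fD fZ fF _ fP] := fI.
have fi : injective f by exact: can_inj fK.
split.
- by move=> x y; apply: fi; rewrite fD !f'K.
- by move=> x a; apply: fi; rewrite fZ !f'K.
- by move=> x y; rewrite -fF !f'K.
- by exists f.
- rewrite -fP; apply/seteqP; split => [x [_ [y Ly <-] <-]|x Lx]; first by rewrite fK.
  by exists (f x); rewrite ?fK //; exists x.
Qed.

Lemma conj_group (G : set ('cV[Q]_m -> 'cV[Q]_m)) : is_subgroup G ->
  is_subgroup [set g : 'cV[Q]_n -> 'cV[Q]_n | G (f' \o g \o f)].
Proof.
move=> [G1 GM GV]; split.
- by rewrite /= (_ : _ \o _ = id) //; apply: funext => x; exact: fK.
- move=> g h /= hg hh; have := GM _ _ hg hh.
  by congr G; apply: funext => x /=; rewrite f'K.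
- move=> g h /= hg gh hg'; apply: (GV _ _ hg) => x /=; by rewrite f'K ?gh ?hg' fK.
Qed.
End Isometries.

Lemma isometry_comp m n p (L : qlattice R m) (M : qlattice R n) (N : qlattice R p) f g :
  isometry L M f -> isometry M N g -> isometry L N (g \o f).
Proof.
move=> [fD fZ fF fB fP] [gD gZ gF gB gP]; split => /=.
- by move=> x y /=; rewrite fD gD.
- by move=> x a /=; rewrite fZ gZ.
- by move=> x y /=; rewrite gF fF.
- exact: bij_comp.
- by rewrite -image_comp fP gP.
Qed.

Section Normal.
Variables (n : nat) (L : qlattice R n).
Local Notation V := 'cV[Q]_n.

Lemma Aut_group : is_subgroup (AutL L).
Proof.
split.
- split => //; first by exists id.
  by rewrite image_id.
- by move=> f g hf hg; exact: isometry_comp hg hf.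
- by move=> f g hf fg gf; exact: isom_inv hf fg gf.
Qed.

Lemma Aut_inv g : AutL L g -> exists2 g', AutL L g' & cancel g g' /\ cancel g' g.
Proof.
move=> hg; have [_ _ _ [g' gg' g'g] _] := hg.
by exists g' => //; exact: isom_inv hg gg' g'g.
Qed.

Lemma Reflec_group : is_subgroup (Reflec L). Proof. exact: generated_group. Qed.
Lemma Reflec0_group : is_subgroup (Reflec0 L). Proof. exact: generated_group. Qed.

Lemma Reflec_Aut g : Reflec L g -> AutL L g.
Proof. by apply: generated_ind; [exact: Aut_group|move=> h []]. Qed.

Lemma Reflec_inv g : Reflec L g -> exists2 g', Reflec L g' & cancel g g' /\ cancel g' g.
Proof.
move=> hg; have [g' _ [gg' g'g]] := Aut_inv (Reflec_Aut hg).
by exists g' => //; have [_ _ inv] := Reflec_group; exact: inv hg gg' g'g.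
Qed.

Lemma Reflec_normal g g' h : AutL L g -> cancel g g' -> cancel g' g ->
  Reflec L h -> Reflec L (g \o h \o g').
Proof.
move=> hg gg' g'g; have hg' : AutL L g' := isom_inv hg gg' g'g.
apply: (@generated_ind _ _ [set h : V -> V | Reflec L (g \o h \o g')]).
  exact: conj_group g'g gg' _ Reflec_group.
move=> s [hs [xi [r [h1 h2 h3 sE]]]]; apply: generated_gen; split.
  have [_ comp _] := Aut_group; exact: (comp _ _ (comp _ _ hg hs) hg').
exists xi, (g r); split => //.
  by rewrite /positive_norm /= /hnorm; case: hg => _ _ -> _ _.
by rewrite sE; exact: isom_reflection.
Qed.
End Normal.

Lemma Reflec0_isom m n (L : qlattice R m) (M : qlattice R n) f f' h :
  isometry L M f -> cancel f f' -> cancel f' f ->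
  Reflec0 L h -> Reflec0 M (f \o h \o f').
Proof.
move=> fI fK f'K.
apply: (@generated_ind _ _ [set h : 'cV[Q]_m -> 'cV[Q]_m | Reflec0 M (f \o h \o f')]).
  exact: conj_group f'K fK _ (Reflec0_group M).
move=> s [xi [r [h1 h2 [h3 h4] sE]]]; apply: generated_gen.
exists xi, (f r); split => //; last by rewrite sE; exact: isom_reflection.
case: fI => _ _ fF _ fP; split; first by rewrite -fP; exists r.
by rewrite /hnorm fF.
Qed.

Lemma Reflec_isom m n (L : qlattice R m) (M : qlattice R n) f f' h :
  isometry L M f -> cancel f f' -> cancel f' f ->
  Reflec L h -> Reflec M (f \o h \o f').
Proof.
move=> fI fK f'K.
apply: (@generated_ind _ _ [set h : 'cV[Q]_m -> 'cV[Q]_m | Reflec M (f \o h \o f')]).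
  exact: conj_group f'K fK _ (Reflec_group M).
move=> s [hs [xi [r [h1 h2 h3 sE]]]]; apply: generated_gen; split.
  apply: (isometry_comp (isom_inv fI fK f'K)); exact: (isometry_comp hs fI).
exists xi, (f r); split => //; last by rewrite sE; exact: isom_reflection.
by rewrite /positive_norm /= /hnorm; case: fI => _ _ -> _ _.
Qed.
End Groups.

(** * Sums of a definite lattice and a hyperbolic plane *)

Section Hyperbolic.
Variable R : realType.
Local Notation Q := (quat R).
Local Notation V := 'cV[Q]_(4 + (1 + 1)).
Local Notation W := 'cV[Q]_4.
Implicit Types (u v w : V) (x y z : W) (a b : Q).

Definition la v : W := usubmx v.
Definition mu v : Q := usubmx (dsubmx v) 0 0.
Definition nu v : Q := dsubmx (dsubmx v) 0 0.
Definition ip x y : Q := \sum_i qconj (x i 0) * y i 0.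
Definition nrm x : R := \sum_i nq (x i 0).
Definition bf u v : Q :=
  ip (la u) (la v) + qconj (mu u) * nu v + qconj (nu u) * mu v.

Lemma scalar11 (A : 'M[Q]_1) : A = (A 0 0)%:M.
Proof. by apply/matrixP => i j; rewrite !ord1 mxE eqxx. Qed.

Lemma la_vec3 x a b : la (vec3 x a b) = x. Proof. by rewrite /la /vec3 col_mxKu. Qed.
Lemma mu_vec3 x a b : mu (vec3 x a b) = a.
Proof. by rewrite /mu /vec3 col_mxKd col_mxKu mxE eqxx. Qed.
Lemma nu_vec3 x a b : nu (vec3 x a b) = b.
Proof. by rewrite /nu /vec3 !col_mxKd mxE eqxx. Qed.
Definition vec3E := (la_vec3, mu_vec3, nu_vec3).
Lemma vecP u v : la u = la v -> mu u = mu v -> nu u = nu v -> u = v.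
Proof.
move=> hl hm hn; rewrite -(vsubmxK u) -(vsubmxK v); congr col_mx => //.
rewrite -(vsubmxK (dsubmx u)) -(vsubmxK (dsubmx v)).
by congr col_mx; rewrite (scalar11 (_ _)) [RHS]scalar11; congr (_%:M).
Qed.
Lemma vec3_eta v : vec3 (la v) (mu v) (nu v) = v.
Proof. by apply: vecP; rewrite vec3E. Qed.

Lemma laD u v : la (u + v) = la u + la v. Proof. by apply/matrixP => i j; rewrite !mxE. Qed.
Lemma muD u v : mu (u + v) = mu u + mu v. Proof. by rewrite /mu !mxE. Qed.
Lemma nuD u v : nu (u + v) = nu u + nu v. Proof. by rewrite /nu !mxE. Qed.
Lemma laN u : la (- u) = - la u. Proof. by apply/matrixP => i j; rewrite !mxE. Qed.
Lemma muN u : mu (- u) = - mu u. Proof. by rewrite /mu !mxE. Qed.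
Lemma nuN u : nu (- u) = - nu u. Proof. by rewrite /nu !mxE. Qed.
Lemma rscaleE n (x : 'cV[Q]_n) a i : rscale x a i 0 = x i 0 * a.
Proof. by rewrite /rscale mxE big_ord1 [a%:M _ _]mxE eqxx. Qed.
Lemma rscale_usub m n (x : 'cV[Q]_(m + n)) a : usubmx (rscale x a) = rscale (usubmx x) a.
Proof. by apply/matrixP => i j; rewrite ord1 rscaleE !mxE big_ord1 !mxE eqxx. Qed.
Lemma rscale_dsub m n (x : 'cV[Q]_(m + n)) a : dsubmx (rscale x a) = rscale (dsubmx x) a.
Proof. by apply/matrixP => i j; rewrite ord1 rscaleE !mxE big_ord1 !mxE eqxx. Qed.
Lemma laZ u a : la (rscale u a) = rscale (la u) a. Proof. exact: rscale_usub. Qed.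
Lemma muZ u a : mu (rscale u a) = mu u * a.
Proof. by rewrite /mu rscale_dsub rscale_usub rscaleE. Qed.
Lemma nuZ u a : nu (rscale u a) = nu u * a.
Proof. by rewrite /nu !rscale_dsub rscaleE. Qed.
Definition vlinE := (laD, muD, nuD, laN, muN, nuN, laZ, muZ, nuZ).

Lemma rscaleA n (x : 'cV[Q]_n) a b : rscale (rscale x a) b = rscale x (a * b).
Proof. by apply/matrixP => i j; rewrite ord1 !rscaleE mulrA. Qed.
Lemma rscale1 n (x : 'cV[Q]_n) : rscale x 1 = x.
Proof. by apply/matrixP => i j; rewrite ord1 rscaleE mulr1. Qed.
Lemma rscaleDr n (x : 'cV[Q]_n) a b : rscale x (a + b) = rscale x a + rscale x b.
Proof. by apply/matrixP => i j; rewrite ord1 [RHS]mxE !rscaleE mulrDr. Qed.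
Lemma rscaleDl n (x y : 'cV[Q]_n) a : rscale (x + y) a = rscale x a + rscale y a.
Proof. by apply/matrixP => i j; rewrite ord1 [RHS]mxE !rscaleE mxE mulrDl. Qed.
Lemma rscaleN n (x : 'cV[Q]_n) a : rscale x (- a) = - rscale x a.
Proof. by apply/matrixP => i j; rewrite ord1 [RHS]mxE !rscaleE mulrN. Qed.
Lemma rscaleNl n (x : 'cV[Q]_n) a : rscale (- x) a = - rscale x a.
Proof. by apply/matrixP => i j; rewrite ord1 [RHS]mxE !rscaleE mxE mulNr. Qed.
Lemma rscale0 n (x : 'cV[Q]_n) : rscale x 0 = 0.
Proof. by apply/matrixP => i j; rewrite ord1 rscaleE mulr0 mxE. Qed.
Lemma rscale0l n a : rscale (0 : 'cV[Q]_n) a = 0.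
Proof. by apply/matrixP => i j; rewrite ord1 rscaleE !mxE mul0r. Qed.

Lemma ipDr x y z : ip x (y + z) = ip x y + ip x z.
Proof. by rewrite /ip -big_split; apply: eq_bigr => i _; rewrite mxE mulrDr. Qed.
Lemma ipZr x y a : ip x (rscale y a) = ip x y * a.
Proof. by rewrite /ip mulr_suml; apply: eq_bigr => i _; rewrite rscaleE mulrA. Qed.
Lemma ipC x y : qconj (ip x y) = ip y x.
Proof.
by rewrite /ip qconj_sum; apply: eq_bigr => i _; rewrite qconjM qconjK.
Qed.
Lemma ipDl x y z : ip (x + y) z = ip x z + ip y z.
Proof. by rewrite -ipC ipDr qconjD !ipC. Qed.
Lemma ipZl x y a : ip (rscale x a) y = qconj a * ip x y.
Proof. by rewrite -ipC ipZr qconjM ipC. Qed.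
Lemma ipNr x y : ip x (- y) = - ip x y.
Proof. by rewrite /ip -sumrN; apply: eq_bigr => i _; rewrite mxE mulrN. Qed.
Lemma ipNl x y : ip (- x) y = - ip x y.
Proof. by rewrite -ipC ipNr qconjN ipC. Qed.
Lemma ip0r x : ip x 0 = 0.
Proof. by rewrite /ip big1 // => i _; rewrite mxE mulr0. Qed.
Lemma ip0l x : ip 0 x = 0. Proof. by rewrite -ipC ip0r qconj0. Qed.
Lemma rq_sum (I : finType) (F : I -> R) : rq (\sum_i F i) = \sum_i rq (F i).
Proof. exact: (big_morph _ (@rqD R) (@rq0 R)). Qed.
Lemma ip_nrm x : ip x x = rq (nrm x).
Proof. by rewrite /nrm rq_sum; apply: eq_bigr => i _; rewrite mul_conjq. Qed.
Lemma nrm_ge0 x : 0 <= nrm x.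
Proof. by apply: sumr_ge0 => i _; exact: nq_ge0. Qed.
Lemma nrm_eq0 x : nrm x = 0 -> x = 0.
Proof.
move=> /eqP; rewrite psumr_eq0 => [/allP h|i _]; last exact: nq_ge0.
apply/matrixP => i j; rewrite ord1 mxE; apply/eqP; rewrite -nq_eq0.
exact: (h i (mem_index_enum _)).
Qed.
Lemma nrm_coord x : nrm x != 0 -> exists k, x k 0 != 0.
Proof.
move=> x0; apply/existsP; apply: contraNT x0; rewrite negb_exists => /forallP y0.
by rewrite /nrm big1 // => i _; rewrite (eqP (negbNE (y0 i))) nq0.
Qed.
Lemma nrmZ x a : nrm (rscale x a) = nrm x * nq a.
Proof. by rewrite /nrm mulr_suml; apply: eq_bigr => i _; rewrite rscaleE nqM. Qed.
Lemma nrmD x y : nrm (x + y) = nrm x + nrm y + 2 * qre (ip x y).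
Proof.
have := ip_nrm (x + y); rewrite ipDr !ipDl !ip_nrm -(ipC x y) => /(congr1 (@qre R)).
by rewrite !qcoordE qre_conj /=; lra.
Qed.
Lemma nrmN x : nrm (- x) = nrm x.
Proof. by apply: eq_bigr => i _; rewrite mxE nqN. Qed.
Lemma nrmB x y : nrm (x - y) = nrm x + nrm y - 2 * qre (ip x y).
Proof. by rewrite nrmD nrmN ipNr qreN mulrN. Qed.

Lemma bfDr u v w : bf u (v + w) = bf u v + bf u w.
Proof. by rewrite /bf laD muD nuD ipDr !mulrDr [RHS]addrACA; congr (_ + _); rewrite addrACA. Qed.
Lemma bfZr u v a : bf u (rscale v a) = bf u v * a.
Proof. by rewrite /bf !vlinE ipZr !mulrDl !mulrA. Qed.
Lemma bfC u v : qconj (bf u v) = bf v u.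
Proof. by rewrite /bf !qconjD !qconjM ipC !qconjK addrAC. Qed.
Lemma bfDl u v w : bf (u + v) w = bf u w + bf v w.
Proof. by rewrite -bfC bfDr qconjD !bfC. Qed.
Lemma bfZl u v a : bf (rscale u a) v = qconj a * bf u v.
Proof. by rewrite -bfC bfZr qconjM bfC. Qed.
Lemma bfNr u v : bf u (- v) = - bf u v.
Proof. by rewrite /bf !vlinE ipNr !mulrN !opprD. Qed.
Lemma bfNl u v : bf (- u) v = - bf u v.
Proof. by rewrite -bfC bfNr qconjN bfC. Qed.
Lemma bf_rho v : bf (rho R) v = mu v.
Proof.
by rewrite /bf /rho !vec3E ip0l qconj0 qconj1 mul0r mul1r !add0r.
Qed.
Lemma bf_self v : bf v v = rq (nrm (la v) + 2 * qre (qconj (mu v) * nu v)).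
Proof.
rewrite /bf ip_nrm -addrA rqD; congr (_ + _).
by apply: quatP; rewrite !qprojE ?rqE; ring.
Qed.

(** The definite summand is a parameter so that the Barnes-Wall model and the model over H^4 share
    the theory of reflections, translations and descent steps. *)
Definition lat (P : set W) : qlattice R (4 + (1 + 1)) := dsum (QLattice 1%:M P) (II11 R).

Lemma hform_lat P u v : hform (lat P) u v = bf u v.
Proof.
rewrite /hform /lat /bf /=.
rewrite -(vec3_eta u) -(vec3_eta v) !vec3E /vec3.
rewrite map_col_mx tr_col_mx mul_row_block !mulmx0 add0r addr0.
rewrite mul_row_col mxE -addrA; congr (_ + _).
  rewrite mulmx1 /ip mxE; apply: eq_bigr => i _; by rewrite !mxE.
rewrite map_col_mx tr_col_mx mul_row_block !mulmx0 add0r addr0 !mulmx1 mul_row_col.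
by rewrite !mxE !big_ord1 !mxE eqxx addrC.
Qed.

Lemma points_lat P v : points (lat P) v <-> [/\ P (la v), hurwitz (mu v) & hurwitz (nu v)].
Proof.
rewrite /lat /dsum /=; split => [[h1 h2]|[h1 h2 h3]].
  split => //.
    by have := h2 (lshift 1 0); rewrite /mu !mxE.
  by have := h2 (rshift 1 0); rewrite /nu !mxE.
split => // i; case: (split_ordP i) => j ->; rewrite ord1.
  by move: h2; rewrite /mu !mxE.
by move: h3; rewrite /nu !mxE.
Qed.

Lemma bw_lat : bw_hyperbolic R = lat (points (barnes_wall R)).
Proof. by []. Qed.

Lemma translationE x a v : translation x a v = vec3 (la v + rscale x (mu v)) (mu v)
  (nu v - ip x (la v) + (a - rq (nrm x / 2)) * mu v).
Proof.
have hf y z : hform (barnes_wall R) y z = ip y z.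
  rewrite /hform /= mulmx1 mxE; apply: eq_bigr => i _; by rewrite !mxE.
rewrite /translation /hnorm !hf -/(la v) -/(mu v) -/(nu v) ip_nrm.
congr (vec3 _ _ (_ + (_ - _) * _)); rewrite (natq R 2) rqM; congr (_ * _).
have n0 : rq 2 != 0 :> Q by rewrite -nq_eq0 nq_rq expf_neq0 // pnatr_eq0.
by apply: (mulrI (x := rq 2)); rewrite ?unitq // quat_mulxV // -rqM divff // pnatr_eq0.
Qed.
End Hyperbolic.

Section Admissible.
Variable R : realType.
Local Notation Q := (quat R).
Local Notation V := 'cV[Q]_(4 + (1 + 1)).
Local Notation W := 'cV[Q]_4.
Implicit Types (u v w r : V) (x y z : W) (a b c xi : Q).

Record admissible (P : set W) : Prop := Admissible {
  adm0 : P 0;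
  admD : forall x y, P x -> P y -> P (x + y);
  admZ : forall x a, P x -> hurwitz a -> P (rscale x a);
  adm_ip : forall x y, P x -> P y -> hurwitz (ip x y) }.

Variables (P : set W) (aP : admissible P).
Local Notation L := (lat P).

Lemma admN x : P x -> P (- x).
Proof.
move=> Px; rewrite -(rscale1 (- x)) rscaleNl -rscaleN; apply: (admZ aP) => //.
by apply: hurwitzN; exact: hurwitz1.
Qed.
Lemma admB x y : P x -> P y -> P (x - y).
Proof. by move=> Px Py; apply: (admD aP) => //; apply: admN. Qed.

Lemma ptsD u v : points L u -> points L v -> points L (u + v).
Proof.
move=> /points_lat[u1 u2 u3] /points_lat[v1 v2 v3]; apply/points_lat.
by rewrite !vlinE; split; [exact: (admD aP)|exact: hurwitzD|exact: hurwitzD].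
Qed.
Lemma ptsZ u a : points L u -> hurwitz a -> points L (rscale u a).
Proof.
move=> /points_lat[u1 u2 u3] ha; apply/points_lat.
by rewrite !vlinE; split; [exact: (admZ aP)|exact: hurwitzM|exact: hurwitzM].
Qed.
Lemma ptsN u : points L u -> points L (- u).
Proof.
move=> /points_lat[u1 u2 u3]; apply/points_lat.
by rewrite !vlinE; split; [exact: admN|exact: hurwitzN|exact: hurwitzN].
Qed.
Lemma ptsB u v : points L u -> points L v -> points L (u - v).
Proof. by move=> hu hv; apply: ptsD => //; apply: ptsN. Qed.
Lemma pts_bf u v : points L u -> points L v -> hurwitz (bf u v).
Proof.
move=> /points_lat[u1 u2 u3] /points_lat[v1 v2 v3].
do 2?[apply: hurwitzD]; [exact: (adm_ip aP)| |].
  by apply: hurwitzM => //; apply: hurwitz_conj.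
by apply: hurwitzM => //; apply: hurwitz_conj.
Qed.
Lemma pts_vec3 x a b : P x -> hurwitz a -> hurwitz b -> points L (vec3 x a b).
Proof. by move=> hx ha hb; apply/points_lat; rewrite !vec3E. Qed.
Lemma pts_rho : points L (rho R).
Proof. by apply: pts_vec3; [exact: (adm0 aP)|exact: hurwitz0|exact: hurwitz1]. Qed.

(** Covers the xi-reflections in short roots, with c = 1 - xi and t = 1, and the biflections in norm
    2 vectors, with c = 1 and t = 2. The equation on c expresses unitarity, and the inverse has
    [qconj c] for c. *)
Lemma isom_rank1 r c (t : R) : bf r r = rq t ->
  qconj c * rq t * c = c + qconj c ->
  (forall v, points L v -> points L (rscale r (c * bf r v)) /\
     points L (rscale r (qconj c * bf r v))) ->
  AutL L (fun v => v - rscale r (c * bf r v)).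
Proof.
move=> rr cc hP.
have canc d : qconj d * rq t * d = d + qconj d ->
    cancel (fun v => v - rscale r (d * bf r v)) (fun v => v - rscale r (qconj d * bf r v)).
  move=> dd v /=; rewrite bfDr bfNr bfZr rr -addrA -opprD -rscaleDr.
  suff -> : d * bf r v + qconj d * (bf r v - rq t * (d * bf r v)) = 0.
    by rewrite rscale0 subr0.
  rewrite mulrBr !mulrA.
  have -> : qconj d * rq t * d = d + qconj d by [].
  by rewrite mulrDl opprD addrA -opprD subrr.
have cc' : qconj (qconj c) * rq t * qconj c = qconj c + qconj (qconj c).
  rewrite qconjK (addrC (qconj c)) -cc -!rqC -!mulrA; congr (_ * _).
  by rewrite mulq_conj mul_conjq.
split.
- by move=> x y; rewrite bfDr mulrDr rscaleDr opprD addrACA.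
- by move=> x a; rewrite bfZr mulrA -rscaleA rscaleDl rscaleNl.
- move=> x y; rewrite !hform_lat bfDr !bfDl bfNl !bfNr !bfZl !bfZr bfNl bfZl rr -(bfC r x).
  move: (bf r x) (bf r y) (bf x y) => X Y Z.
  rewrite !qconjM.
  rewrite mulNr opprK.
  have -> : qconj X * qconj c * rq t * (c * Y) = qconj X * (c + qconj c) * Y.
    by rewrite -cc !mulrA.
  by rewrite mulrDr mulrDl mulrA addKr subrK.
- exists (fun v => v - rscale r (qconj c * bf r v)); first exact: canc.
  by move=> v; have := canc _ cc' v; rewrite qconjK.
- apply/seteqP; split => [x [y Ly <-]|x Lx].
    by apply: ptsB => //; have [] := hP _ Ly.
  exists (x - rscale r (qconj c * bf r x)).
    by apply: ptsB => //; have [] := hP _ Lx.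
  by have := canc _ cc' x; rewrite qconjK.
Qed.

Lemma refl_short xi r v : bf r r = 1 ->
  reflection L xi r v = v - rscale r ((1 - xi) * bf r v).
Proof. by move=> rr; rewrite /reflection /hnorm !hform_lat rr divr1. Qed.

Lemma refl_short_Aut xi r : hurwitz xi -> nq xi = 1 -> points L r -> bf r r = 1 ->
  AutL L (reflection L xi r).
Proof.
move=> hx nx Lr rr.
have -> : reflection L xi r = fun v => v - rscale r ((1 - xi) * bf r v).
  by apply: funext => v; exact: refl_short.
apply: (@isom_rank1 r (1 - xi) 1) => //.
  rewrite rq1 mulr1 mul_conjq nqB nq1 nx.
  by apply: quatP; rewrite !qprojE ?rqE; ring.
have h1 : hurwitz (1 - xi) by apply: hurwitzB => //; exact: hurwitz1.
move=> v Lv; split; apply: ptsZ => //; apply: hurwitzM => //.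
- exact: pts_bf.
- exact: hurwitz_conj.
- exact: pts_bf.
Qed.

Lemma refl_id r : reflection L 1 r = id.
Proof.
by apply: funext => v; rewrite /reflection subrr !mul0r rscale0 subr0.
Qed.

Lemma refl_Reflec0 xi r : hurwitz xi -> nq xi = 1 -> points L r -> bf r r = 1 ->
  Reflec0 L (reflection L xi r).
Proof.
move=> hx nx Lr rr; have [->|/eqP x1] := eqVneq xi 1.
  by rewrite refl_id; have [] := Reflec0_group L.
apply: generated_gen; exists xi, r; split => //; first by apply/is_hunitP.
by split => //; rewrite /hnorm hform_lat.
Qed.

Lemma Reflec0_Reflec g : Reflec0 L g -> Reflec L g.
Proof.
apply: generated_ind; first exact: Reflec_group.
move=> h [xi [r [/[dup] hu /is_hunitP[hx nx] x1 [Lr]]]].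
rewrite /hnorm hform_lat => rr hE; apply: generated_gen; split.
  by rewrite hE; exact: refl_short_Aut.
exists xi, r; split => //; first exact: hunit_root.
by rewrite /positive_norm /= /hnorm hform_lat rr /= ltr01.
Qed.

Lemma Reflec0_Aut g : Reflec0 L g -> AutL L g.
Proof. by move/Reflec0_Reflec/Reflec_Aut. Qed.

Lemma Reflec0_inv g : Reflec0 L g ->
  exists2 g', Reflec0 L g' & cancel g g' /\ cancel g' g.
Proof.
move=> hg; have [g' _ [gg' g'g]] := Aut_inv (Reflec0_Aut hg).
by exists g' => //; have [_ _ inv] := Reflec0_group L; exact: inv hg gg' g'g.
Qed.

Lemma Reflec0_comp f g : Reflec0 L f -> Reflec0 L g -> Reflec0 L (f \o g).
Proof. by have [_ comp _] := Reflec0_group L; exact: comp. Qed.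
Lemma Reflec_comp f g : Reflec L f -> Reflec L g -> Reflec L (f \o g).
Proof. by have [_ comp _] := Reflec_group L; exact: comp. Qed.
Lemma Aut_comp f g : AutL L f -> AutL L g -> AutL L (f \o g).
Proof. by have [_ comp _] := Aut_group L; exact: comp. Qed.

Lemma bifl_E r v : bf r r = rq 2 -> reflection L (-1) r v = v - rscale r (bf r v).
Proof.
move=> rr; rewrite /reflection /hnorm !hform_lat rr opprK; congr (_ - rscale _ _).
have -> : 1 + 1 = rq 2 :> Q by rewrite -(natq R 2).
by rewrite rqC mulrK // unitq -nq_eq0 nq_rq expf_neq0 // pnatr_eq0.
Qed.

Lemma bifl_Reflec r : points L r -> bf r r = rq 2 -> Reflec L (reflection L (-1) r).
Proof.
move=> Lr rr; apply: generated_gen; split; last first.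
  exists (-1), r; split => //.
  - by exists 2 => //; rewrite sqrrN expr1n.
  - by move=> /(congr1 (@qre R)); rewrite qreN /= => h; clear rr; lra.
  - by rewrite /positive_norm /= /hnorm hform_lat rr /= ltr0n.
have -> : reflection L (-1) r = fun v => v - rscale r (1 * bf r v).
  by apply: funext => v; rewrite mul1r; exact: bifl_E.
apply: (@isom_rank1 r 1 2) => //.
  by rewrite qconj1 mul1r mulr1 -(natq R 2).
move=> v Lv; rewrite qconj1 mul1r; split; apply: ptsZ => //; exact: pts_bf.
Qed.

Lemma AutE g : AutL L g -> [/\ forall x y : V, g (x + y) = g x + g y,
  forall (x : V) a, g (rscale x a) = rscale (g x) a, forall x y : V, bf (g x) (g y) = bf x y
  & forall x : V, points L x -> points L (g x)].
Proof.
move=> [gD gZ gF _ gP]; split => //.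
  by move=> x y; have := gF x y; rewrite !hform_lat.
by move=> x Lx; rewrite -gP; exists x.
Qed.
End Admissible.

(** * Translations fixing [rho], and the root step of the descent *)

Section Cusp.
Variable R : realType.
Local Notation Q := (quat R).
Local Notation V := 'cV[Q]_(4 + (1 + 1)).
Local Notation W := 'cV[Q]_4.
Local Notation rho := (rho R).
Implicit Types (u v w r : V) (x y : W) (a b c z : Q) (f g : V -> V).

Lemma nrm0 : nrm 0 = 0 :> R.
Proof. by rewrite /nrm big1 // => i _; rewrite mxE nq0. Qed.

Definition imq a : Q := a - rq (qre a).

Lemma hurwitz_rq (t : R) : hurwitz (rq t) -> exists k : int, t = k%:~R.
Proof.
move=> /hurwitzP[a [b [c [d [ta ib _ _]]]]]; exists (- b); rewrite rmorphN; lra.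
Qed.

(** The law of a Heisenberg group: the cocycle is the imaginary part of the pairing, and the
    translations [translation 0 z] are central. *)
Lemma transl_comp x y z (w : Q) v :
  translation x z (translation y w v) = translation (x + y) (z + w - imq (ip x y)) v.
Proof.
rewrite !translationE; apply: vecP; rewrite !vec3E //.
  by rewrite rscaleDl (addrC (rscale x _)) addrA.
rewrite ipDr ipDl ipZr nrmD /imq.
have -> : rq ((nrm x + nrm y + 2 * qre (ip x y)) / 2) =
    rq (nrm x / 2) + rq (nrm y / 2) + rq (qre (ip x y)) :> Q.
  by rewrite -!rqD; congr rq; field.
move: (rq (nrm x / 2)) (rq (nrm y / 2)) (rq (qre (ip x y))) => A B C.
move: (ip x y) (ip x (la v)) (ip y (la v)) => a b c; have -> : z + w - (a - C) - (A + B + C) = (w - B) + (z - A) - a by qring.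
rewrite [(_ + _ - a) * _]mulrBl [(w - B + _) * _]mulrDl; move: ((w - B) * mu v) ((z - A) * mu v) (a * mu v) => X Y Z; qring.
Qed.

Lemma transl0 v : translation 0 0 v = v.
Proof.
rewrite translationE; apply: vecP; rewrite !vec3E //.
  by rewrite rscale0l addr0.
by rewrite nrm0 ip0l mul0r rq0 subr0 subrr mul0r addr0.
Qed.
Lemma imq_real a : qconj a = a -> imq a = 0.
Proof.
move=> h; rewrite /imq; have := congr1 (@qi R) h; have := congr1 (@qj R) h.
have := congr1 (@qk R) h; rewrite qk_conj qj_conj qi_conj => hk hj hi; clear h.
by apply: quatP; rewrite !qprojE ?rqE; lra.
Qed.
Lemma transl_inv x z : cancel (translation x z) (translation (- x) (- z)).
Proof.
move=> v; rewrite transl_comp addNr (_ : - z + z - _ = 0) ?transl0 //.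
by rewrite addNr imq_real ?subr0 // ipC ipNl ipNr.
Qed.
Lemma transl_inv' x z : cancel (translation (- x) (- z)) (translation x z).
Proof. by move=> v; have := transl_inv (- x) (- z) v; rewrite !opprK. Qed.
Lemma central_comp z (w : Q) v : translation 0 z (translation 0 w v) = translation 0 (z + w) v.
Proof. by rewrite transl_comp addr0 ip0l imq_real ?subr0 // qconj0. Qed.

Lemma central_add (G : set (V -> V)) z (w : Q) : is_subgroup G ->
  G (translation 0 z) -> G (translation 0 w) -> G (translation 0 (z + w)).
Proof.
move=> [_ GM _] hz hw; have := GM _ _ hz hw; congr (G _).
by apply: funext => v /=; rewrite central_comp.
Qed.
Lemma central_opp (G : set (V -> V)) z : is_subgroup G ->
  G (translation 0 z) -> G (translation 0 (- z)).
Proof.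
by move=> [_ _ GV] hz; apply: (GV _ _ hz) => v; rewrite central_comp ?addNr ?subrr transl0.
Qed.
Lemma central_mul (G : set (V -> V)) z (n : int) : is_subgroup G ->
  G (translation 0 z) -> G (translation 0 (z *~ n)).
Proof.
move=> gG hz; have pos (m : nat) : G (translation 0 (z *~ m)).
  elim: m => [|m IH]; last by rewrite -(addn1 m) PoszD mulrzDr; exact: central_add.
  rewrite mulr0z (_ : translation 0 0 = id); first by case: gG.
  by apply: funext => v; exact: transl0.
case: (intP n) => [|m|m]; [exact: (pos 0%N)|exact: pos|].
by rewrite mulrNz; apply: central_opp => //; exact: pos.
Qed.

Lemma la_transl x z v : la (translation x z v) = la v + rscale x (mu v).
Proof. by rewrite translationE vec3E. Qed.
Lemma mu_transl x z v : mu (translation x z v) = mu v.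
Proof. by rewrite translationE vec3E. Qed.
Lemma transl_rho x z : translation x z rho = rho.
Proof.
rewrite translationE /Defs.rho; apply: vecP; rewrite !vec3E //.
  by rewrite rscale0 addr0.
by rewrite ip0r mulr0 addr0 subr0.
Qed.

Section WithP.
Variables (P : set W) (aP : admissible P).
Local Notation L := (lat P).

Lemma nrm_int x : P x -> exists k : int, nrm x = k%:~R.
Proof. by move=> Px; apply: hurwitz_rq; rewrite -ip_nrm; exact: (adm_ip aP). Qed.

Lemma transl_Aut x z : P x -> qre z = 0 -> hurwitz (z - rq (nrm x / 2)) ->
  AutL L (translation x z).
Proof.
move=> Px z0 hz.
have pts y a v : P y -> hurwitz (a - rq (nrm y / 2)) -> points L v ->
    points L (translation y a v).
  move=> Py ha /points_lat[v1 v2 v3]; rewrite translationE; apply: pts_vec3 => //.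
    by apply: (admD aP) => //; exact: (admZ aP).
  apply: hurwitzD; last exact: hurwitzM.
  by apply: hurwitzB => //; exact: (adm_ip aP).
split.
- move=> u v; rewrite !translationE; apply: vecP; rewrite !vlinE !vec3E //.
    by rewrite rscaleDr addrACA.
  by rewrite ipDr mulrDr opprD (addrACA (nu u)) [LHS]addrACA.
- move=> u a; rewrite !translationE; apply: vecP; rewrite !vlinE !vec3E //.
    by rewrite rscaleDl rscaleA.
  by rewrite ipZr [RHS]mulrDl (mulrBl _ (nu u)) mulrA.
- move=> u v; rewrite !hform_lat /bf !translationE !vec3E ipDr !ipDl !ipZl !ipZr ip_nrm.
  rewrite -(ipC x (la u)).
  have : qconj (z - rq (nrm x / 2)) = - (z - rq (nrm x / 2)) - rq (nrm x).
    by apply: quatP; rewrite !qprojE ?rqE ?z0; field.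
  move: (z - rq _) => s sE.
  move: (ip (la u) (la v)) (ip x (la u)) (ip x (la v)) (nrm x) sE => a b c t sE.
  move: (mu u) (nu u) (mu v) (nu v) => m n m' n'.
  rewrite !qconjD qconjN qconjM sE !(mulrDl, mulrDr, mulrN, mulNr, mulrA).
  move: (qconj m * n') (qconj n * m') (qconj m * c) (qconj b * m') => X1 X2 X3 X4.
  move: (qconj m * rq t * m') (qconj m * s * m') => X5 X6.
  qring.
- exists (translation (- x) (- z)); [exact: transl_inv|exact: transl_inv'].
- apply/seteqP; split => [_ [v Lv <-]|v Lv]; first exact: pts.
  exists (translation (- x) (- z) v); last exact: transl_inv'.
  apply: pts => //; first exact: (admN aP).
  rewrite nrmN; have -> : - z - rq (nrm x / 2) = - (z - rq (nrm x / 2)) - rq (nrm x).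
    by qfield.
  apply: hurwitzB; first exact: hurwitzN.
  by rewrite -ip_nrm; exact: (adm_ip aP).
Qed.

Lemma transl_exists x : P x -> exists2 z, qre z = 0 & hurwitz (z - rq (nrm x / 2)).
Proof.
move=> Px; have [k ->] := nrm_int Px; have [K [->|->]] := int_parity k.
  exists 0 => //; rewrite sub0r -rqN.
  have -> : - ((2 * K)%:~R / 2) = (- K)%:~R :> R by rewrite rmorphN rmorphM /=; field.
  exact: (hurwitz_int R (- K) 0 0 0).
(* For odd norm the real part of z - x^2/2 is half-integral, so the imaginary coordinates must be
   half-integral as well. *)
exists (Quat 0 2^-1 2^-1 2^-1) => //.
have -> : (Quat 0 2^-1 2^-1 2^-1 : Q) - rq ((2 * K + 1)%:~R / 2) =
  Quat (2^-1 + (- K - 1)%:~R) (2^-1 + 0%:~R) (2^-1 + 0%:~R) (2^-1 + 0%:~R).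
  by rewrite -rqN /rq addqE !(rmorphD, rmorphB, rmorphN, rmorphM) /=; congr Quat; field.
exact: hurwitz_half.
Qed.

(** The last coordinate of g v is forced by pairing with the image of (0; 1, 0), and the nullity of
    that image makes z imaginary. *)
Lemma Aut_transl x g : AutL L g -> (forall v, la (g v) = la v + rscale x (mu v)) ->
  (forall v, mu (g v) = mu v) -> exists2 z, qre z = 0 & g = translation x z.
Proof.
move=> /AutE[gD gZ gF _] gl gm.
pose m : V := vec3 0 1 0; pose a := nu (g m).
have la_m : la (g m) = x by rewrite gl !vec3E add0r rscale1.
have mu_m : mu (g m) = 1 by rewrite gm vec3E.
have n0 : nrm x + 2 * qre a = 0.
  have := gF m m; rewrite !bf_self la_m mu_m -/a qconj1 mul1r !vec3E mulr0 nrm0 mulr0 addr0.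
  by move=> /(congr1 (@qre R)).
exists (rq (nrm x / 2) - rq (nrm x) - qconj a).
  by rewrite !qcoordE qre_conj !rqE; lra.
apply: funext => v; rewrite translationE; apply: vecP; rewrite vec3E //.
have := gF m v; rewrite {1}/bf la_m mu_m gl gm qconj1 mul1r ipDr ipZr ip_nrm -/a.
rewrite /bf !vec3E ip0l qconj1 mul1r qconj0 mul0r addr0 add0r => <-.
move: (rq (nrm x / 2)) (rq (nrm x)) (qconj a) => h N b.
have -> : h - N - b - h = - (N + b) by qring.
by rewrite mulNr mulrDl; move: (N * mu v) (b * mu v) (nu (g v)) (ip _ _) => ????; qring.
Qed.

Lemma null_re v : bf v v = 0 -> mu v != 0 ->
  qre (nu v * (mu v)^-1) = - (nrm (rscale (la v) (mu v)^-1) / 2).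
Proof.
move=> v0 m0; have := v0; rewrite bf_self => /(congr1 (@qre R)).
have n0 : nq (mu v) != 0 by rewrite nq_eq0.
rewrite [LHS]/= qre0 nrmZ nqV qVE // mulrA -rqC qre_rqM qreC => h.
apply: (mulfI n0); rewrite mulrA mulfV // mul1r.
have -> : nq (mu v) * - (nrm (la v) / nq (mu v) / 2) = - (nrm (la v) / 2) by field.
lra.
Qed.

(** Since f has order 6, 1 - f = [qconj f] is a unit, and the reflection sends [mu v] to [qconj f]
    (f - w) [mu v] with w = [bf r v] / [mu v]. *)
Lemma refl_reduce r v (f : Q) : points L r -> bf r r = 1 -> mu r = 1 -> mu v != 0 ->
  hurwitz f -> nq f = 1 -> 2 * qre f = 1 -> nq (bf r v * (mu v)^-1 - f) < 1 ->
  exists2 g, Reflec0 L g & nq (mu (g v)) < nq (mu v).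
Proof.
move=> Lr rr mr m0 hf nf rf lt1.
exists (reflection L f r); first exact: refl_Reflec0.
rewrite refl_short // !vlinE mr mul1r.
have -> : 1 - f = qconj f by apply: quatP; rewrite !qprojE; lra.
have -> : mu v - qconj f * bf r v = qconj f * (f - bf r v * (mu v)^-1) * mu v.
  rewrite mulrBr mulrBl mul_conjq nf rq1 mul1r; congr (_ - _).
  by rewrite -!mulrA quat_mulVx // mulr1.
rewrite !nqM nq_conj nf mul1r -nqN opprB -[X in _ < X]mul1r ltr_pM2r //.
by rewrite nq_gt0.
Qed.

Lemma bf_vec3 x a v : mu v != 0 -> bf (vec3 x 1 a) v * (mu v)^-1 =
  ip x (rscale (la v) (mu v)^-1) + nu v * (mu v)^-1 + qconj a.
Proof.
move=> m0; rewrite /bf !vec3E ipZr qconj1 mul1r !mulrDl -[qconj a * _ * _]mulrA.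
by rewrite quat_mulxV // mulr1.
Qed.

(** For every short root r = (x; 1, a) the quotient [bf r v] / [mu v] has real part (1 - d)/2, where
    d is the squared distance from [la v] / [mu v] to x. For d <= 1 it lies in [0, 1/2], as
    [near_order6] requires; varying a adjusts the imaginary part. *)
Lemma root_step v x : points L v -> bf v v = 0 -> mu v != 0 -> P x ->
  nrm (rscale (la v) (mu v)^-1 - x) <= 1 ->
  (exists s, [/\ points L s, bf s s = 1 & bf s v = 0]) \/
  exists2 g, Reflec0 L g & nq (mu (g v)) < nq (mu v).
Proof.
move=> Lv v0 m0 Px le1; have [k kE] := nrm_int Px.
set y := rscale _ _ in le1.
pose w0 := ip x y + nu v * (mu v)^-1.
have re0 : qre w0 + (1 - k)%:~R / 2 = (1 - nrm (y - x)) / 2.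
  by rewrite qreD null_re // -/y nrmB kE rmorphB /= -(ipC x y) qre_conj; field.
have [|s [hs sE hw]] := @near_order6 R (1 - k) w0.
  by rewrite re0; have := nrm_ge0 (y - x); lra.
pose r : V := vec3 x 1 (qconj s).
have Lr : points L r.
  by apply: pts_vec3 => //; [exact: hurwitz1|exact: hurwitz_conj].
have rr : bf r r = 1.
  rewrite bf_self !vec3E qconj1 mul1r qre_conj sE kE rmorphB /= addrC subrK.
  exact: rq1.
have wE : bf r v * (mu v)^-1 = w0 + s by rewrite bf_vec3 // qconjK.
case: hw => [w00|[f [hf nf rf lt1]]].
  left; exists r; split => //.
  have -> : bf r v = (w0 + s) * mu v by rewrite -wE -mulrA quat_mulVx // mulr1.
  by rewrite w00 mul0r.
right; apply: (refl_reduce Lr rr _ m0 hf nf rf); first by rewrite vec3E.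
by rewrite wE.
Qed.

(** The reflection in (0; 1, f) carries [rho] to a multiple of the opposite null vector (0; 1, 0),
    and the one in (0; 1, f') carries that back to the line of [rho]. *)
Lemma unit_step (f f' : Q) : hurwitz f -> nq f = 1 -> 2 * qre f = 1 ->
  hurwitz f' -> nq f' = 1 -> 2 * qre f' = 1 ->
  exists2 g, Reflec0 L g & g rho = rscale rho (f' * qconj f) /\
    forall v, la (g v) = la v.
Proof.
move=> hf nf rf hf' nf' rf'.
have sh a : hurwitz a -> nq a = 1 -> 2 * qre a = 1 ->
    points L (vec3 0 1 a) /\ bf (vec3 0 1 a) (vec3 0 1 a) = 1.
  move=> ha na ra; split.
    by apply: pts_vec3 => //; [exact: (adm0 aP)|exact: hurwitz1].
  by rewrite bf_self !vec3E qconj1 mul1r ra nrm0 add0r.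
have [L1 r1] := sh _ hf nf rf; have [L2 r2] := sh _ hf' nf' rf'.
exists (reflection L (qconj f') (vec3 0 1 f') \o reflection L f (vec3 0 1 f)).
  apply: (Reflec0_comp); apply: refl_Reflec0 => //.
    exact: hurwitz_conj.
  by rewrite nq_conj.
have e1 : 1 - f = qconj f by apply: quatP; rewrite !qprojE; lra.
have e2 : 1 - qconj f' = f' by apply: quatP; rewrite !qprojE; lra.
split=> [|v] /=; last first.
  by rewrite !refl_short // !vlinE !vec3E !rscale0l !subr0.
have u1 : f * qconj f = 1 by rewrite mulq_conj nf.
have u2 : f' * qconj f' = 1 by rewrite mulq_conj nf'.
rewrite !refl_short // e1 e2.
have -> : bf (vec3 0 1 f) rho = 1.
  by rewrite -bfC bf_rho vec3E qconj1.
rewrite mulr1.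
have -> : rho - rscale (vec3 0 1 f) (qconj f) = vec3 0 (- qconj f) 0.
  apply: vecP; rewrite !vlinE !vec3E; first by rewrite rscale0l subr0.
    by rewrite mul1r sub0r.
  by rewrite u1 subrr.
have -> : bf (vec3 0 1 f') (vec3 0 (- qconj f) 0) = - (qconj f' * qconj f).
  by rewrite /bf !vec3E ip0l mulr0 add0r add0r mulrN.
apply: vecP; rewrite !vlinE !vec3E.
- by rewrite !rscale0l subr0.
- by rewrite mul0r mul1r mulrN mulrA u2 mul1r opprK addNr.
- by rewrite mulrN mulrN opprK add0r mul1r (mulrA f' (qconj f')) u2 mul1r.
Qed.
End WithP.
End Cusp.

Section Units.
Variable R : realType.
Local Notation Q := (quat R).
Implicit Types (a b c : Q).

Lemma hunit_cases a : hurwitz a -> nq a = 1 -> q8 a \/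
  exists s t u v : R, [/\ a = Quat (s / 2) (t / 2) (u / 2) (v / 2),
    s = 1 \/ s = -1, t = 1 \/ t = -1, u = 1 \/ u = -1 & v = 1 \/ v = -1].
Proof.
move=> /hurwitzP[m [x [y [z ->]]]].
have [M [mE|mE]] := int_parity m.
  have -> : hquat R m x y z = Quat M%:~R (M + x)%:~R (M + y)%:~R (M + z)%:~R.
    by rewrite /hquat mE !rmorphD !rmorphM /=; congr Quat; field.
  move: (M + x) (M + y) (M + z) => {}x {}y {}z {mE m}.
  rewrite /nq /= -!rmorphXn -!rmorphD /= => /(intr_inj (x2 := 1)) n1; left.
  have e0 : (0 : int)%:~R = 0 :> R by [].
  have e1 : (1 : int)%:~R = 1 :> R by [].
  have eN : (-1 : int)%:~R = -1 :> R by rewrite rmorphN.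
  have : [\/ [\/ [/\ M = 1, x = 0, y = 0 & z = 0] | [/\ M = -1, x = 0, y = 0 & z = 0]],
    [\/ [/\ M = 0, x = 1, y = 0 & z = 0] | [/\ M = 0, x = -1, y = 0 & z = 0]],
    [\/ [/\ M = 0, x = 0, y = 1 & z = 0] | [/\ M = 0, x = 0, y = -1 & z = 0]] |
    [\/ [/\ M = 0, x = 0, y = 0 & z = 1] | [/\ M = 0, x = 0, y = 0 & z = -1]]].
    have sm (n : int) : n ^+ 2 <= 1 -> n = 0 \/ n = 1 \/ n = -1 by nia.
    have sq (n : int) : 0 <= n ^+ 2 by exact: sqr_ge0.
    have := sq M; have := sq x; have := sq y; have := sq z => z0 y0 x0 M0.
    have [] : [/\ M ^+ 2 <= 1, x ^+ 2 <= 1, y ^+ 2 <= 1 & z ^+ 2 <= 1] by split; lia.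
    move=> /sm hM /sm hx /sm hy /sm hz.
    move: hM hx hy hz n1; clear.
    by move=> [->|[->|->]] [->|[->|->]] [->|[->|->]] [->|[->|->]] //= _;
      (do [by constructor 1; left | by constructor 1; right | by constructor 2; left
       | by constructor 2; right | by constructor 3; left | by constructor 3; right
       | by constructor 4; left | by constructor 4; right]).
  case=> -[] [-> -> -> ->]; rewrite ?e0 ?e1 ?eN /q8 /qI /qJ /qK oneqE !oppqE !oppr0.
  - by constructor 1; left.
  - by constructor 1; right.
  - by constructor 2; left.
  - by constructor 2; right.
  - by constructor 3; left.
  - by constructor 3; right.
  - by constructor 4; left.
  - by constructor 4; right.
have -> : hquat R m x y z = Quat (2^-1 + M%:~R) (2^-1 + (M + x)%:~R)
    (2^-1 + (M + y)%:~R) (2^-1 + (M + z)%:~R).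
  by rewrite /hquat mE !rmorphD !rmorphM /=; congr Quat; field.
move: (M + x) (M + y) (M + z) => {}x {}y {}z {mE m}.
have eqz (n : int) : (2^-1 + n%:~R) ^+ 2 = (n ^+ 2 + n)%:~R + 4^-1 :> R.
  by rewrite rmorphD rmorphXn /=; field.
rewrite /nq /= !eqz => n1; right.
have {}n1 : (M ^+ 2 + M) + (x ^+ 2 + x) + (y ^+ 2 + y) + (z ^+ 2 + z) = 0.
  apply: (@intr_inj R); rewrite [in LHS]rmorphD [in LHS]rmorphD [in LHS]rmorphD /=.
  by move: n1; lra.
have sm (n : int) : 0 <= n ^+ 2 + n by nia.
have := sm M; have := sm x; have := sm y; have := sm z => z0 y0 x0 M0.
have s0 (n : int) : n ^+ 2 + n = 0 -> exists2 s : R, s = 1 \/ s = -1 & 2^-1 + n%:~R = s / 2.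
  move=> h; have [->|->] : n = 0 \/ n = -1 by nia.
    by exists 1; [left|rewrite addr0 mul1r].
  by exists (-1); [right|rewrite rmorphN; field].
have [s hs ->] := s0 M ltac:(lia); have [t ht ->] := s0 x ltac:(lia).
have [u hu ->] := s0 y ltac:(lia); have [v hv ->] := s0 z ltac:(lia).
by exists s, t, u, v.
Qed.

Lemma hurwitz_signs (s t u v : R) : s = 1 \/ s = -1 -> t = 1 \/ t = -1 ->
  u = 1 \/ u = -1 -> v = 1 \/ v = -1 ->
  hurwitz (Quat (s / 2) (t / 2) (u / 2) (v / 2)) /\
  nq (Quat (s / 2) (t / 2) (u / 2) (v / 2)) = 1.
Proof.
have sg (x : R) : x = 1 \/ x = -1 -> exists2 n : int, x / 2 = 2^-1 + n%:~R & x ^+ 2 = 1.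
  case=> ->; first by exists 0; rewrite ?expr1n // addr0 mul1r.
  by exists (-1); rewrite ?sqrrN ?expr1n // rmorphN; field.
move=> /sg[a ha a2] /sg[b hb b2] /sg[c hc c2] /sg[d hd d2]; split.
  by rewrite ha hb hc hd; exact: hurwitz_half.
by rewrite /nq /= !expr_div_n a2 b2 c2 d2; field.
Qed.

(* The condition [2 * qre c = -1] selects the units of order 3, which generate
   the group of units. *)
Lemma units_gen (G : Q -> Prop) : G 1 -> (forall a b, G a -> G b -> G (a * b)) ->
  (forall c, hurwitz c -> nq c = 1 -> 2 * qre c = -1 -> G c) ->
  forall a, hurwitz a -> nq a = 1 -> G a.
Proof.
move=> G1 GM G3.
have split_ a c : hurwitz a -> nq a = 1 -> hurwitz c -> nq c = 1 ->
    2 * qre c = -1 -> 2 * qre (a * c) = -1 -> G a.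
  move=> ha na hc nc rc rac.
  have -> : a = (a * c) * qconj c by rewrite -mulrA mulq_conj nc rq1 mulr1.
  apply: GM; apply: G3 => //.
  - exact: hurwitzM.
  - by rewrite nqM na nc mulr1.
  - exact: hurwitz_conj.
  - by rewrite nq_conj.
  - by rewrite qre_conj.
have o1 : (1 : R) = 1 \/ (1 : R) = -1 by left.
have oN : (-1 : R) = 1 \/ (-1 : R) = -1 by right.
have Gi (q : Q) (s t u : R) : s = 1 \/ s = -1 -> t = 1 \/ t = -1 -> u = 1 \/ u = -1 ->
    q8 q -> 2 * qre (q * Quat (-1 / 2) (s / 2) (t / 2) (u / 2)) = -1 -> G q.
  move=> hs ht hu /q8_props[hq nq1 _ _].
  have [hc nc] := hurwitz_signs oN hs ht hu.
  by apply: split_ => //=; field.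
have hI : G (qI R).
  apply: (Gi _ 1 1 1) => //; first by constructor 2; left.
  by rewrite /qI mulqE /=; field.
move=> a ha na; case: (hunit_cases ha na) => [ha8|].
  case: (ha8) => -[] aE; rewrite aE.
  - exact: G1.
  - have -> : -1 = qI R * qI R :> Q.
      by rewrite /qI mulqE oneqE oppqE; congr Quat; ring.
    exact: GM.
  - exact: hI.
  - by apply: (Gi _ (-1) 1 1) => //; [rewrite -aE|rewrite /qI oppqE mulqE /=; field].
  - by apply: (Gi _ 1 1 1) => //; [rewrite -aE|rewrite /qJ mulqE /=; field].
  - by apply: (Gi _ 1 (-1) 1) => //; [rewrite -aE|rewrite /qJ oppqE mulqE /=; field].
  - by apply: (Gi _ 1 1 1) => //; [rewrite -aE|rewrite /qK mulqE /=; field].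
  - by apply: (Gi _ 1 1 (-1)) => //; [rewrite -aE|rewrite /qK oppqE mulqE /=; field].
move=> [s [t [u [v [aE hs ht hu hv]]]]].
case: (hs) => sE; last first.
  by apply: G3 => //; rewrite aE sE /=; field.
have hv' : - v = 1 \/ - v = -1.
  by case: hv => ->; [right|left]; rewrite ?opprK.
have [hc nc] := hurwitz_signs oN ht hu hv'.
apply: (split_ _ _ ha na hc nc); first by rewrite /=; field.
rewrite aE sE mulqE /=.
have sq (x : R) : x = 1 \/ x = -1 -> x ^+ 2 = 1.
  by case=> ->; rewrite ?sqrrN expr1n.
have t2 := sq _ ht; have u2 := sq _ hu; have v2 := sq _ hv.
by clear aE; lra.
Qed.
End Units.

(** * Units and translations realized by reflections *)

Section UnitScaling.
Variable R : realType.
Local Notation Q := (quat R).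
Local Notation W := 'cV[Q]_4.
Local Notation rho := (rho R).
Variables (P : set W) (aP : admissible P).
Local Notation L := (lat P).

Lemma unit_rho (u : Q) : hurwitz u -> nq u = 1 ->
  exists2 g, Reflec0 L g & g rho = rscale rho u /\ forall v, la (g v) = la v.
Proof.
move: u; apply: (@units_gen R (fun u : Q => exists2 g, Reflec0 L g &
   g rho = rscale rho u /\ forall v, la (g v) = la v)).
- exists id; first by have [] := Reflec0_group L.
  by rewrite rscale1.
- move=> a b [g hg [g1 g2]] [h hh [h1 h2]].
  exists (g \o h); first exact: Reflec0_comp.
  split=> [|v] /=; last by rewrite g2 h2.
  have [_ gZ _ _] := AutE (Reflec0_Aut aP hg).
  by rewrite h1 gZ g1 rscaleA.
move=> c hc nc rc.
have h0 : c * c = - c - 1 by rewrite sqr_quat rc nc rqN rq1 mulN1r.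
have c3 : c * c * c = 1 by rewrite h0 mulrBl mulNr h0 mul1r opprB opprK addrK.
have cc : qconj c = c * c.
  apply: (mulIr (x := c)); first by rewrite unitq -nq_eq0 nc oner_eq0.
  by rewrite mul_conjq nc c3.
(* For c of order 3, both [- c] and [- qconj c] have order 6, and the scalar produced is [qconj c]
   squared, that is c^4 = c. *)
have [||||||g hg [g1 g2]] := @unit_step R P aP (- c) (- qconj c).
- exact: hurwitzN.
- by rewrite nqN.
- by rewrite qreN mulrN rc opprK.
- by apply: hurwitzN; exact: hurwitz_conj.
- by rewrite nqN nq_conj.
- by rewrite qreN qre_conj mulrN rc opprK.
exists g => //; split=> //; rewrite g1; congr rscale.
by rewrite qconjN mulNr mulrN opprK cc !mulrA c3 mul1r.
Qed.

Lemma mu_fix g u v : AutL L g -> g rho = rscale rho u -> nq u = 1 ->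
  mu (g v) = u * mu v.
Proof.
move=> /AutE[gD gZ gF _] gr nu_.
have := gF rho v; rewrite gr bfZl !bf_rho => <-.
by rewrite mulrA mulq_conj nu_ rq1 mul1r.
Qed.

(** The commutator of the translation by y with a reflection product multiplying [rho] by the unit e
    is, up to a central part, the translation by y (1 - conj e). For e of order 6 this is y e, hence
    y = x conj e. The translation by y is only known to be an automorphism, which suffices because
    [Reflec] is normal. *)
Lemma transl_Reflec x : P x -> exists2 z, qre z = 0 & Reflec L (translation x z).
Proof.
move=> Px.
pose e := qeta R; have he : hurwitz e by exact: hurwitz_eta.
have ne : nq e = 1 by rewrite /e /qeta /nq /=; field.
have e1 : 1 - qconj e = e by rewrite /e /qeta oneqE /= oppqE addqE; congr Quat; field.
have [d hd [dr dl]] := unit_rho he ne.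
have [d' hd' [dd' d'd]] := Reflec0_inv aP hd.
have hdA := Reflec0_Aut aP hd; have hdA' := Reflec0_Aut aP hd'.
have ec : qconj e * e = 1 by rewrite mul_conjq ne.
have dr' : d' rho = rscale rho (qconj e).
  have [_ dZ _ _] := AutE hdA.
  apply: (can_inj dd'); rewrite d'd dZ dr rscaleA mulq_conj ne rscale1 //.
have dl' v : la (d' v) = la v by rewrite -{2}(d'd v) dl.
pose y := rscale x (qconj e).
have Py : P y by apply: (admZ aP) => //; exact: hurwitz_conj.
have [w w0 hw] := transl_exists aP Py.
have TA := transl_Aut aP Py w0 hw.
have hC : Reflec L (translation y w \o d \o translation (- y) (- w) \o d').
  apply: Reflec_comp; last exact: Reflec0_Reflec.
  apply: Reflec_normal TA (transl_inv y w) (transl_inv' y w) _.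
  exact: Reflec0_Reflec.
have mC v : mu ((translation y w \o d \o translation (- y) (- w) \o d') v) = mu v.
  rewrite /= mu_transl (mu_fix _ hdA dr ne) mu_transl (mu_fix _ hdA' dr') ?nq_conj //.
  by rewrite mulrA mulq_conj ne rq1 mul1r.
have lC v : la ((translation y w \o d \o translation (- y) (- w) \o d') v) =
    la v + rscale x (mu v).
  rewrite /= la_transl dl (mu_fix _ hdA dr ne) !la_transl mu_transl dl'.
  rewrite (mu_fix _ hdA' dr') ?nq_conj // (mulrA e) mulq_conj ne rq1 mul1r.
  rewrite rscaleNl -addrA -rscaleN -rscaleDr; congr (_ + _).
  rewrite /y rscaleA; congr rscale.
  rewrite mulrDr mulrN addrC mulrA -mulrBl -{1}(mulr1 (qconj e)) -mulrBr e1 ec.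
  by rewrite mul1r.
have [z z0 hz] := Aut_transl (Reflec_Aut hC) lC mC.
by exists z => //; rewrite -hz.
Qed.

(** This is the commutator of two translations over x and y, which is independent of their central
    parts. *)
Lemma transl_center x y : P x -> P y -> Reflec L (translation 0 (- 2 * imq (ip x y))).
Proof.
move=> Px Py; have [z z0 hz] := transl_Reflec Px; have [w w0 hw] := transl_Reflec Py.
have [h' hh' [h'1 h'2]] := Reflec_inv (Reflec_comp hw hz).
suff -> : translation 0 (- 2 * imq (ip x y)) =
    (translation x z \o translation y w) \o h'.
  exact: Reflec_comp (Reflec_comp hz hw) hh'.
apply: funext => v; have {1}-> : v = translation y w (translation x z (h' v)).
  by rewrite -{1}(h'2 v).
rewrite [RHS]/=; move: (h' v) => {}v.
rewrite (transl_comp y x) (transl_comp 0) (transl_comp x y) add0r (addrC y x).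
congr (translation _ _ v); rewrite ip0l -(ipC x y); move: (ip x y) => a.
by apply: quatP; rewrite /imq ?qprojE ?rqE; ring.
Qed.
End UnitScaling.

(** * The Barnes-Wall lattice *)

Ltac hurwitz_tac := repeat first [assumption | exact: hurwitz_pp | exact: hurwitz0
  | exact: hurwitz1 | exact: hurwitzI | exact: hurwitzJ | exact: hurwitzK
  | exact: hurwitz_eta | exact: hurwitz_nat
  | apply: hurwitz_conj | apply: hurwitzN | apply: hurwitzD | apply: hurwitzM].

Section Coordinates.
Variable R : realType.
Local Notation Q := (quat R).
Local Notation W := 'cV[Q]_4.
Implicit Types (x y : W) (a b c d : Q).

Definition v4 a b c d : W := \col_(i < 4) [:: a; b; c; d]`_i.
Definition o0 : 'I_4 := @Ordinal 4 0 isT.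
Definition o1 : 'I_4 := @Ordinal 4 1 isT.
Definition o2 : 'I_4 := @Ordinal 4 2 isT.
Definition o3 : 'I_4 := @Ordinal 4 3 isT.

Lemma forall4 (T : 'I_4 -> Prop) : T o0 -> T o1 -> T o2 -> T o3 -> forall i, T i.
Proof.
move=> h0 h1 h2 h3 [[|[|[|[|n]]]] hi] //.
- by rewrite (_ : Ordinal hi = o0) //; apply: val_inj.
- by rewrite (_ : Ordinal hi = o1) //; apply: val_inj.
- by rewrite (_ : Ordinal hi = o2) //; apply: val_inj.
- by rewrite (_ : Ordinal hi = o3) //; apply: val_inj.
Qed.

Lemma sum4 (T : zmodType) (F : 'I_4 -> T) : \sum_i F i = F o0 + F o1 + F o2 + F o3.
Proof.
rewrite !big_ord_recl big_ord0 addr0 !addrA.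
by congr (F _ + F _ + F _ + F _); apply: val_inj.
Qed.

Lemma v4E a b c d : (v4 a b c d o0 0 = a) * (v4 a b c d o1 0 = b) *
  (v4 a b c d o2 0 = c) * (v4 a b c d o3 0 = d).
Proof. by rewrite !mxE. Qed.

Lemma v4P x y : x o0 0 = y o0 0 -> x o1 0 = y o1 0 -> x o2 0 = y o2 0 ->
  x o3 0 = y o3 0 -> x = y.
Proof.
by move=> h0 h1 h2 h3; apply/matrixP => i j; rewrite ord1; elim/forall4: i.
Qed.

Lemma v4_eta x : x = v4 (x o0 0) (x o1 0) (x o2 0) (x o3 0).
Proof. by apply: v4P; rewrite v4E. Qed.

Lemma ip4 x y : ip x y = qconj (x o0 0) * y o0 0 + qconj (x o1 0) * y o1 0 +
  qconj (x o2 0) * y o2 0 + qconj (x o3 0) * y o3 0.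
Proof. by rewrite /ip sum4. Qed.

Lemma nrm4 x : nrm x = nq (x o0 0) + nq (x o1 0) + nq (x o2 0) + nq (x o3 0).
Proof. by rewrite /nrm sum4. Qed.
End Coordinates.

Section BarnesWall.
Variable R : realType.
Local Notation Q := (quat R).
Local Notation W := 'cV[Q]_4.
Local Notation pp := (pp R).
Implicit Types (x y : W) (a b c d : Q).

Definition bwP : set W := points (barnes_wall R).

Lemma ppVK a : pp^-1 * (pp * a) = a.
Proof. by rewrite mulrA quat_mulVx ?pp_neq0 // mul1r. Qed.
Lemma ppKV a : pp * (pp^-1 * a) = a.
Proof. by rewrite mulrA quat_mulxV ?pp_neq0 // mul1r. Qed.
Lemma conj_ppV_ppV : qconj pp^-1 * pp^-1 = rq 2^-1.
Proof. by rewrite mul_conjq nq_ppV. Qed.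

Lemma bwP_iff x : bwP x <-> [/\ forall i, hurwitz (pp * x i 0),
    forall i, inP (pp * x i 0 - pp * x o0 0)
  & exists2 h, hurwitz h & \sum_i pp * x i 0 = 2 * h].
Proof.
split=> [[X [hX dX sX] <-]|[h1 h2 h3]].
  have E i : pp * map_mx (fun t => (1 + qI R)^-1 * t) X i 0 = X i 0.
    by rewrite mxE ppKV.
  split=> [i|i|].
  - by rewrite E; exact: hX.
  - by rewrite !E; exact: dX.
  - by under eq_bigr => i _ do rewrite E.
exists (\col_i (pp * x i 0)); last first.
  by apply/matrixP => i j; rewrite ord1 !mxE ppVK.
split=> [i|i j|].
- by rewrite mxE.
- rewrite !mxE -(subrKA (pp * x o0 0)) -[pp * x o0 0 - _]opprB.
  by apply: inPD => //; exact: inPN.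
- by under eq_bigr => i _ do rewrite mxE.
Qed.

Lemma bwP_v4 a b c d : hurwitz a -> inP (b - a) -> inP (c - a) -> inP (d - a) ->
  (exists2 h, hurwitz h & a + b + c + d = 2 * h) ->
  bwP (v4 (pp^-1 * a) (pp^-1 * b) (pp^-1 * c) (pp^-1 * d)).
Proof.
move=> ha hb hc hd hs; apply/bwP_iff; split.
- elim/forall4; rewrite v4E ppKV //.
  + by rewrite -(subrK a b); apply: hurwitzD => //; exact: inP_hurwitz.
  + by rewrite -(subrK a c); apply: hurwitzD => //; exact: inP_hurwitz.
  + by rewrite -(subrK a d); apply: hurwitzD => //; exact: inP_hurwitz.
- by elim/forall4; rewrite !v4E !ppKV // subrr; exact: inP0.
- by rewrite sum4 !v4E !ppKV.
Qed.

Lemma bwPE x : bwP x -> exists a b c d,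
  [/\ x = v4 (pp^-1 * a) (pp^-1 * b) (pp^-1 * c) (pp^-1 * d),
     [/\ hurwitz a, inP (b - a), inP (c - a) & inP (d - a)]
   & exists2 h, hurwitz h & a + b + c + d = 2 * h].
Proof.
move=> /bwP_iff[h1 h2]; rewrite sum4 => h3.
exists (pp * x o0 0), (pp * x o1 0), (pp * x o2 0), (pp * x o3 0); split=> //.
by apply: v4P; rewrite v4E ppVK.
Qed.

Lemma bw_adm : admissible bwP.
Proof.
have Z x a : bwP x -> hurwitz a -> bwP (rscale x a).
  move=> /bwP_iff[h1 h2 [h hh sE]] ha; apply/bwP_iff; split.
  - by move=> i; rewrite rscaleE mulrA; exact: hurwitzM.
  - by move=> i; rewrite !rscaleE !mulrA -mulrBl; exact: inPMr.
  - exists (h * a); first exact: hurwitzM.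
    by rewrite mulrA -sE mulr_suml; apply: eq_bigr => i _; rewrite rscaleE mulrA.
split=> //.
- apply/bwP_iff; split=> [i|i|].
  + by rewrite mxE mulr0; exact: hurwitz0.
  + by rewrite !mxE mulr0 subr0; exact: inP0.
  + exists 0; first exact: hurwitz0.
    by rewrite big1 ?mulr0 // => i _; rewrite mxE mulr0.
- move=> x y /bwP_iff[x1 x2 [hx hhx sx]] /bwP_iff[y1 y2 [hy hhy sy]].
  apply/bwP_iff; split=> [i|i|].
  + by rewrite mxE mulrDr; exact: hurwitzD.
  + by rewrite !mxE !mulrDr opprD addrACA; exact: inPD.
  + exists (hx + hy); first exact: hurwitzD.
    by rewrite mulrDr -sx -sy -big_split; apply: eq_bigr => i _; rewrite mxE mulrDr.
move=> x y /bwP_iff[hx dx [h hh sx]] /bwP_iff[hy dy [m hm sy]].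
(* The obstacle to integrality is the factor 1/2 in the pairing of the vectors [pp] x and [pp] y.
   With [pp] x_i = a + [pp] b_i and likewise for y, the terms in a are even because the coordinate
   sums are, and the products of the multiples of [pp] carry a factor 2. *)
have split_ (z : W) : (forall i, inP (pp * z i 0 - pp * z o0 0)) -> exists b : 'I_4 -> Q,
    forall i, hurwitz (b i) /\ pp * z i 0 = pp * z o0 0 + pp * b i.
  move=> dz; suff /choice[b hb] : forall i, exists t, hurwitz t /\
      pp * z i 0 = pp * z o0 0 + pp * t by exists b.
  by move=> i; have [t ht tE] := dz i; exists t; rewrite -tE addrC subrK.
have [b hb] := split_ x dx; have [c hc] := split_ y dy.
move: (hx o0) (hy o0) hb hc; move: (pp * x o0 0) (pp * y o0 0) => a e ha he hb hc.
have sb : \sum_i pp * b i = rq 2 * (h - rq 2 * a).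
  have := sx; under eq_bigr => i _ do rewrite (hb i).2.
  rewrite big_split sumr_const card_ord /= (natq R 2) => /(canRL (addKr _)) ->.
  have -> : a *+ 4 = rq 2 * (rq 2 * a) by rewrite !mulq2 -!mulr2n -mulrnA.
  by rewrite mulrBr addrC.
have -> : ip x y = qconj a * m + qconj (h - rq 2 * a) * e + \sum_i qconj (b i) * c i.
  apply: (mulrI (x := rq 2)); first by rewrite unitq -nq_eq0 nq_rq expf_neq0 // pnatr_eq0.
  transitivity (\sum_i (qconj a * (pp * y i 0) + qconj (pp * b i) * e +
      rq 2 * (qconj (b i) * c i))).
    rewrite /ip mulr_sumr; apply: eq_bigr => i _.
    have E (s t : Q) : rq 2 * (qconj s * t) = qconj (pp * s) * (pp * t).
      by rewrite qconjM -mulrA (mulrA (qconj pp)) mul_conjq nq_pp mulrA rqC mulrA.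
    by rewrite !E (hb i).2 qconjD mulrDl -addrA (hc i).2 -mulrDr.
  rewrite 2!big_split /= -[\sum_i rq 2 * _]mulr_sumr -[\sum_i qconj a * _]mulr_sumr.
  rewrite -mulr_suml -qconj_sum sy sb (natq R 2).
  by rewrite qconjM qconj_rq -rqC -!mulrA !mulrA -!(rqC 2 (qconj a)) -!mulrA -!mulrDr.
have h2 : hurwitz (rq 2 : Q) by rewrite -(natq R 2); exact: hurwitz_nat.
apply: hurwitzD; first by hurwitz_tac.
by elim/big_ind: _ => [|? ?|i _]; [exact: hurwitz0|exact: hurwitzD|have [? _] := hb i; have [? _] := hc i; hurwitz_tac].
Qed.

Lemma nrm_bw (a b c d : Q) : nrm (v4 (pp^-1 * a) (pp^-1 * b) (pp^-1 * c) (pp^-1 * d)) =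
  (nq a + nq b + nq c + nq d) / 2.
Proof. by rewrite nrm4 !v4E !nqM nq_ppV; ring. Qed.

Lemma ip_bw (a b c d a' b' c' d' : Q) :
  ip (v4 (pp^-1 * a) (pp^-1 * b) (pp^-1 * c) (pp^-1 * d))
     (v4 (pp^-1 * a') (pp^-1 * b') (pp^-1 * c') (pp^-1 * d')) =
  (qconj a * a' + qconj b * b' + qconj c * c' + qconj d * d') * rq 2^-1.
Proof.
rewrite ip4 !v4E !qconjM.
have E (s t : Q) : qconj s * qconj pp^-1 * (pp^-1 * t) = qconj s * t * rq 2^-1.
  by rewrite mulrA -(mulrA (qconj s)) conj_ppV_ppV -rqC -mulrA rqC.
by rewrite !E -!mulrDl.
Qed.

Lemma Hn_adm : admissible (@Hn R 4).
Proof.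
split.
- by move=> i; rewrite mxE; exact: hurwitz0.
- by move=> x y hx hy i; rewrite mxE; exact: hurwitzD.
- by move=> x a hx ha i; rewrite rscaleE; exact: hurwitzM.
move=> x y hx hy; rewrite ip4.
by do !apply: hurwitzD; apply: hurwitzM => //; exact: hurwitz_conj.
Qed.

(** If the coordinates of [pp] x are outside the ideal, their norms add up to at least 4, and x has
    norm at least 2. Otherwise these norms are even; for a norm 1 vector only one is nonzero and
    equals 2, but then that coordinate is the sum, a multiple of 2, whose norm is divisible by 4. *)
Lemma bw_nrm1 x : bwP x -> nrm x <> 1.
Proof.
move=> /bwPE[a [b [c [d [-> [ha hb hc hd] [h hh sE]]]]]]; rewrite nrm_bw => n1.
have H (y : Q) : inP (y - a) -> hurwitz y.
  by move=> /inP_hurwitz /hurwitzD - /(_ _ ha); rewrite subrK.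
have E (y : Q) : inP a -> inP (y - a) -> exists n : nat, nq y = 2 * n%:R.
  move=> pa pya; have py : inP y by rewrite -(subrK a y); exact: inPD.
  case: py => z hz ->; have [n nE] := hurwitz_nq hz.
  by exists n; rewrite nqM nq_pp nE.
have [pa|pa] := pselect (inP a); last first.
  have N (y : Q) : inP (y - a) -> 1 <= nq y.
    move=> hy; apply: hurwitz_nq_ge1; first exact: H.
    by apply/eqP => y0; apply: pa; have := inPN hy; rewrite y0 sub0r opprK.
  have := N _ hb; have := N _ hc; have := N _ hd.
  have := N a; rewrite subrr => /(_ (@inP0 R)).
  by clear -n1; move: (nq a) (nq b) (nq c) (nq d) n1 => A B C D *; lra.
have [na naE] := E a pa ltac:(by rewrite subrr; exact: inP0).
have [nb nbE] := E b pa hb; have [nc ncE] := E c pa hc; have [nd ndE] := E d pa hd.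
have s1 : (na + nb + nc + nd = 1)%N.
  by apply/eqP; rewrite -(eqr_nat R) !natrD; apply/eqP; clear - n1 naE nbE ncE ndE; lra.
have K (x1 x2 x3 x4 : Q) : nq x1 = 0 -> nq x2 = 0 -> nq x3 = 0 -> x1 + x2 + x3 + x4 = 2 * h ->
    nq x4 = 2 -> False.
  move=> /eqP; rewrite nq_eq0 => /eqP -> /eqP; rewrite nq_eq0 => /eqP -> /eqP.
  rewrite nq_eq0 => /eqP ->; rewrite !add0r => ->; rewrite (natq R 2) nqM nq_rq.
  have [n ->] := hurwitz_nq hh => h2.
  have : (2 * n = 1)%N.
    by apply/eqP; rewrite -(eqr_nat R) natrM; apply/eqP; clear -h2; lra.
  by clear; lia.
have : [\/ [\/ [/\ na = 0, nb = 0, nc = 0 & nd = 1] | [/\ na = 0, nb = 0, nd = 0 & nc = 1]],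
  [/\ na = 0, nd = 0, nc = 0 & nb = 1] | [/\ nd = 0, nb = 0, nc = 0 & na = 1]]%N.
  clear - s1; case: na s1 => [|[|na]]; case: nb => [|[|nb]]; case: nc => [|[|nc]];
   case: nd => [|[|nd]]; move=> s1; try lia;
   by [constructor 1; left|constructor 1; right|constructor 2|constructor 3].
move: naE nbE ncE ndE => /= naE nbE ncE ndE.
case=> [[[e1 e2 e3 e4]|[e1 e2 e3 e4]]|[e1 e2 e3 e4]|[e1 e2 e3 e4]]; rewrite e1 e2 e3 e4 ?mulr0 ?mulr1 in naE nbE ncE ndE.
- exact: (K a b c d).
- by apply: (K a b d c) => //; rewrite -sE; qring.
- by apply: (K a d c b) => //; rewrite -sE; qring.
- by apply: (K d b c a) => //; rewrite -sE; qring.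
Qed.
End BarnesWall.

(** * Covering by lattice points and norm 1 points *)

Section Covering.
Variable R : realType.
Local Notation Q := (quat R).
Local Notation W := 'cV[Q]_4.
Local Notation pp := (pp R).
Implicit Types (x y : W) (a b c d : Q).

Lemma inP_two_l a : inP a -> exists2 h, hurwitz h & pp * a = 2 * h.
Proof.
move=> [h hh ->]; exists (qI R * h); first by hurwitz_tac.
rewrite !mulrA; congr (_ * _).
by rewrite (natq R 2) ppE /qI /rq !mulqE; congr Quat; ring.
Qed.

Lemma inP_two_r a : inP a -> exists2 h, hurwitz h & a * pp = 2 * h.
Proof.
move=> [h hh ->]; rewrite -mulrA; apply: inP_two_l.
by apply: inPMl => //; exact: inP_pp.
Qed.

(** The two halves of [pp] x are approximated by points (a1, a2) and (a3, a4) of E8, with total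
    error at most 2, hence at most 1 for x. Modulo the lattice vector from (-a3, -a4, a3, a4) the
    approximation becomes (w1, w2, 0, 0). Reducing it by [pp] times another E8 point leaves
    congruent d1, d2 with norms of sum at most 2. The sum 1 is excluded by the congruence, so e has
    norm 0 or 1. *)
Lemma bw_covering x : (exists2 l, bwP l & nrm (x - l) <= 1) \/
  exists l e, [/\ bwP l, bwP (rscale e pp), nrm e = 1 & nrm (x - (l + e)) <= 1].
Proof.
have [a1 [a2 [h1 h2 h12 n12]]] := e8_covering (pp * x o0 0) (pp * x o1 0).
have [a3 [a4 [h3 h4 h34 n34]]] := e8_covering (pp * x o2 0) (pp * x o3 0).
set w1 := a1 + a3; set w2 := a2 + a4.
have [c1 [c2 [k1 k2 k12 m12]]] := e8_covering (pp^-1 * w1) (pp^-1 * w2).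
set d1 := w1 - pp * c1; set d2 := w2 - pp * c2.
have hd1 : hurwitz d1 by rewrite /d1 /w1; hurwitz_tac.
have hd2 : hurwitz d2 by rewrite /d2 /w2; hurwitz_tac.
have p1 : inP (pp * c1) by exists c1.
have p2 : inP (pp * c2) by exists c2.
have d12 : inP (d1 - d2).
  have -> : d1 - d2 = (a1 - a2) + (a3 - a4) - (pp * c1 - pp * c2).
    by rewrite /d1 /d2 /w1 /w2; move: (pp * c1) (pp * c2) => u v; qring.
  by apply: inPB; [exact: inPD|exact: inPB].
pose l0 : W := v4 (pp^-1 * - a3) (pp^-1 * - a4) (pp^-1 * a3) (pp^-1 * a4).
pose l1 : W := v4 (pp^-1 * (pp * c1)) (pp^-1 * (pp * c2)) (pp^-1 * 0) (pp^-1 * 0).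
pose e : W := v4 (pp^-1 * d1) (pp^-1 * d2) (pp^-1 * 0) (pp^-1 * 0).
have P0 : bwP l0.
  apply: bwP_v4; first exact: hurwitzN.
  - by rewrite opprK addrC.
  - by rewrite opprK -mulr2n -mulr_natl; exact: inP_two.
  - rewrite opprK (_ : a4 + a3 = 2 * a4 + (a3 - a4)); last by rewrite (natq R 2) mulq2 -addrA [a4 + (_ - _)]addrC subrK.
    by apply: inPD => //; exact: inP_two.
  - by exists 0; [exact: hurwitz0|rewrite mulr0; qring].
have P1 : bwP l1.
  apply: bwP_v4; rewrite ?sub0r; first exact: inP_hurwitz.
  - exact: inPB.
  - exact: inPN.
  - exact: inPN.
  - rewrite !addr0 -mulrDr; apply: inP_two_l.
    rewrite (_ : c1 + c2 = c1 - c2 + 2 * c2); last by rewrite (natq R 2) mulq2 addrA subrK.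
    by apply: inPD => //; exact: inP_two.
have xE : nrm (x - (l0 + l1 + e)) <= 1.
  have -> : x - (l0 + l1 + e) = v4 (pp^-1 * (pp * x o0 0 - a1)) (pp^-1 * (pp * x o1 0 - a2))
      (pp^-1 * (pp * x o2 0 - a3)) (pp^-1 * (pp * x o3 0 - a4)).
    rewrite {1}(v4_eta x) /l0 /l1 /e; apply: v4P; rewrite !mxE /= -[in LHS](ppVK (x _ _));
      rewrite -!mulrDr -!mulrN -!mulrDr; congr (_ * _); rewrite /d1 /d2 /w1 /w2;
      rewrite ?mulr0; try (move: (pp * c1) (pp * c2) => u v); move: (pp * x _ _) => w; qring.
  by rewrite nrm_bw; clear -n12 n34; move: (nq _) (nq _) (nq _) (nq _) n12 n34 => A B C D *; lra.
have nE : nrm e = (nq d1 + nq d2) / 2 by rewrite nrm_bw nq0 !addr0.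
have le2 : nq d1 + nq d2 <= 2.
  move: m12; have E w c : pp^-1 * w - c = pp^-1 * (w - pp * c) by rewrite mulrBr ppVK.
  by rewrite !E !nqM nq_ppV -/d1 -/d2; clear; move: (nq d1) (nq d2) => A B *; lra.
have [n1 n1E] := hurwitz_nq hd1; have [n2 n2E] := hurwitz_nq hd2.
have K (u v : Q) : hurwitz v -> inP (u - v) -> nq u = 0 -> nq v <> 1.
  move=> hv hp /eqP; rewrite nq_eq0 => /eqP u0 n1'; apply: (hurwitz_nq1_notinP hv n1').
  by have := inPN hp; rewrite u0 sub0r opprK.
have : (n1 + n2 <= 2)%N by rewrite -(ler_nat R) natrD -n1E -n2E.
have : (n1 + n2 <> 1)%N.
  move=> n12'; have [[e1 e2]|[e1 e2]] : (n1 = 0 /\ n2 = 1 \/ n2 = 0 /\ n1 = 1)%N by lia.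
    by apply: (K d1 d2) => //; rewrite ?n1E ?n2E ?e1 ?e2.
  apply: (K d2 d1) => //; rewrite ?n1E ?n2E ?e1 ?e2 //.
  by rewrite -opprB; exact: inPN.
move=> ne1 lt2; have [/eqP e0|e2] : ((n1 + n2 = 0) \/ (n1 + n2 = 2))%N by lia.
  left; exists (l0 + l1); first by apply: (admD (@bw_adm R)).
  have e0' : e = 0.
    apply: nrm_eq0; rewrite nE n1E n2E -natrD (eqP e0); lra.
  by rewrite -[l0 + l1]addr0 -e0'.
right; exists (l0 + l1), e; split => //.
- by apply: (admD (@bw_adm R)).
- have -> : rscale e pp = v4 (pp^-1 * (d1 * pp)) (pp^-1 * (d2 * pp)) (pp^-1 * 0) (pp^-1 * 0).
    by apply: v4P; rewrite rscaleE !v4E -?mulrA // ?mul0r ?mulr0.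
  have q1 : inP (d1 * pp) by apply: inPMl => //; exact: inP_pp.
  have q2 : inP (d2 * pp) by apply: inPMl => //; exact: inP_pp.
  apply: bwP_v4; rewrite ?sub0r; first exact: inP_hurwitz.
  + exact: inPB.
  + exact: inPN.
  + exact: inPN.
  rewrite !addr0 -mulrDl; apply: inP_two_r.
  rewrite (_ : d1 + d2 = d1 - d2 + 2 * d2); last by rewrite (natq R 2) mulq2 [RHS]addrA subrK.
  by apply: inPD => //; exact: inP_two.
- by rewrite nE n1E n2E -natrD e2; lra.
Qed.
End Covering.

(** * Transitivity on norm 2 vectors *)

Section RootTransitivity.
Variable R : realType.
Local Notation Q := (quat R).
Local Notation W := 'cV[Q]_4.
Local Notation pp := (pp R).
Local Notation L := (lat (@bwP R)).
Local Notation rho := (rho R).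
Implicit Types (x y f g : W) (a b c d u : Q).

(* The isometries of the Barnes-Wall summand that extend to elements of
   [Reflec L] trivial on the hyperbolic plane. *)
Definition Weq x y := exists h, [/\ Reflec L h, h rho = rho,
  h (vec3 0 1 0) = vec3 0 1 0 & h (vec3 x 0 0) = vec3 y 0 0].

Lemma Weq_refl x : Weq x x.
Proof. by exists id; split=> //; have [] := Reflec_group L. Qed.

Lemma Weq_trans y x z : Weq x y -> Weq y z -> Weq x z.
Proof.
move=> [h [h1 h2 h3 h4]] [k [k1 k2 k3 k4]]; exists (k \o h).
by split; rewrite /= ?h2 ?h3 ?h4 //; exact: Reflec_comp.
Qed.

Lemma rscale_vec3 x a b c : rscale (vec3 x b c) a = vec3 (rscale x a) (b * a) (c * a).
Proof. by apply: vecP; rewrite !vlinE !vec3E. Qed.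

Lemma Weq_scale x y a : Weq x y -> Weq (rscale x a) (rscale y a).
Proof.
move=> [h [h1 h2 h3 h4]]; exists h; split=> //.
have [_ hZ _ _] := AutE (Reflec_Aut h1).
by have := congr1 (fun v => rscale v a) h4; rewrite -hZ !rscale_vec3 mul0r.
Qed.

Lemma Weq_bifl f x : bwP f -> nrm f = 2 -> Weq x (x - rscale f (ip f x)).
Proof.
move=> Pf nf; have rr : bf (vec3 f 0 0) (vec3 f 0 0) = rq 2.
  by rewrite bf_self !vec3E nf mulr0 qre0 mulr0 addr0.
have Lf : points L (vec3 f 0 0) by apply: pts_vec3 => //; exact: hurwitz0.
exists (reflection L (-1) (vec3 f 0 0)); rewrite !bifl_E //.
split; first exact: (bifl_Reflec (@bw_adm R)).
- by rewrite -bfC bf_rho vec3E qconj0 rscale0 subr0.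
- rewrite /bf !vec3E ip0r qconj0 !mul0r !addr0.
  by rewrite rscale0 subr0.
- rewrite /bf !vec3E qconj0 !mul0r !addr0 rscale_vec3 !mul0r.
  by apply: vecP; rewrite !vlinE !vec3E ?subr0.
Qed.

(** As for two roots spanning A2: with u = [ip f g], the biflection in g sends f u to f u - g, and
    the one in f sends this to -g. *)
Lemma Weq_link f g : bwP f -> bwP g -> nrm f = 2 -> nrm g = 2 -> nq (ip f g) = 1 ->
  Weq f (rscale g (- qconj (ip f g))).
Proof.
move=> Pf Pg nf ng nu_; set u := ip f g.
suff : Weq (rscale f u) (- g).
  move=> /(@Weq_scale _ _ (qconj u)); rewrite rscaleA mulq_conj nu_ rq1 rscale1.
  by rewrite rscaleN rscaleNl.
apply: Weq_trans (Weq_bifl _ Pg ng) _.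
have -> : rscale f u - rscale g (ip g (rscale f u)) = rscale f u - g.
  by rewrite ipZr -(ipC f g) mul_conjq nu_ rq1 rscale1.
have := Weq_bifl (rscale f u - g) Pf nf.
rewrite ipDr ipNr ipZr ip_nrm nf -/u.
have -> : rq 2 * u - u = u by qring.
by rewrite addrAC subrr add0r.
Qed.

Lemma Weq_unit_link f g u : bwP f -> bwP g -> nrm f = 2 -> nrm g = 2 ->
  ip f g = u -> nq u = 1 -> Weq f (rscale g (- qconj u)).
Proof. by move=> ? ? ? ? <-; exact: Weq_link. Qed.

Definition bwF : W := v4 (pp^-1 * (2 * qI R)) (pp^-1 * 0) (pp^-1 * 0) (pp^-1 * 0).

Lemma bwFE : bwF = v4 pp 0 0 0.
Proof.
rewrite /bwF mulr0; congr v4; rewrite -[RHS]ppVK; congr (_ * _).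
by rewrite (natq R 2) ppE /qI /rq !mulqE; congr Quat; ring.
Qed.

Lemma bwF_pts : bwP bwF.
Proof.
have hI : inP (2 * qI R) by apply: inP_two; exact: hurwitzI.
apply: bwP_v4; rewrite ?sub0r; do ?exact: inPN.
  exact: inP_hurwitz.
by exists (qI R); [exact: hurwitzI|rewrite !addr0].
Qed.

Lemma nrm_bwF : nrm bwF = 2.
Proof. by rewrite /bwF nrm_bw (natq R 2) nqM nq_rq nq0 /qI /nq /=; field. Qed.

Lemma nrm_unit4 a b c d : nq a = 1 -> nq b = 1 -> nq c = 1 -> nq d = 1 ->
  nrm (v4 (pp^-1 * a) (pp^-1 * b) (pp^-1 * c) (pp^-1 * d)) = 2.
Proof. by move=> na nb nc nd; rewrite nrm_bw na nb nc nd; field. Qed.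

Lemma q8_bw (x1 x2 x3 e : Q) : q8 x1 -> q8 x2 -> q8 x3 -> hurwitz e -> 1 + x1 + x2 + x3 = 2 * e ->
  bwP (v4 (pp^-1 * 1) (pp^-1 * x1) (pp^-1 * x2) (pp^-1 * x3)) /\
  nrm (v4 (pp^-1 * 1) (pp^-1 * x1) (pp^-1 * x2) (pp^-1 * x3)) = 2.
Proof.
move=> /q8_props[h1 n1 p1 _] /q8_props[h2 n2 p2 _] /q8_props[h3 n3 p3 _] he sE; split.
  by apply: bwP_v4 => //; [exact: hurwitz1|exists e].
by apply: nrm_unit4 => //; exact: nq1.
Qed.

(** For a unit of order 3, a closed chain of links runs from [bwF] through [pp]^-1 (1, 1, 1, 1) and
    [pp]^-1 (1, x1, x2, x3) back to [bwF]. The signs of x1 = ± i, x2 = ± j, x3 = ± k are chosen so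
    that its holonomy is the given unit. *)
Lemma Weq_F_unit u : hurwitz u -> nq u = 1 -> Weq bwF (rscale bwF u).
Proof.
move: u; apply: (@units_gen R (fun u => Weq bwF (rscale bwF u))).
- by rewrite rscale1; exact: Weq_refl.
- by move=> a b ha hb; apply: Weq_trans hb _; rewrite -rscaleA; exact: Weq_scale.
move=> c hc nc rc.
have [|] := hunit_cases hc nc.
  have i0 : (0 : R) <> -1 by lra.
  by case=> -[] cE; move: rc; rewrite cE !qprojE /qI /qJ /qK /= => rc; exfalso; lra.
move=> [s [t [v [w [cE hs ht hv hw]]]]].
have {hs} sE : s = -1 by move: rc; rewrite cE /=; lra.
(* The three link factors multiply to i conj(e) i, where e = (1 + x1 + x2 + x3)/2 is the middle
   pairing; this value of e makes the product c. *)
have eH : hurwitz (qconj (qI R * c * qI R)) by hurwitz_tac.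
have eE : qconj (qI R * c * qI R) = Quat 2^-1 (t / 2) (- v / 2) (- w / 2).
  by rewrite cE sE /qI !mulqE /=; congr Quat; field.
move: eH; rewrite eE; set e : Q := Quat _ _ _ _ => eH.
have ne : nq e = 1 by rewrite /e -eE nq_conj !nqM nc /qI /nq /=; ring.
have q8i (z : R) : z = 1 \/ z = -1 -> [/\ q8 (Quat 0 z 0 0), q8 (Quat 0 0 (- z) 0) & q8 (Quat 0 0 0 (- z))].
  have E0 : - (0 : R) = 0 := oppr0 R.
  case=> ->; split; rewrite ?opprK.
  - by constructor 2; left.
  - by constructor 3; right; rewrite /qJ oppqE E0.
  - by constructor 4; right; rewrite /qK oppqE E0.
  - by constructor 2; right; rewrite /qI oppqE E0.
  - by constructor 3; left.
  - by constructor 4; left.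
have [q1 _ _] := q8i _ ht; have [_ q2 _] := q8i _ hv; have [_ _ q3] := q8i _ hw.
have [|P2 n2] := q8_bw q1 q2 q3 eH.
  by rewrite (natq R 2) /rq /e !qE; congr Quat; field.
have q81 : q8 (1 : Q) by constructor 1; left.
have [|P1 n1] := q8_bw q81 q81 q81 (hurwitz_nat R 2).
  by rewrite -mulr2n -!mulrSr -natrM.
have nI : nq (qI R) = 1 by rewrite /qI /nq /=; ring.
have l1 := @Weq_unit_link _ _ (- qI R) bwF_pts P1 nrm_bwF n1.
have l2 := @Weq_unit_link _ _ e P1 P2 n1 n2.
have l3 := @Weq_unit_link _ _ (qI R) P2 bwF_pts n2 nrm_bwF.
have {}l1 := l1 ltac:(by rewrite ip_bw (natq R 2) /qI /rq !qE /= ?qE; congr Quat; field) ltac:(by rewrite nqN).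
have {}l2 := l2 ltac:(by rewrite ip_bw /rq /e !qE /= ?qE; congr Quat; field) ne.
have {}l3 := l3 ltac:(by rewrite ip_bw (natq R 2) /qI /rq !qE /= ?qE; congr Quat; field) nI.
have := Weq_trans l1 (Weq_scale _ (Weq_trans l2 (Weq_scale _ l3))).
rewrite !rscaleA; congr (Weq _ (rscale _ _)).
by rewrite cE sE /e /qI !(oppqE, qconjE, mulqE); congr Quat; field.
Qed.

Lemma Weq_F_link f : bwP f -> nrm f = 2 -> nq (ip f bwF) = 1 -> Weq f bwF.
Proof.
move=> Pf nf ni; apply: Weq_trans (Weq_link Pf bwF_pts nf nrm_bwF ni) _.
have hu : hurwitz (- qconj (ip f bwF)).
  by apply/hurwitzN/hurwitz_conj/(adm_ip (@bw_adm R)) => //; exact: bwF_pts.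
set u := - _; have nu_ : nq u = 1 by rewrite nqN nq_conj.
have := Weq_scale u (Weq_F_unit (hurwitz_conj hu) (etrans (nq_conj _) nu_)).
by rewrite rscaleA mul_conjq nu_ rscale1.
Qed.

Lemma Weq_F_odd f : bwP f -> nrm f = 2 -> ~ inP (pp * f o0 0) -> Weq f bwF.
Proof.
move=> Pf nf; have [a [b [c [d [fE [ha hb hc hd] _]]]]] := bwPE Pf.
have -> : pp * f o0 0 = a by rewrite fE v4E ppKV.
move=> pa; apply: Weq_F_link => //; move: nf; rewrite fE nrm_bw /bwF ip_bw => n4.
have N (y : Q) : inP (y - a) -> 1 <= nq y.
  move=> hy; apply: hurwitz_nq_ge1.
    by rewrite -(subrK a y); apply: hurwitzD => //; exact: inP_hurwitz.
  by apply/eqP => y0; apply: pa; have := inPN hy; rewrite y0 sub0r opprK.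
have nI : nq (qI R) = 1 by rewrite /qI /nq /=; ring.
rewrite !mulr0 !addr0 (natq R 2) !nqM !nq_rq nq_conj nI.
have := N _ hb; have := N _ hc; have := N _ hd.
have := N a; rewrite subrr => /(_ (@inP0 R)).
clear -n4; move: (nq a) (nq b) (nq c) (nq d) n4 => A B C D n4 hA hB hC hD.
have -> : A = 1 by lra.
by field.
Qed.

(* If all the coordinates of [p f] are in (1+i)H, a biflection in some vector
   p^-1 (1, x1, x2, x3) makes the first one a unit. *)
Lemma Weq_F f : bwP f -> nrm f = 2 -> Weq f bwF.
Proof.
move=> Pf nf; have [a [b [c [d [fE [ha hb hc hd] [h hh sE]]]]]] := bwPE Pf.
have [pa|pa] := pselect (inP a); last by apply: Weq_F_odd => //; rewrite fE v4E ppKV.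
apply: contrapT => nW.
have K (x1 x2 x3 e : Q) : q8 x1 -> q8 x2 -> q8 x3 -> hurwitz e -> 1 + x1 + x2 + x3 = 2 * e ->
    inP ((a + qconj x1 * b + qconj x2 * c + qconj x3 * d) * rq 2^-1).
  move=> q1 q2 q3 he eE; apply: contrapT => nP; apply: nW.
  have [Pg ng] := q8_bw q1 q2 q3 he eE; set g := v4 _ _ _ _ in Pg ng.
  have gf : ip g f = (a + qconj x1 * b + qconj x2 * c + qconj x3 * d) * rq 2^-1.
    by rewrite /g fE ip_bw qconj1 mul1r.
  have Pi := adm_ip (@bw_adm R) Pg Pf.
  apply: Weq_trans (Weq_bifl f Pg ng) (Weq_F_odd _ _ _).
  - by apply: (admB (@bw_adm R)) => //; exact: (admZ (@bw_adm R)).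
  - rewrite nrmB nrmZ nf ng ipZr -(ipC g f) qreC mulq_conj rqE; lra.
  - have -> : pp * (f - rscale g (ip g f)) o0 0 = a - ip g f.
      by rewrite mxE [X in _ + X]mxE rscaleE mulrBr mulrA {1}fE /g !v4E !ppKV mul1r.
    by move=> /(inPB pa); rewrite opprB addrC subrK gf.
have I (y : Q) : inP (y - a) -> inP y by move=> hy; rewrite -(subrK a y); exact: inPD.
have [h0 hh0 aE] := pa; have [h1 hh1 bE] := I _ hb.
have [h2 hh2 cE] := I _ hc; have [h3 hh3 dE] := I _ hd.
have q81 : q8 (1 : Q) by constructor 1; left.
have q8I : q8 (qI R) by constructor 2; left.
have h4 := hurwitz_nat R 2; have e1 : 1 + 1 + 1 + 1 = 2 * 2%:R :> Q by rewrite -mulr2n -!mulrSr -natrM.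
have k0 := K 1 1 1 _ q81 q81 q81 h4 e1; rewrite !qconj1 !mul1r in k0.
have e2 : 1 + qI R + qI R + 1 = 2 * pp by rewrite (natq R 2) mulq2 ppE /qI oneqE !addqE; congr Quat; ring.
have D (x y z w : Q) : inP ((x + pp * y + pp * z + w) * rq 2^-1) ->
    inP ((x + qconj (qI R) * (pp * y) + qconj (qI R) * (pp * z) + w) * rq 2^-1) -> inP (y + z).
  move=> u1 u2; have := inPMl (hurwitzN (@hurwitzI R)) (inPB u1 u2).
  congr inP; rewrite -mulrBl (_ : qconj (qI R) = - qI R); last first.
    by rewrite /qI qconjE oppqE oppr0.
  have -> : x + pp * y + pp * z + w - (x + - qI R * (pp * y) + - qI R * (pp * z) + w) =
      (1 + qI R) * pp * (y + z).
    rewrite -mulrA; move: pp => p; rewrite (mulrDr p) mulrDl mul1r mulrDr !mulNr.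
    by move: (qI R * (p * y)) (qI R * (p * z)) (p * y) (p * z) => A' B' A B; qring.
  have -> : (1 + qI R) * pp = rq 2 * qI R by rewrite ppE /qI oneqE addqE !mulqE; congr Quat; ring.
  rewrite -(rqC (2^-1)) !mulrA -(mulrA (- qI R)) -rqM mulVf ?pnatr_eq0 // mulr1.
  have -> : - qI R * qI R = 1 by rewrite /qI oneqE oppqE mulqE; congr Quat; ring.
  by rewrite mul1r.
have k23 : inP (h1 + h2).
  apply: (D a h1 h2 d); first by move: k0; rewrite bE cE.
  by have := K _ _ _ _ q8I q8I q81 (@hurwitz_pp R) e2; rewrite bE cE qconj1 mul1r.
have k12 : inP (h2 + h3).
  apply: (D (a + b) h2 h3 0); first by move: k0; rewrite cE dE addr0.
  have e3 : 1 + 1 + qI R + qI R = 2 * pp by rewrite -e2; qring.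
  by have := K _ _ _ _ q81 q8I q8I (@hurwitz_pp R) e3; rewrite cE dE qconj1 mul1r addr0.
have k13 : inP (h1 + h3).
  have -> : h1 + h3 = (h1 + h2) + (h2 + h3) - 2 * h2 by rewrite (natq R 2) mulq2; qring.
  by apply: inPB; [exact: inPD|exact: inP_two].
have kS : inP (h0 + h1 + h2 + h3).
  have -> : h0 + h1 + h2 + h3 = qconj pp * h.
    apply: (mulrI (x := pp)); first by rewrite unitq pp_neq0.
    by rewrite 3!(mulrDr pp) -aE -bE -cE -dE sE mulrA mulq_conj nq_pp (natq R 2).
  by apply: inPMr => //; apply: inP_conj; exact: inP_pp.
have k03 : inP (h0 + h3).
  have -> : h0 + h3 = (h0 + h1 + h2 + h3) - (h1 + h2) by qring.
  exact: inPB.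
have E (y z : Q) : inP (y + z) -> inP z -> inP y by move=> u1 u2; rewrite -(addrK z y); exact: inPB.
have n4 : nq h0 + nq h1 + nq h2 + nq h3 = 2.
  by move: nf; rewrite fE nrm_bw aE bE cE dE !nqM nq_pp; clear; lra.
(* All h_k are congruent modulo the ideal and their norms add up to 2. Four nonzero norms exceed 2,
   so the h_k are in the ideal and exactly one is nonzero, of norm 2. The pairing in [k0] then has
   norm 1 although it lies in the ideal. *)
have [p3|p3] := pselect (inP h3); last first.
  have ge (y : Q) : hurwitz y -> ~ inP y -> 1 <= nq y.
    move=> hy py; apply: hurwitz_nq_ge1 => //; apply/eqP => y0.
    by apply: py; rewrite y0; exact: inP0.
  have N (y : Q) : inP (y + h3) -> ~ inP y by rewrite addrC => k py; exact: p3 (E _ _ k py).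
  have := ge _ hh0 (N _ k03); have := ge _ hh1 (N _ k13); have := ge _ hh2 (N _ k12).
  by have := ge _ hh3 p3; clear -n4; lra.
have F (y : Q) : inP y -> exists n : nat, nq y = 2 * n%:R.
  by case=> z hz ->; have [n nE] := hurwitz_nq hz; exists n; rewrite nqM nq_pp nE.
have [m0 m0E] := F _ (E _ _ k03 p3); have [m1 m1E] := F _ (E _ _ k13 p3).
have [m2 m2E] := F _ (E _ _ k12 p3); have [m3 m3E] := F _ p3.
have mS : (m0 + m1 + m2 + m3 = 1)%N.
  by apply/eqP; rewrite -(eqr_nat R) !natrD; apply/eqP; clear -n4 m0E m1E m2E m3E; lra.
have hS : hurwitz (h0 + h1 + h2 + h3) by hurwitz_tac.
have Z (y : Q) n : nq y = 2 * n%:R -> n = 0%N -> y = 0.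
  by move=> nE n0; apply/eqP; rewrite -nq_eq0 nE n0 mulr0.
have nS : nq (h0 + h1 + h2 + h3) = 2.
  have [[e1' [e2' e3']]|[[e1' [e2' e3']]|[[e1' [e2' e3']]|[e1' [e2' e3']]]]] :
    (m1 = 0 /\ m2 = 0 /\ m3 = 0 \/ m0 = 0 /\ m2 = 0 /\ m3 = 0 \/
     m0 = 0 /\ m1 = 0 /\ m3 = 0 \/ m0 = 0 /\ m1 = 0 /\ m2 = 0)%N by lia.
  - by move: n4; rewrite (Z h1 m1) // (Z h2 m2) // (Z h3 m3) // nq0 !addr0.
  - by move: n4; rewrite (Z h0 m0) // (Z h2 m2) // (Z h3 m3) // nq0 !addr0 !add0r.
  - by move: n4; rewrite (Z h0 m0) // (Z h1 m1) // (Z h3 m3) // nq0 !addr0 !add0r.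
  - by move: n4; rewrite (Z h0 m0) // (Z h1 m1) // (Z h2 m2) // nq0 !add0r.
apply: (hurwitz_nq1_notinP (inP_hurwitz k0) _ k0).
by rewrite aE bE cE dE -3!(mulrDr pp) !nqM nS nq_pp nq_rq; field.
Qed.
End RootTransitivity.

(** * The model over H^4 *)

Section StandardTranslations.
Variable R : realType.
Local Notation Q := (quat R).
Local Notation W := 'cV[Q]_4.
Local Notation L := (lat (@Hn R 4)).
Local Notation aH := (@Hn_adm R).
Implicit Types (x y : W) (a b c d u : Q) (k : 'I_4).

Lemma colD x y i : (x + y) i 0 = x i 0 + y i 0. Proof. by rewrite mxE. Qed.
Lemma colN x i : (- x) i 0 = - x i 0. Proof. by rewrite mxE. Qed.

Definition axis k a : W := \col_i (if i == k then a else 0).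

Lemma axisE k a i : axis k a i 0 = if i == k then a else 0.
Proof. by rewrite mxE. Qed.

Lemma ip_axis k a x : ip (axis k a) x = qconj a * x k 0.
Proof.
rewrite /ip (bigD1 k) //= axisE eqxx big1 ?addr0 // => i /negPf ik.
by rewrite axisE ik qconj0 mul0r.
Qed.

Lemma axis_pts k a : hurwitz a -> @Hn R 4 (axis k a).
Proof. by move=> ha i; rewrite axisE; case: ifP => // _; exact: hurwitz0. Qed.

Lemma nrm_axis k a : nrm (axis k a) = nq a.
Proof. by have := congr1 (@qre R) (ip_nrm (axis k a)); rewrite ip_axis axisE eqxx mul_conjq. Qed.

Lemma rscale_axis k a b : rscale (axis k a) b = axis k (a * b).
Proof.
by apply/matrixP => i j; rewrite ord1 rscaleE !axisE; case: ifP; rewrite ?mul0r.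
Qed.

Lemma axis_root k a : hurwitz a -> points L (vec3 (axis k 1) 0 a) /\
  bf (vec3 (axis k 1) 0 a) (vec3 (axis k 1) 0 a) = 1.
Proof.
move=> ha; split.
  by apply: pts_vec3 => //; [apply: axis_pts; exact: hurwitz1|exact: hurwitz0].
by rewrite bf_self !vec3E nrm_axis nq1 qconj0 mul0r qre0 mulr0 addr0.
Qed.

Lemma imq_re a : qre (imq a) = 0.
Proof. by rewrite /imq qcoordE rqE subrr. Qed.

Lemma imq_order6 (y u : Q) : 2 * qre u = 1 ->
  imq (qconj y * u * y) - rq (nq y / 2) = - (qconj y * qconj u * y).
Proof.
move=> ru; have r2 : qre u = 2^-1 by lra.
have re : qre (qconj y * u * y) = nq y / 2 by rewrite /nq !qprojE r2; field.
have -> : qconj u = 1 - u by apply: quatP; rewrite !qprojE; lra.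
rewrite /imq re mulrBr mulr1 mulrBl mul_conjq opprB -addrA -opprD -rqD.
by congr (_ - rq _); field.
Qed.

(** The two roots differ by a multiple of [rho] and are reflected with inverse units, so the
    composite is trivial modulo the span of the k-th axis and [rho] up to a shear, that is, a
    translation along the axis. *)
Lemma axis_transl k (y u : Q) : hurwitz y -> hurwitz u -> nq u = 1 -> 2 * qre u = 1 ->
  Reflec0 L (translation (axis k y) (imq (qconj y * u * y))).
Proof.
move=> hy hu nu_ ru.
have [L0 r0] := axis_root k (@hurwitz0 R).
have hc : hurwitz (- qconj (u * y)) by hurwitz_tac.
have [L1 r1] := axis_root k hc.
suff -> : translation (axis k y) (imq (qconj y * u * y)) =
    reflection L u (vec3 (axis k 1) 0 (- qconj (u * y))) \o
    reflection L (qconj u) (vec3 (axis k 1) 0 0).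
  by apply: Reflec0_comp; apply: refl_Reflec0 => //; rewrite ?nq_conj //;
     exact: hurwitz_conj.
have u1 : 1 - qconj u = u by apply: quatP; rewrite !qprojE; lra.
have u2 : 1 - u = qconj u by apply: quatP; rewrite !qprojE; lra.
have uu : qconj u * u = 1 by rewrite mul_conjq nu_.
apply: funext => v /=; rewrite translationE !refl_short // u1 u2.
have -> : bf (vec3 (axis k 1) 0 0) v = la v k 0.
  by rewrite /bf !vec3E ip_axis qconj1 mul1r qconj0 !mul0r !addr0.
rewrite bfDr bfNr bfZr.
have -> : bf (vec3 (axis k 1) 0 (- qconj (u * y))) v = la v k 0 - u * y * mu v.
  by rewrite /bf !vec3E ip_axis qconj1 mul1r qconj0 !mul0r addr0 qconjN qconjK mulNr.
have -> : bf (vec3 (axis k 1) 0 (- qconj (u * y))) (vec3 (axis k 1) 0 0) = 1.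
  by rewrite /bf !vec3E ip_axis axisE eqxx qconj1 qconj0 mul0r mulr0 !addr0 mul1r.
have -> : la v k 0 - u * y * mu v - 1 * (u * la v k 0) = qconj u * la v k 0 - u * y * mu v.
  by rewrite mul1r -{1}(mul1r (la v k 0)) addrAC -mulrBl u2.
have u3 : qconj u * qconj u = qconj u - 1 by rewrite -{2}u2 mulrBr mulr1 uu.
rewrite !rscale_vec3 !rscale_axis !mul0r !mul1r mulrBr.
rewrite !mulrA uu mul1r u3 -u2.
apply: vecP; rewrite !vlinE !vec3E ?subr0 //.
- apply/matrixP => i j; rewrite ord1 !(colD, colN) !axisE.
  case: eqP => [->|_]; last by rewrite !subr0 addr0.
  rewrite !mulrBl !mul1r; move: (la v k 0) (u * la v k 0) (y * mu v) => t s m; qring.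
- rewrite ip_axis nrm_axis u2 qconjM mulNr opprK.
  rewrite imq_order6 //.
  have u4 : qconj u * (qconj u - 1) = -1 by rewrite mulrBr mulr1 u3 addrAC subrr add0r.
  rewrite mulrBr [qconj y * qconj u * (_ * _)]mulrA -(mulrA (qconj y) (qconj u) (_ - _)) u4.
  by rewrite mulrN1 mulNr mulNr addrA !mulrA.
Qed.

Lemma Reflec0_id : Reflec0 L id. Proof. by have [] := Reflec0_group L. Qed.

Lemma central_transl_order6 (u u' : Q) : hurwitz u -> nq u = 1 -> 2 * qre u = 1 ->
  hurwitz u' -> nq u' = 1 -> 2 * qre u' = 1 -> Reflec0 L (translation 0 (u - u')).
Proof.
move=> hu nu_ ru hu' nu' ru'; have h1 := @hurwitz1 R.
have t1 := axis_transl o0 h1 hu nu_ ru; have t2 := axis_transl o0 h1 hu' nu' ru'.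
rewrite qconj1 mul1r mulr1 in t1; rewrite qconj1 mul1r mulr1 in t2.
have [_ _ inv] := Reflec0_group L.
have t2' := inv _ _ t2 (@transl_inv R _ _) (@transl_inv' R _ _).
have := Reflec0_comp t1 t2'; congr (Reflec0 L); apply: funext => v /=.
rewrite transl_comp subrr ipNr ip_nrm nrm_axis; congr (translation _ _ v).
by apply: quatP; rewrite /imq !qprojE ?rqE; lra.
Qed.

(** An imaginary Hurwitz integer has integral coordinates, and each of i, j, k is a difference of
    two units of order 6. *)
Lemma central_transl z : hurwitz z -> qre z = 0 -> Reflec0 L (translation 0 z).
Proof.
move=> /hurwitzP[a [b [c [d zE]]]] z0.
have [n aE] : exists n : int, a = 2 * n.
  have [n [|aE]] := int_parity a; first by exists n.
  exfalso; move: z0; rewrite zE /hquat aE /= => /eqP.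
  by rewrite mulf_eq0 invr_eq0 pnatr_eq0 /= orbF intr_eq0; lia.
have zE' : z = qI R *~ b + qJ R *~ c + qK R *~ d.
  rewrite zE /hquat; move: z0; rewrite zE /hquat /= => z0.
  rewrite /qI /qJ /qK !mulrzqE !addqE; apply: quatP => /=; lra.
rewrite zE'.
have o : (1 : R) = 1 \/ (1 : R) = -1 by left.
have oN : (-1 : R) = 1 \/ (-1 : R) = -1 by right.
have [h0 n0] := hurwitz_signs o o o o; have [h1 n1] := hurwitz_signs o oN o o.
have [h2 n2] := hurwitz_signs o o oN o; have [h3 n3] := hurwitz_signs o o o oN.
have r (s t v : R) : 2 * qre (Quat (1 / 2) s t v : Q) = 1 by rewrite /=; lra.
have gL := Reflec0_group L.
apply: (central_add gL); [apply: (central_add gL)|]; apply: (central_mul _ gL).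
- have := central_transl_order6 h0 n0 (r _ _ _) h1 n1 (r _ _ _).
  by congr (Reflec0 L (translation 0 _)); rewrite /qI oppqE addqE; congr Quat; field.
- have := central_transl_order6 h0 n0 (r _ _ _) h2 n2 (r _ _ _).
  by congr (Reflec0 L (translation 0 _)); rewrite /qJ oppqE addqE; congr Quat; field.
- have := central_transl_order6 h0 n0 (r _ _ _) h3 n3 (r _ _ _).
  by congr (Reflec0 L (translation 0 _)); rewrite /qK oppqE addqE; congr Quat; field.
Qed.

Lemma hurwitz_transl x z : AutL L (translation x z) -> hurwitz (z - rq (nrm x / 2)).
Proof.
move=> /AutE[_ _ _ hP].
have Lm : points L (vec3 0 1 0).
  by apply: pts_vec3; [exact: (adm0 aH)|exact: hurwitz1|exact: hurwitz0].
have := hP _ Lm; rewrite translationE !vec3E => /points_lat[_ _].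
by rewrite vec3E ip0r subr0 add0r mulr1.
Qed.

Lemma axis_sum x : x = \sum_k axis k (x k 0).
Proof.
apply/matrixP => i j; rewrite ord1 summxE (bigD1 i) //= axisE eqxx big1 ?addr0 // => k /negPf ki.
by rewrite axisE eq_sym ki.
Qed.

Lemma standard_transl x z : @Hn R 4 x -> qre z = 0 -> hurwitz (z - rq (nrm x / 2)) ->
  Reflec0 L (translation x z).
Proof.
move=> Px z0 hz.
have [w w0 hw] : exists2 w, qre w = 0 & Reflec0 L (translation x w).
  rewrite (axis_sum x); elim/big_ind: _ => [|y y' [a a0 ha] [b b0 hb]|k _].
  - exists 0 => //; rewrite (_ : translation 0 0 = id); first exact: Reflec0_id.
    by apply: funext => v; exact: transl0.
  - exists (a + b - imq (ip y y')); first by rewrite qreD qreN imq_re qreD a0 b0 oppr0 !addr0.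
    have := Reflec0_comp ha hb; congr (Reflec0 L).
    by apply: funext => v /=; rewrite transl_comp.
  - exists (imq (qconj (x k 0) * qeta R * x k 0)); first exact: imq_re.
    apply: axis_transl => //; first exact: hurwitz_eta.
    + by rewrite /qeta /nq /=; field.
    + by rewrite /=; field.
have hw' := hurwitz_transl (Reflec0_Aut aH hw).
have hd : hurwitz (z - w).
  have -> : z - w = (z - rq (nrm x / 2)) - (w - rq (nrm x / 2)) by qring.
  exact: hurwitzB.
have d0 : qre (z - w) = 0 by rewrite !qcoordE z0 w0 subrr.
have := Reflec0_comp (central_transl hd d0) hw; congr (Reflec0 L).
apply: funext => v /=; rewrite transl_comp add0r ip0l imq_real ?qconj0 //.
by rewrite subr0 subrK.
Qed.
End StandardTranslations.

Section StandardCusp.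
Variable R : realType.
Local Notation Q := (quat R).
Local Notation W := 'cV[Q]_4.
Local Notation V := 'cV[Q]_(4 + (1 + 1)).
Local Notation pp := (pp R).
Local Notation L := (lat (@Hn R 4)).
Local Notation aH := (@Hn_adm R).
Implicit Types (x y : W) (v w : V) (a b c d u m n z : Q) (k : 'I_4).

(* Equivalence under the short reflections of the model over H^4, where
   [vec3 ones pp (- pp)] represents the cusp of Barnes-Wall type. *)
Definition Geq v w := exists2 g, Reflec0 L g & g v = w.

Lemma Geq_refl v : Geq v v.
Proof. by exists id; first exact: Reflec0_id. Qed.

Lemma Geq_trans w v v' : Geq v w -> Geq w v' -> Geq v v'.
Proof.
by move=> [g hg <-] [h hh <-]; exists (h \o g); first exact: Reflec0_comp.
Qed.

Lemma Geq_sym v w : Geq v w -> Geq w v.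
Proof. by move=> [g hg <-]; have [g' hg' [gK _]] := Reflec0_inv aH hg; exists g'. Qed.

Lemma Geq_points v w : Geq v w -> points L v -> points L w.
Proof. by move=> [g hg <-]; have [_ _ _] := AutE (Reflec0_Aut aH hg); apply. Qed.

Lemma Geq_bf v w : Geq v w -> bf w w = bf v v.
Proof. by move=> [g hg <-]; have [_ _ -> _] := AutE (Reflec0_Aut aH hg). Qed.

Lemma Geq_transl x y z m n : @Hn R 4 y -> qre z = 0 -> hurwitz (z - rq (nrm y / 2)) ->
  Geq (vec3 x m n)
    (vec3 (x + rscale y m) m (n - ip y x + (z - rq (nrm y / 2)) * m)).
Proof.
move=> hy z0 hz; exists (translation y z); first exact: standard_transl.
by rewrite translationE !vec3E.
Qed.

Lemma Geq_unit x k m n : hurwitz (x k 0) -> nq (x k 0) = 1 ->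
  Geq (vec3 x m n) (vec3 (x + axis k (1 - x k 0)) m n).
Proof.
move=> hx nx; have [Lr rr] := axis_root k (@hurwitz0 R).
exists (reflection L (qconj (x k 0)) (vec3 (axis k 1) 0 0)).
  by apply: refl_Reflec0; rewrite ?nq_conj //; exact: hurwitz_conj.
rewrite refl_short // /bf !vec3E ip_axis qconj1 qconj0 !mul0r !addr0 mul1r.
rewrite rscale_vec3 rscale_axis !mul0r mul1r.
apply: vecP; rewrite !vlinE !vec3E ?subr0 //; congr (_ + _).
rewrite mulrBl mul1r mul_conjq nx rq1.
by apply/matrixP => i j; rewrite ord1 colN !axisE; case: ifP; rewrite ?oppr0 ?opprB.
Qed.

Definition ones : W := v4 1 1 1 1.

Lemma Geq_ones x m n : (forall k, hurwitz (x k 0) /\ nq (x k 0) = 1) ->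
  Geq (vec3 x m n) (vec3 ones m n).
Proof.
move=> hx; have [h0 n0] := hx o0; have [h1 n1] := hx o1.
have [h2 n2] := hx o2; have [h3 n3] := hx o3.
apply: Geq_trans (Geq_unit (k := o0) _ _ h0 n0) _.
set x0 := _ + _; have e1 : x0 o1 0 = x o1 0 by rewrite colD axisE addr0.
apply: Geq_trans (Geq_unit (k := o1) _ _ _ _) _; rewrite ?e1 //.
set x1 := _ + _; have e2 : x1 o2 0 = x o2 0 by rewrite !colD !axisE !addr0.
apply: Geq_trans (Geq_unit (k := o2) _ _ _ _) _; rewrite ?e2 //.
set x2 := _ + _; have e3 : x2 o3 0 = x o3 0 by rewrite !colD !axisE !addr0.
apply: Geq_trans (Geq_unit (k := o3) _ _ _ _) _; rewrite ?e3 //.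
rewrite (_ : x2 + _ = ones); first exact: Geq_refl.
by apply: v4P; rewrite !colD !axisE /= v4E ?addr0 addrC subrK.
Qed.

Lemma Geq_central z n : hurwitz z -> qre z = 0 ->
  Geq (vec3 ones pp n) (vec3 ones pp (n + z * pp)).
Proof.
move=> hz z0; have h0 : @Hn R 4 0 by exact: (adm0 aH).
have hz0 : hurwitz (z - rq (nrm (0 : W) / 2)) by rewrite nrm0 mul0r rq0 subr0.
have := Geq_transl ones pp n h0 z0 hz0.
by rewrite rscale0l ip0l nrm0 mul0r rq0 !subr0 addr0.
Qed.

(** The translation by y along the first axis turns the first coordinate 1 of [ones] into the unit
    q, which a reflection turns back into 1. The net effect is a change of n. *)
Lemma Geq_move (y u q : Q) n : hurwitz y -> hurwitz u -> nq u = 1 -> 2 * qre u = 1 ->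
  y * pp = q - 1 -> hurwitz q -> nq q = 1 ->
  Geq (vec3 ones pp n) (vec3 ones pp (n - qconj y * (u + qconj u * q))).
Proof.
move=> hy hu nu_ ru yq hq nq_.
have s1 : Geq (vec3 ones pp n) (translation (axis o0 y) (imq (qconj y * u * y)) (vec3 ones pp n)).
  by exists (translation (axis o0 y) (imq (qconj y * u * y))); first exact: axis_transl.
apply: Geq_trans s1 _.
rewrite translationE !vec3E ip_axis nrm_axis v4E mulr1.
rewrite imq_order6 //.
have -> : n - qconj y + - (qconj y * qconj u * y) * pp = n - qconj y * (u + qconj u * q).
  have u1 : u = 1 - qconj u by apply: quatP; rewrite !qprojE; lra.
  have -> : u + qconj u * q = 1 + (qconj u * q - qconj u).
    by rewrite addrCA -[1 - qconj u]u1 addrC.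
  by rewrite mulNr -!mulrA yq (mulrBr (qconj u)) mulr1 -addrA -opprD -{1}(mulr1 (qconj y)) -mulrDr.
apply: Geq_ones; elim/forall4; rewrite colD rscaleE axisE v4E /= ?mul0r ?addr0;
  try (by split; [exact: hurwitz1|exact: nq1]).
by rewrite yq addrC subrK.
Qed.

Lemma Geq_even n (t : int) (s r : int) : n = Quat (- 1 - t%:~R) (-1 + t%:~R) (s + r)%:~R (r - s)%:~R ->
  Geq (vec3 ones pp n) (vec3 ones pp (- pp)).
Proof.
move=> ->; have hz := hurwitz_int R 0 (- t) (- s) (- r).
set z := Quat _ _ _ _ in hz; set n0 := Quat _ _ _ _.
have -> : - pp = n0 + z * pp.
  by rewrite ppE /n0 /z !qE !(rmorphN, rmorphD, rmorphB, rmorph0) /=; congr Quat; ring.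
exact: Geq_central.
Qed.

(** Central translations change the last two coordinates of n by integers of equal parity. If s + r
    is odd, a move with q = i corrects the parity first. *)
Lemma Geq_integral n (t s r : int) : n = Quat (- 1 - t%:~R) (-1 + t%:~R) s%:~R r%:~R ->
  Geq (vec3 ones pp n) (vec3 ones pp (- pp)).
Proof.
move=> nE; have [m [sr|sr]] := int_parity (s + r).
  apply: (@Geq_even _ t (s - m) m); rewrite nE; congr (Quat _ _ _%:~R _%:~R); lia.
have uh := hurwitz_half R 0 (-1) (-1) (-1).
set u := Quat _ _ _ _ in uh.
have nu_ : nq u = 1 by rewrite /nq /u /= rmorphN rmorph1 rmorph0; field.
have ru : 2 * qre u = 1 by rewrite /u /= rmorph0; field.
have qE' : qI R * pp = qI R - 1 by rewrite ppE /qI !qE; congr Quat; ring.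
have nI : nq (qI R) = 1 by rewrite /qI /nq /=; ring.
apply: Geq_trans (Geq_move n (hurwitzI R) uh nu_ ru qE' (hurwitzI R) nI) _.
apply: (@Geq_even _ t (s - m) (m + 1)); rewrite nE.
have -> : (s - m + (m + 1))%:~R = s%:~R + 1 :> R by rewrite (_ : s - m + (m + 1) = s + 1) ?intrD //; lia.
have -> : (m + 1 - (s - m))%:~R = r%:~R :> R by congr (_%:~R); lia.
by apply: quatP; rewrite /u !qprojE /= rmorphN rmorph1 rmorph0; field.
Qed.

(** Nullity fixes qre n + qi n = -2, which is the shape of [Geq_integral] when n has integral
    coordinates. A half-integral n is first made integral by a move with q = j. *)
Lemma Geq_null n : hurwitz n -> bf (vec3 ones pp n) (vec3 ones pp n) = 0 ->
  Geq (vec3 ones pp n) (vec3 ones pp (- pp)).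
Proof.
move=> /hurwitzP[a [b [c [d nE]]]]; rewrite bf_self !vec3E.
have -> : nrm ones = 4 by rewrite nrm4 !v4E nq1; lra.
have -> : qre (qconj pp * n) = qre n + qi n by rewrite ppE qreM /=; ring.
move=> /(congr1 (@qre R)); rewrite rqE qre0 => n1.
have [A [aE|aE]] := int_parity a.
  apply: (@Geq_integral _ (A + b + 1) (A + c) (A + d)).
  move: n1; rewrite nE /hquat aE !(rmorphD, rmorphM) /= => n1.
  by apply: quatP => /=; lra.
have qE' : (qeta R - 1) * pp = qJ R - 1 by rewrite ppE /qeta /qJ !qE; congr Quat; field.
have nJ : nq (qJ R) = 1 by rewrite /qJ /nq /=; ring.
have hy : hurwitz (qeta R - 1) by hurwitz_tac.
have ne : nq (qeta R) = 1 by rewrite /qeta /nq /=; field.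
have re : 2 * qre (qeta R) = 1 by rewrite /qeta /=; field.
apply: Geq_trans (Geq_move n hy (hurwitz_eta R) ne re qE' (hurwitzJ R) nJ) _.
apply: (@Geq_integral _ (A + b + 2) (A + c + 2) (A + d + 1)).
move: n1; rewrite nE /hquat aE !(rmorphD, rmorphM) /= => n1.
by apply: quatP; rewrite /qeta /qJ !qprojE /=; lra.
Qed.

(** A coordinate outside the ideal is congruent to a unit modulo right multiples of [pp], so one
    translation makes all the coordinates units. *)
Lemma Geq_cusp e n : points L (vec3 e pp n) -> bf (vec3 e pp n) (vec3 e pp n) = 0 ->
  (forall k, ~ inP (e k 0)) -> Geq (vec3 e pp n) (vec3 ones pp (- pp)).
Proof.
move=> Lv v0 he; have /points_lat[] := Lv; rewrite vec3E => hh _ _.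
have [y0 h0 n0] := inP_unit_rep (hh o0) (he o0).
have [y1 h1 n1] := inP_unit_rep (hh o1) (he o1).
have [y2 h2 n2] := inP_unit_rep (hh o2) (he o2).
have [y3 h3 n3] := inP_unit_rep (hh o3) (he o3).
have Py : @Hn R 4 (v4 (- y0) (- y1) (- y2) (- y3)).
  by elim/forall4; rewrite v4E; exact: hurwitzN.
have [z z0 hz] := transl_exists aH Py.
have s1 := Geq_transl e pp n Py z0 hz; set x := e + _ in s1; set n' := n - _ + _ in s1.
have s2 : Geq (vec3 x pp n') (vec3 ones pp n').
  apply: Geq_ones; have /points_lat[] := Geq_points s1 Lv; rewrite vec3E => hx _ _ k.
  split; first exact: hx.
  by elim/forall4: k; rewrite colD rscaleE v4E mulNr.
have s := Geq_trans s1 s2; apply: (Geq_trans s).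
have /points_lat[_ _] := Geq_points s Lv; have := Geq_bf s; rewrite v0.
by rewrite vec3E => ? ?; exact: Geq_null.
Qed.
End StandardCusp.

Section StandardStep.
Variable R : realType.
Local Notation Q := (quat R).
Local Notation W := 'cV[Q]_4.
Local Notation V := 'cV[Q]_(4 + (1 + 1)).
Local Notation pp := (pp R).
Local Notation L := (lat (@Hn R 4)).
Local Notation aH := (@Hn_adm R).
Implicit Types (x y D : W) (v w : V) (s : Q) (k : 'I_4).

Lemma cusp_vec D s : vec3 (rscale D pp) pp (s * pp) = rscale (vec3 D 1 s) pp.
Proof. by rewrite rscale_vec3 mul1r. Qed.

Lemma cusp_null D s : 2 * qre s = - nrm D ->
  bf (vec3 (rscale D pp) pp (s * pp)) (vec3 (rscale D pp) pp (s * pp)) = 0.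
Proof.
move=> sE; rewrite cusp_vec bfZl bfZr bf_self !vec3E qconj1 mul1r sE subrr rq0.
by rewrite mul0r mulr0.
Qed.

(** The factor 2 is the norm of [pp]. The nullity of both vectors makes the real part of the
    remaining quotient minus half the squared distance from x to D; the rest is the imaginary
    distance. *)
Lemma cusp_bf D s v : 2 * qre s = - nrm D -> bf v v = 0 -> mu v != 0 ->
  let x := rscale (la v) (mu v)^-1 in
  nq (bf (vec3 (rscale D pp) pp (s * pp)) v) =
  2 * (nrm (x - D) ^+ 2 / 4 + im_dist s (- qconj (ip D x + nu v * (mu v)^-1))) * nq (mu v).
Proof.
move=> sE v0 m0 x; rewrite cusp_vec bfZl nqM nq_conj nq_pp -mulrA; congr (_ * _).
have -> : bf (vec3 D 1 s) v = (bf (vec3 D 1 s) v * (mu v)^-1) * mu v.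
  by rewrite -mulrA quat_mulVx // mulr1.
rewrite bf_vec3 // nqM -/x; congr (_ * _).
have re := null_re v0 m0; rewrite -/x in re.
set B := ip D x + _.
have -> : B + qconj s = qconj (s - - qconj B) by rewrite opprK qconjD qconjK addrC.
rewrite nq_conj nq_im; congr (_ + _).
rewrite qreN qre_conj opprK /B qreD re nrmB -(ipC D x) qre_conj.
have -> : qre s = - nrm D / 2 by lra.
by field.
Qed.

(** Adding [deep_pair] over the four coordinates gives [nrm (x - A) + nrm (x - D) <= 2]. Either the
    lattice point A is close enough for a root step, or D is strictly within distance 1 and the
    factor 2 (r^2/4 + 1/4) is below 1. *)
Lemma nstep v : points L v -> bf v v = 0 -> mu v != 0 ->
  [\/ exists r, [/\ points L r, bf r r = 1 & bf r v = 0],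
      exists2 g, Reflec0 L g & nq (mu (g v)) < nq (mu v)
    | exists2 w, Geq w (vec3 (ones R) pp (- pp)) & nq (bf w v) < nq (mu v)].
Proof.
move=> Lv v0 m0; set x := rscale (la v) (mu v)^-1.
have /choice[f hf] : forall k, exists ad : Q * Q, [/\ hurwitz ad.1, hurwitz (ad.2 * pp),
    ~ hurwitz ad.2 & nq (x k 0 - ad.1) + nq (x k 0 - ad.2) <= 2^-1].
  by move=> k; have [a [d had]] := deep_pair (x k 0); exists (a, d).
pose A : W := \col_k (f k).1; pose D : W := \col_k (f k).2.
have sum2 : nrm (x - A) + nrm (x - D) <= 2.
  rewrite !nrm4 !colD !colN; have E k : (A k 0 = (f k).1) * (D k 0 = (f k).2) by rewrite !mxE.
  rewrite !E; have [_ _ _ ] := hf o0; have [_ _ _ ] := hf o1; have [_ _ _ ] := hf o2.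
  have [_ _ _] := hf o3; clear.
  move: (nq (_ o0 0 - (f o0).1)) (nq (_ o0 0 - (f o0).2)) => a0 d0.
  move: (nq (_ o1 0 - (f o1).1)) (nq (_ o1 0 - (f o1).2)) => a1 d1.
  move: (nq (_ o2 0 - (f o2).1)) (nq (_ o2 0 - (f o2).2)) => a2 d2.
  move: (nq (_ o3 0 - (f o3).1)) (nq (_ o3 0 - (f o3).2)) => a3 d3.
  by lra.
have [le1|gt1] := leP (nrm (x - A)) 1.
  have PA : @Hn R 4 A by move=> k; rewrite mxE; have [] := hf k.
  by have [h|h] := root_step aH Lv v0 m0 PA le1; [constructor 1|constructor 2].
constructor 3; have lt1 : nrm (x - D) < 1 by clear -sum2 gt1; move: (nrm _) (nrm _) sum2 gt1 => *; lra.
have hD k : hurwitz (D k 0 * pp) by rewrite mxE; have [] := hf k.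
have nP k : ~ inP (D k 0 * pp).
  move=> /inP_right[h hh hE]; have [_ _ nh _] := hf k; apply: nh.
  suff -> : (f k).2 = h by [].
  by apply: (mulIr (x := pp)); [rewrite unitq pp_neq0|rewrite -hE mxE].
have odd_ k : exists n : int, nq (D k 0) = (2 * n + 1)%:~R / 2.
  have [N NE] := hurwitz_nq (hD k); have [n [E|E]] := int_parity N%:Z.
    by exfalso; apply: (nP k); apply/(inP_nq (hD k)); exists n; rewrite NE -E pmulrn.
  by exists n; rewrite -E -pmulrn -NE nqM nq_pp; field.
(* The four norms of the coordinates are halves of odd integers, so their sum is an integer, as
   [approx_im] requires of twice the real part of s. *)
have [K KE] : exists K : int, nrm D = K%:~R.
  have [n0 e0] := odd_ o0; have [n1 e1] := odd_ o1; have [n2 e2] := odd_ o2; have [n3 e3] := odd_ o3.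
  exists (n0 + n1 + n2 + n3 + 2); by rewrite nrm4 e0 e1 e2 e3 !(rmorphD, rmorphM) /=; field.
have [s [hs sE le4 _]] := approx_im (- K) (- qconj (ip D x + nu v * (mu v)^-1)).
have sN : 2 * qre s = - nrm D by rewrite sE KE rmorphN.
exists (vec3 (rscale D pp) pp (s * pp)).
  apply: Geq_cusp; last by move=> k; rewrite rscaleE; exact: nP.
    apply: pts_vec3 => //; last exact: hurwitz_pp.
    by move=> k; rewrite rscaleE.
  exact: cusp_null.
rewrite (cusp_bf sN v0 m0) -/x -[X in _ < X]mul1r ltr_pM2r ?nq_gt0 //.
have := nrm_ge0 (x - D); move: (nrm _) (im_dist _ _) lt1 le4 => r i; clear; nra.
Qed.
End StandardStep.

(** * Comparison of the two models *)

Section Models.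
Variable R : realType.
Local Notation Q := (quat R).
Local Notation W := 'cV[Q]_4.
Local Notation V := 'cV[Q]_(4 + (1 + 1)).
Local Notation pp := (pp R).
Local Notation qeta := (qeta R).
Local Notation bL := (lat (@bwP R)).
Local Notation hL := (lat (@Hn R 4)).
Local Notation aB := (@bw_adm R).
Implicit Types (x y D : W) (v w : V) (a b c d s : Q) (k : 'I_4).

(* In the Barnes-Wall model [fr1], .., [fr4] are orthonormal and orthogonal to the
   hyperbolic pair [frn], [frm]; the coordinates along this frame identify the
   lattice with its model over H^4, and [frn] with the vector [rho] of the latter. *)
Definition qomega : Q := - qconj qeta.

Definition fr1 : V := vec3 0 1 qeta.
Definition fr2 : V := vec3 (v4 1 1 0 0) 1 qomega.
Definition fr3 : V := vec3 (v4 1 0 1 0) 1 qomega.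
Definition fr4 : V := vec3 (v4 1 0 0 1) 1 qomega.
Definition frn : V := vec3 (v4 pp 0 0 0) pp (qomega * pp).
Definition frm : V := let q := - (pp^-1 * qI R) in vec3 (v4 q q q q) (- pp) (- (qomega * pp)).

Definition toH v : V :=
  vec3 (v4 (bf fr1 v) (bf fr2 v) (bf fr3 v) (bf fr4 v)) (bf frn v) (bf frm v).
Definition ofH w : V := rscale fr1 (la w o0 0) + rscale fr2 (la w o1 0) +
  rscale fr3 (la w o2 0) + rscale fr4 (la w o3 0) + rscale frm (mu w) + rscale frn (nu w).

Lemma ppVE : pp^-1 = Quat 2^-1 (- 2^-1) 0 0.
Proof.
apply: (mulrI (x := pp)); first by rewrite unitq pp_neq0.
by rewrite quat_mulxV ?pp_neq0 // ppE !qE; congr Quat; field.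
Qed.

Lemma v4_0 : (0 : W) = v4 0 0 0 0.
Proof. by apply: v4P; rewrite v4E mxE. Qed.

Lemma bf_vec34 a b c d m n a' b' c' d' m' n' :
  bf (vec3 (v4 a b c d) m n) (vec3 (v4 a' b' c' d') m' n') =
  qconj a * a' + qconj b * b' + qconj c * c' + qconj d * d' + qconj m * n' + qconj n * m'.
Proof. by rewrite /bf !vec3E ip4 !v4E. Qed.

Lemma frame_points : [/\ points bL fr1, points bL fr2, points bL fr3 & points bL fr4] /\
  points bL frn /\ points bL frm.
Proof.
have pV1 : 1 = pp^-1 * pp :> Q by rewrite quat_mulVx // pp_neq0.
have pV0 : 0 = pp^-1 * 0 :> Q by rewrite mulr0.
have hp := @inP_pp R; have h0 := @inP0 R; have hN := inPN hp.
have two : exists2 h : Q, hurwitz h & pp + pp = 2 * h.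
  by exists pp; [exact: hurwitz_pp|rewrite (natq R 2); qring].
have ho : hurwitz qomega by rewrite /qomega; hurwitz_tac.
have h1 := @hurwitz1 R; have he := @hurwitz_eta R; have hpp := @hurwitz_pp R.
split; [split|split].
- by apply: pts_vec3 => //; exact: (adm0 aB).
- apply: pts_vec3 => //; rewrite pV0 pV1.
  by apply: bwP_v4; rewrite ?subrr ?sub0r ?addr0.
- apply: pts_vec3 => //; rewrite pV0 pV1.
  by apply: bwP_v4; rewrite ?subrr ?sub0r ?addr0.
- apply: pts_vec3 => //; rewrite pV0 pV1.
  by apply: bwP_v4; rewrite ?subrr ?sub0r ?addr0.
- apply: pts_vec3 => //; last exact: hurwitzM.
  by rewrite -bwFE; exact: bwF_pts.
have hI := @hurwitzI R.
apply: pts_vec3; [|exact: hurwitzN|by apply/hurwitzN/hurwitzM].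
rewrite -mulrN; apply: bwP_v4; rewrite ?subrr //; first exact: hurwitzN.
exists (- (qI R + qI R)); first by hurwitz_tac.
by rewrite (natq R 2); qring.
Qed.

Lemma qomegaE : qomega = Quat (- 2^-1) 2^-1 2^-1 2^-1.
Proof. by rewrite /qomega /qeta oppqE !opprK. Qed.
Lemma qomega_pp : qomega * pp = Quat (-1) 0 1 0.
Proof. by rewrite qomegaE ppE mulqE; congr Quat; field. Qed.
Lemma fr1E : fr1 = vec3 (v4 0 0 0 0) 1 (Quat 2^-1 2^-1 2^-1 2^-1).
Proof. by rewrite /fr1 v4_0. Qed.
Lemma fr2E : fr2 = vec3 (v4 1 1 0 0) 1 (Quat (- 2^-1) 2^-1 2^-1 2^-1).
Proof. by rewrite /fr2 qomegaE. Qed.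
Lemma fr3E : fr3 = vec3 (v4 1 0 1 0) 1 (Quat (- 2^-1) 2^-1 2^-1 2^-1).
Proof. by rewrite /fr3 qomegaE. Qed.
Lemma fr4E : fr4 = vec3 (v4 1 0 0 1) 1 (Quat (- 2^-1) 2^-1 2^-1 2^-1).
Proof. by rewrite /fr4 qomegaE. Qed.
Lemma frnE : frn = vec3 (v4 (Quat 1 1 0 0) 0 0 0) (Quat 1 1 0 0) (Quat (-1) 0 1 0).
Proof. by rewrite /frn qomega_pp ppE. Qed.
Lemma frmE : let q := Quat (- 2^-1) (- 2^-1) 0 0 in
  frm = vec3 (v4 q q q q) (Quat (-1) (-1) 0 0) (Quat 1 0 (-1) 0).
Proof.
rewrite /frm qomega_pp; set q := - (_ * _).
have -> : q = Quat (- 2^-1) (- 2^-1) 0 0.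
  by rewrite /q ppVE /qI mulqE oppqE; congr Quat; field.
by rewrite ppE !oppqE oppr0 opprK.
Qed.

Ltac frame := rewrite ?fr1E ?fr2E ?fr3E ?fr4E ?frnE ?frmE ?bf_vec34 ?(zeroqE, oneqE) ?qconjE;
  rewrite ?mulqE ?addqE; repeat split; congr Quat; field.

Lemma frame_gram1 : [/\ bf fr1 fr1 = 1, bf fr1 fr2 = 0, bf fr1 fr3 = 0 & bf fr1 fr4 = 0] /\
  bf fr1 frn = 0 /\ bf fr1 frm = 0.
Proof. by frame. Qed.
Lemma frame_gram2 : [/\ bf fr2 fr2 = 1, bf fr2 fr3 = 0, bf fr2 fr4 = 0 & bf fr2 frn = 0] /\
  bf fr2 frm = 0.
Proof. by frame. Qed.
Lemma frame_gram3 : [/\ bf fr3 fr3 = 1, bf fr3 fr4 = 0, bf fr3 frn = 0 & bf fr3 frm = 0].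
Proof. by frame. Qed.
Lemma frame_gram4 : [/\ bf fr4 fr4 = 1, bf fr4 frn = 0 & bf fr4 frm = 0] /\
  [/\ bf frn frn = 0, bf frn frm = 1 & bf frm frm = 0].
Proof. by frame. Qed.

Lemma bf_ofH v w : bf v (ofH w) = bf v fr1 * la w o0 0 + bf v fr2 * la w o1 0 +
  bf v fr3 * la w o2 0 + bf v fr4 * la w o3 0 + bf v frm * mu w + bf v frn * nu w.
Proof.
rewrite /ofH; move: fr1 fr2 fr3 fr4 frm frn => f1 f2 f3 f4 fm fn.
by rewrite !bfDr !bfZr.
Qed.

Lemma bf_toH v w : bf (toH v) w = bf v (ofH w).
Proof.
rewrite bf_ofH /toH; move: fr1 fr2 fr3 fr4 frm frn => f1 f2 f3 f4 fm fn.
rewrite {1}/bf la_vec3 mu_vec3 nu_vec3 ip4 !v4E !bfC.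
by rewrite -!addrA; do 4!congr (_ + _); rewrite addrC.
Qed.

Lemma toH_ofH : cancel ofH toH.
Proof.
move=> w; have [[a1 a2 a3 a4] [a5 a6]] := frame_gram1.
have [[b2 b3 b4 b5] b6] := frame_gram2; have [c3 c4 c5 c6] := frame_gram3.
have [[d4 d5 d6] [e5 e6 f6]] := frame_gram4.
have sym u v t : bf u v = t -> bf v u = qconj t by move=> <-; rewrite bfC.
have s := (sym _ _ _ a2, sym _ _ _ a3, sym _ _ _ a4, sym _ _ _ a5, sym _ _ _ a6, sym _ _ _ b3,
   sym _ _ _ b4, sym _ _ _ b5, sym _ _ _ b6).
have s' := (sym _ _ _ c4, sym _ _ _ c5, sym _ _ _ c6, sym _ _ _ d5, sym _ _ _ d6, sym _ _ _ e6).
have g := (a1, a2, a3, a4, a5, a6, b2, b3, b4, b5, b6, c3, c4, c5, c6, d4, d5, d6, e5, e6, f6).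
apply: vecP; rewrite /toH !vec3E; last 2 first.
- by rewrite bf_ofH !(g, s, s') !qconj0 ?qconj1 !mul0r !mul1r !(addr0, add0r).
- by rewrite bf_ofH !(g, s, s') !qconj0 ?qconj1 !mul0r !mul1r !(addr0, add0r).
by apply: v4P; rewrite v4E bf_ofH !(g, s, s') ?qconj0 ?qconj1 !mul0r !mul1r !(addr0, add0r).
Qed.

Lemma ofH_toH : cancel toH ofH.
Proof.
move=> v; rewrite -[RHS]vec3_eta -(vec3_eta v) (v4_eta (la v)).
move: (la v o0 0) (la v o1 0) (la v o2 0) (la v o3 0) (mu v) (nu v) => a b c d m n {v}.
set X := n + qconj qomega * m; set S := a + b + c + d.
have [q qE'] : exists q : Q, q = - (pp^-1 * qI R) by eexists.
have qp : q * qconj pp = -1.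
  by rewrite qE' ppVE ppE /qI qconjE !mulqE oneqE ?oppqE ?mulqE; congr Quat; field.
have pq : pp * qconj q = -1.
  by have := congr1 (@qconj R) qp; rewrite qconjM qconjK => ->; rewrite qconjN qconj1.
have p2 : pp * qconj pp = rq 2 by rewrite mulq_conj nq_pp.
set v := vec3 _ _ _.
have e1 : bf fr1 v = n + qconj qeta * m.
  by rewrite /fr1 v4_0 /v bf_vec34 qconj0 qconj1 !mul0r !add0r mul1r.
have e2 : bf fr2 v = a + b + X.
  by rewrite /fr2 /v bf_vec34 qconj0 qconj1 !mul0r !addr0 !mul1r /X addrA.
have e3 : bf fr3 v = a + c + X.
  by rewrite /fr3 /v bf_vec34 qconj0 qconj1 !mul0r !addr0 !mul1r /X addrA.
have e4 : bf fr4 v = a + d + X.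
  by rewrite /fr4 /v bf_vec34 qconj0 qconj1 !mul0r !addr0 !mul1r /X addrA.
have e5 : bf frn v = qconj pp * (a + X).
  by rewrite /frn /v bf_vec34 qconj0 !mul0r !addr0 qconjM -mulrA -!mulrDr -addrA.
have e6 : bf frm v = qconj q * S - qconj pp * X.
  rewrite /frm -qE' /v bf_vec34 !qconjN qconjM /S /X !mulNr -mulrA; clear.
  move: (qconj pp) => p'; rewrite 3!(mulrDr (qconj q)) (mulrDr p').
  by rewrite opprD !addrA.
rewrite /ofH /toH !vec3E !v4E e1 e2 e3 e4 e5 e6 {e1 e2 e3 e4 e5 e6}.
have T : pp * (qconj q * S - qconj pp * X) = - S - (X + X).
  by rewrite mulrBr !mulrA pq p2 mulq2 mulN1r.
have U : q * (qconj pp * (a + X)) = - (a + X) by rewrite mulrA qp mulN1r.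
have U2 : pp * (qconj pp * (a + X)) = (a + X) + (a + X) by rewrite mulrA p2 mulq2.
apply: vecP; rewrite !vlinE !vec3E.
- apply: v4P; rewrite !colD !rscaleE !v4E ?mxE ?mul0r ?mul1r ?add0r ?addr0 -?qE' U ?T /S.
  + by clear T U U2; move: X => Y; qring.
  + by clear T U U2; move: X => Y; qring.
  + by clear T U U2; move: X => Y; qring.
  + by clear T U U2; move: X => Y; qring.
- rewrite !mul1r mulNr U2 T.
  have e : m = qconj qeta * m - qconj qomega * m.
    by rewrite -mulrBl /qomega qconjN qconjK opprK -[LHS]mul1r; congr (_ * _); rewrite /qeta addqE /= ; congr Quat; field.
  rewrite [RHS]e; have -> : qconj qomega * m = X - n by rewrite /X addrC addKr.
  by rewrite /S; clear T U U2; move: X (qconj qeta * m) => Y Z; qring.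
- rewrite (mulNr (qomega * pp)) -!(mulrA qomega pp) U2 T.
  have e : n = qeta * n + m - qomega * X.
    rewrite /X mulrDr mulrA (_ : qomega * qconj qomega = 1); last first.
      by rewrite mulq_conj /qomega nqN nq_conj /nq /qeta /=; have -> : 2^-1 ^+ 2 + 2^-1 ^+ 2 + 2^-1 ^+ 2 + 2^-1 ^+ 2 = 1 :> R by field.
    rewrite mul1r opprD addrACA subrr addr0 -mulrBl /qomega opprK -[LHS]mul1r; congr (_ * _).
    by rewrite /qeta addqE /=; congr Quat; field.
  rewrite [RHS]e mulrDr mulrA mulq_conj (_ : nq qeta = 1); last by rewrite /nq /qeta /=; field.
  rewrite rq1 mul1r /S; clear T U U2 e; move: X qomega => Y o.
  rewrite -!addrA; congr (_ + (_ + _)); rewrite -!mulrN -!mulrDr; congr (_ * _).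
  by qring.
Qed.

(** The frame consists of lattice points: pairings with it are Hurwitz integers, and Hurwitz
    combinations of it are lattice points, so the two inverse maps exchange the lattices. *)
Lemma toH_isometry : isometry bL hL toH.
Proof.
have [[p1 p2 p3 p4] [pn pm]] := frame_points.
split.
- move=> v w; rewrite /toH; move: fr1 fr2 fr3 fr4 frm frn => f1 f2 f3 f4 fm fn.
  rewrite !bfDr; apply: vecP; rewrite !vlinE !vec3E //.
  by apply: v4P; rewrite colD !v4E.
- move=> v a; rewrite /toH; move: fr1 fr2 fr3 fr4 frm frn => f1 f2 f3 f4 fm fn.
  rewrite !bfZr; apply: vecP; rewrite !vlinE !vec3E //.
  by apply: v4P; rewrite rscaleE !v4E.
- by move=> v w; rewrite !hform_lat bf_toH ofH_toH.
- by exists ofH; [exact: ofH_toH|exact: toH_ofH].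
apply/seteqP; split=> [_ [v Lv <-]|w /points_lat[hw m n]].
  apply: pts_vec3; [|exact: (pts_bf aB)|exact: (pts_bf aB)].
  by elim/forall4; rewrite v4E; exact: (pts_bf aB).
exists (ofH w); last exact: toH_ofH.
by repeat first [apply: (ptsD aB) | apply: (ptsZ aB)].
Qed.

Lemma hform_I51 (x y : 'cV[Q]_(5 + 1)) : hform (I51 R) x y =
  \sum_(i < 5) qconj (x (lshift 1 i) 0) * y (lshift 1 i) 0 -
  qconj (x (rshift 5 0) 0) * y (rshift 5 0) 0.
Proof.
have dE (D : 'rV[Q]_(5 + 1)) : hform (QLattice (diag_mx D) (@Hn R (5 + 1))) x y =
    \sum_j qconj (x j 0) * D 0 j * y j 0.
  rewrite hformE; apply: eq_bigr => j _; rewrite /= (bigD1 j) //= big1 ?addr0.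
    by rewrite mxE eqxx mulr1n.
  by move=> i /negPf ij; rewrite mxE ij mulr0n mulr0 mul0r.
transitivity (\sum_j qconj (x j 0) * row_mx (const_mx 1 : 'rV[Q]_5) (const_mx (- 1) : 'rV_1) 0 j * y j 0).
  exact: dE.
rewrite big_split_ord big_ord1 /=; congr (_ + _).
  by apply: eq_bigr => i _; rewrite row_mxEl mxE mulr1.
by rewrite row_mxEr mxE mulrN1 mulNr.
Qed.

(** Diagonalizes the hyperbolic plane over the Hurwitz integers, thanks to [qeta + qconj qeta = 1].
    The fifth coordinate is the pairing with the short root (0; 1, [qeta]). *)
Definition toI v : 'cV[Q]_(5 + 1) :=
  col_mx (col_mx (la v) (nu v + qconj qeta * mu v)%:M : 'cV[Q]_(4 + 1)) (qeta * mu v - nu v)%:M.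
Definition ofI (x : 'cV[Q]_(5 + 1)) : V :=
  let y : 'cV[Q]_(4 + 1) := usubmx x in
  let a := dsubmx y 0 0 in let b := dsubmx x 0 0 in
  vec3 (usubmx y) (a + b) (qeta * a - qconj qeta * b).

Lemma eta_conj : qeta + qconj qeta = 1.
Proof. by rewrite /qeta addqE oneqE; congr Quat; field. Qed.
Lemma eta_unit : qeta * qconj qeta = 1 /\ qconj qeta * qeta = 1.
Proof.
have n1 : nq qeta = 1 by rewrite /nq /qeta /=; field.
by rewrite mulq_conj mul_conjq n1.
Qed.

Lemma toI_ofI : cancel ofI toI.
Proof.
move=> x.
rewrite /toI /ofI !vec3E; apply: etrans (@vsubmxK _ 5 1 1 x); congr col_mx.
  apply: etrans (@vsubmxK _ 4 1 1 (usubmx x)); congr col_mx.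
  apply: etrans (esym (scalar11 _)); congr (_%:M).
  by rewrite mulrDr addrACA addNr addr0 -mulrDl eta_conj mul1r.
apply: etrans (esym (scalar11 _)); congr (_%:M).
by rewrite mulrDr opprB addrC addrA subrK -mulrDl addrC eta_conj mul1r.
Qed.

Lemma ofI_toI : cancel toI ofI.
Proof.
move=> v; have [e1 e2] := eta_unit.
rewrite /ofI /toI !(col_mxKu, col_mxKd) ![_%:M _ _]mxE !mulr1n.
apply: vecP; rewrite !vec3E //.
  by rewrite addrC addrA subrK -mulrDl eta_conj mul1r.
rewrite mulrDr mulrBr !mulrA e1 e2 mul1r opprB addrACA subrr addr0.
by rewrite -mulrDl eta_conj mul1r.
Qed.

Lemma toI_form v w : hform (I51 R) (toI v) (toI w) = bf v w.
Proof.
have [e1 e2] := eta_unit.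
rewrite hform_I51 !col_mxEd ![_%:M _ _]mxE.
under eq_bigr => i _ do rewrite !col_mxEu.
rewrite (@big_split_ord _ _ _ 4 1 xpredT) big_ord1.
under eq_bigr => i _ do rewrite !(@col_mxEu _ 4 1 1).
rewrite !(@col_mxEd _ 4 1 1) ![_%:M _ _]mxE /= /bf -[in RHS]addrA -[LHS]addrA; congr (_ + _).
move: (mu v) (mu w) (nu v) (nu w) => m m' n n'; rewrite !mulr1n.
have -> : qconj (n + qconj qeta * m) = qconj n + qconj m * qeta by rewrite qconjD qconjM qconjK.
have -> : qconj (qeta * m - n) = qconj m * qconj qeta - qconj n by rewrite qconjB qconjM.
have -> : (qconj n + qconj m * qeta) * (n' + qconj qeta * m') =
   qconj n * n' + qconj n * qconj qeta * m' + (qconj m * qeta * n' + qconj m * m').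
  by rewrite mulrDl !mulrDr !mulrA -(mulrA (qconj m) qeta (qconj qeta)) e1 mulr1.
have -> : (qconj m * qconj qeta - qconj n) * (qeta * m' - n') =
   qconj m * m' - qconj m * qconj qeta * n' - (qconj n * qeta * m' - qconj n * n').
  by rewrite mulrBl !mulrBr !mulrA -(mulrA (qconj m) (qconj qeta) qeta) e2 mulr1.
have -> : qconj m * n' = qconj m * qeta * n' + qconj m * qconj qeta * n'.
  by rewrite -mulrDl -mulrDr eta_conj mulr1.
have -> : qconj n * m' = qconj n * qeta * m' + qconj n * qconj qeta * m'.
  by rewrite -mulrDl -mulrDr eta_conj mulr1.
move: (qconj m * m') (qconj n * n') (qconj m * qeta * n') (qconj m * qconj qeta * n') => A B C D.
by move: (qconj n * qeta * m') (qconj n * qconj qeta * m') => E F; qring.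
Qed.

Lemma toI_isometry : isometry hL (I51 R) toI.
Proof.
have he := @hurwitz_eta R; have hc := hurwitz_conj he.
split.
- move=> v w; rewrite /toI !vlinE !mulrDr; apply: etrans _ (esym (@add_col_mx _ 5 1 1 _ _ _ _)).
  congr col_mx.
    apply: etrans _ (esym (@add_col_mx _ 4 1 1 _ _ _ _)); congr col_mx.
    by rewrite -raddfD addrACA.
  by rewrite -raddfD opprD addrACA.
- move=> v a; rewrite /toI !vlinE; apply: etrans _ (esym (@mul_col_mx _ 5 1 _ _ _ _ _)).
  congr col_mx.
    apply: etrans _ (esym (@mul_col_mx _ 4 1 _ _ _ _ _)); congr col_mx.
    by rewrite -scalar_mxM mulrDl mulrA.
  by rewrite -scalar_mxM mulrBl mulrA.
- by move=> v w; rewrite hform_lat toI_form.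
- by exists ofI; [exact: ofI_toI|exact: toI_ofI].
apply/seteqP; split=> [_ [v /points_lat[hl hm hn] <-]|x hx].
  move=> i; case: (@split_ordP 5 1 i) => j ->.
    rewrite col_mxEu; case: (@split_ordP 4 1 j) => {}j ->.
      by rewrite (@col_mxEu _ 4 1 1); exact: hl.
    by rewrite (@col_mxEd _ 4 1 1) mxE ord1 mulr1n; hurwitz_tac.
  by rewrite col_mxEd mxE ord1 mulr1n; hurwitz_tac.
exists (ofI x); last exact: toI_ofI.
have h1 : hurwitz (dsubmx (usubmx x : 'cV[Q]_(4 + 1)) 0 0).
  by rewrite [dsubmx _ _ _]mxE [usubmx _ _ _]mxE; exact: hx.
have h2 : hurwitz (dsubmx x 0 0) by rewrite mxE; exact: hx.
apply: pts_vec3; last 2 first.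
- exact: hurwitzD.
- by hurwitz_tac.
by move=> i; rewrite [usubmx _ _ _]mxE [usubmx _ _ _]mxE; exact: hx.
Qed.

Lemma bw_hyperbolic_I51 : isometric (bw_hyperbolic R) (I51 R).
Proof. by exists (toI \o toH); apply: isometry_comp toH_isometry toI_isometry. Qed.
End Models.

(** * Descent for null vectors *)

Section Descent.
Variable R : realType.
Local Notation Q := (quat R).
Local Notation W := 'cV[Q]_4.
Local Notation V := 'cV[Q]_(4 + (1 + 1)).
Local Notation pp := (pp R).
Local Notation rho := (rho R).
Local Notation qeta := (qeta R).
Local Notation frn := (frn R).
Local Notation L := (lat (@bwP R)).
Local Notation hL := (lat (@Hn R 4)).
Local Notation aB := (@bw_adm R).
Local Notation aH := (@Hn_adm R).
Implicit Types (x y D : W) (v w : V) (a b : Q) (k : 'I_4) (c : R).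

Definition short_perp v := exists r, [/\ points L r, bf r r = 1 & bf r v = 0].
(** The bound c is a parameter because the descent over H^4 compares with [nq (bf frn v)] in place
    of [nq (mu v)]. *)
Definition step c v := short_perp v \/ exists2 g, Reflec0 L g & nq (mu (g v)) < c.

Lemma Aut_mu (P : set W) U v : AutL (lat P) U -> U rho = rho -> mu (U v) = mu v.
Proof. by move=> hU Ur; rewrite -bf_rho -{1}Ur; have [_ _ -> _] := AutE hU; rewrite bf_rho. Qed.

Lemma Reflec_cancel (P : set W) (f g : V -> V) : Reflec (lat P) f ->
  Reflec (lat P) (f \o g) -> Reflec (lat P) g.
Proof.
move=> /Reflec_inv[f' hf' [fK _]] hfg; have := Reflec_comp hf' hfg.
by congr (Reflec _); apply: funext => v; rewrite /= fK.
Qed.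

Lemma short_perp_aut U v : AutL L U -> short_perp (U v) -> short_perp v.
Proof.
move=> hU [r [Lr rr rv]]; have [U' hU' [UK KU]] := Aut_inv hU.
have [_ _ uB uP] := AutE hU'; exists (U' r); split; first exact: uP.
  by rewrite uB.
by rewrite -(UK v) uB.
Qed.

Lemma step_aut U c v : AutL L U -> U rho = rho -> step c (U v) -> step c v.
Proof.
move=> hU Ur [h|[g hg lt]]; first by left; exact: short_perp_aut hU h.
have [U' hU' [UK KU]] := Aut_inv hU; right; exists (U' \o g \o U).
  exact: (Reflec0_isom hU' KU UK hg).
by rewrite /= (Aut_mu _ hU') // -Ur UK.
Qed.

Lemma step_trans c c' v : c <= c' -> step c v -> step c' v.
Proof. by move=> cc [h|[g hg lt]]; [left|right; exists g => //; exact: lt_le_trans cc]. Qed.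

Lemma step_Reflec0 g c v : Reflec0 L g -> step c (g v) -> step c v.
Proof.
move=> hg [h|[g' hg' lt]]; first by left; exact: short_perp_aut (Reflec0_Aut aB hg) h.
by right; exists (g' \o g) => //; exact: Reflec0_comp.
Qed.

Lemma toH_rho : toH rho = vec3 (ones R) (qconj pp) (- qconj pp).
Proof.
rewrite /toH -![bf _ rho]bfC !bf_rho /fr1 /fr2 /fr3 /fr4 /frn /frm !vec3E !qconj1.
by rewrite qconjN.
Qed.

Lemma Geq_toH_rho : Geq (rscale (toH rho) (qI R)) (vec3 (ones R) pp (- pp)).
Proof.
have hI := @hurwitzI R; have nI : nq (qI R) = 1 by rewrite /qI /nq /=; ring.
have pI : qconj pp * qI R = pp by rewrite ppE /qI qconjE mulqE; congr Quat; ring.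
rewrite toH_rho rscale_vec3 mulNr pI.
have E k : rscale (ones R) (qI R) k 0 = qI R.
  by rewrite rscaleE; elim/forall4: k; rewrite v4E mul1r.
apply: Geq_ones => k; by rewrite E.
Qed.

Lemma toH_points v : points L v -> points hL (toH v).
Proof. by have [_ _ _ _ <-] := toH_isometry R => Lv; exists v. Qed.
Lemma ofH_points w : points hL w -> points L (ofH w).
Proof. by have [_ _ _ _ <-] := toH_isometry R => -[v Lv <-]; rewrite ofH_toH. Qed.
Lemma bf_toH_toH v w : bf (toH v) (toH w) = bf v w.
Proof. by rewrite bf_toH ofH_toH. Qed.
Lemma bf_ofH_ofH v w : bf (ofH v) (ofH w) = bf v w.
Proof. by rewrite -bf_toH toH_ofH. Qed.

Lemma null_mu0 v : bf v v = 0 -> mu v = 0 -> la v = 0.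
Proof.
by rewrite bf_self => /(congr1 (@qre R)) + m0; rewrite rqE m0 qconj0 mul0r mulr0 addr0 => /nrm_eq0.
Qed.

(* Descent on the norm of [bf frn v] in the model over H^4, until some image of
   [rho] has an inner product of smaller norm with [v]. *)
Lemma cusp_step v : points L v -> bf v v = 0 -> step (nq (bf frn v)) v.
Proof.
have muH w : bf frn w = mu (toH w) by rewrite /toH vec3E.
have Ln : points L frn by have [_ []] := frame_points R.
move=> Lv; have [m mE] := hurwitz_nq (pts_bf aB Ln Lv).
have [n] := ubnP m; elim: n m v mE Lv => // n IH m v mE Lv le v0.
have LH := toH_points Lv; have vH : bf (toH v) (toH v) = 0 by rewrite bf_toH_toH.
have [m0|m0] := eqVneq (mu (toH v)) 0.
  (* Here [toH v] is a multiple of the vector [rho] of the model over H^4, which is orthogonal to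
     the unit vectors of H^4. *)
  left; have [Lr rr] := axis_root o0 (@hurwitz0 R).
  exists (ofH (vec3 (axis o0 1) 0 0)); split; first exact: ofH_points.
    by rewrite bf_ofH_ofH.
  rewrite -(ofH_toH v) bf_ofH_ofH /bf (null_mu0 vH m0) m0 !vec3E ip0r mulr0 qconj0 mul0r.
  by rewrite !addr0.
have [[r [Lr rr rv]]|[g hg lt]|[w Gw lt]] := nstep LH vH m0.
- left; exists (ofH r); split; first exact: ofH_points.
    by rewrite bf_ofH_ofH.
  by rewrite -(ofH_toH v) bf_ofH_ofH.
- have hg' : Reflec0 L (@ofH R \o g \o @toH R).
    apply: (Reflec0_isom _ (@toH_ofH R) (@ofH_toH R) hg).
    exact: isom_inv (toH_isometry R) (@ofH_toH R) (@toH_ofH R).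
  apply: (step_Reflec0 hg'); pose v' := ofH (g (toH v)); rewrite -[X in step _ X]/v'.
  have lt' : nq (bf frn v') < nq (bf frn v) by rewrite !muH /v' /= toH_ofH.
  apply: step_trans (ltW lt') _; have [_ _ gB gP] := AutE (Reflec0_Aut aB hg').
  have [m' m'E] := hurwitz_nq (pts_bf aB Ln (gP _ Lv)).
  have lt2 : (m' < n)%N by apply: leq_trans (_ : (m <= n)%N); rewrite // -(ltr_nat R) -mE -m'E.
  by apply: (IH m') => //; [exact: (gP _ Lv)|rewrite -v0; exact: gB].
- have [g hg gw] := Geq_trans Gw (Geq_sym Geq_toH_rho).
  right; exists (@ofH R \o g \o @toH R).
    apply: (Reflec0_isom _ (@toH_ofH R) (@ofH_toH R) hg).
    exact: isom_inv (toH_isometry R) (@ofH_toH R) (@toH_ofH R).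
  have [_ _ gB _] := AutE (Reflec0_Aut aH hg).
  have nI : nq (qI R) = 1 by rewrite /qI /nq /=; ring.
  move: lt; rewrite -gB gw bfZl nqM nq_conj nI mul1r bf_toH bf_rho /= muH.
  by [].
Qed.

(** With u = [mu v], the vector v conj(u) + [rho] [qeta] is a short root, and a reflection of order
    6 in it cancels its null component v conj(u), leaving a multiple of [rho]. *)
Lemma null_unit v : points L v -> bf v v = 0 -> nq (mu v) = 1 ->
  exists2 g, Reflec0 L g & exists2 a, hurwitz a & g v = rscale rho a.
Proof.
move=> /points_lat[l1 l2 l3] v0 n1.
set u := mu v in n1 l2.
have uu : u * qconj u = 1 by rewrite mulq_conj n1.
have uu' : qconj u * u = 1 by rewrite mul_conjq n1.
have [e1 e2] := eta_unit R.
pose l := rscale (la v) (qconj u).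
have [n nd] : exists n, n = nu v * qconj u by eexists.
have vE : v = rscale (vec3 l 1 n) u.
  by rewrite rscale_vec3 /l nd rscaleA uu' rscale1 mul1r -mulrA uu' mulr1 vec3_eta.
have hc := hurwitz_conj l2; have he := @hurwitz_eta R.
have Pl : bwP l by apply: (admZ aB).
have nE : nrm l + 2 * qre n = 0.
  have := v0; rewrite {1 2}vE bfZl bfZr mulrA => /(congr1 (fun z => u * z * qconj u)).
  rewrite !mulrA uu mul1r -mulrA uu mulr1 mulr0 mul0r bf_self !vec3E qconj1 mul1r.
  by move=> /(congr1 (@qre R)).
pose r : V := vec3 l 1 (n + qeta).
have Lr : points L r.
  by apply: pts_vec3 => //; [exact: hurwitz1|rewrite nd; hurwitz_tac].
have rr : bf r r = 1.
  rewrite bf_self !vec3E qconj1 mul1r qreD mulrDr addrA nE add0r -rq1; congr rq.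
  by rewrite /=; field.
exists (reflection L (qconj qeta) r).
  by apply: refl_Reflec0; rewrite ?nq_conj //; [exact: hurwitz_conj|rewrite /nq /qeta /=; field].
exists (- qeta * u); first by hurwitz_tac.
have e3 : 1 - qconj qeta = qeta by rewrite -(eta_conj R) addrK.
have rv : bf r v = qconj qeta * u.
  rewrite {1}vE bfZr; congr (_ * _); rewrite /bf !vec3E ip_nrm qconj1 mul1r mulr1 qconjD.
  rewrite addrA -[RHS]add0r; congr (_ + _); apply: quatP; rewrite !qprojE ?rqE; clear -nE; lra.
rewrite refl_short // e3 rv mulrA e1 mul1r {1}vE -rscaleA -rscaleNl -rscaleDl.
congr rscale; apply: vecP; rewrite !vlinE !vec3E ?rscale0l ?mul0r ?subrr //.
by rewrite opprD addrA subrr add0r mul1r.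
Qed.
End Descent.

(** * Norm decrease in the Barnes-Wall model *)

Section FirstPart.
Variable R : realType.
Local Notation Q := (quat R).
Local Notation W := 'cV[Q]_4.
Local Notation V := 'cV[Q]_(4 + (1 + 1)).
Local Notation pp := (pp R).
Local Notation rho := (rho R).
Local Notation qeta := (qeta R).
Local Notation qomega := (qomega R).
Local Notation frn := (frn R).
Local Notation L := (lat (@bwP R)).
Local Notation aB := (@bw_adm R).
Implicit Types (x y D : W) (v w : V) (a b s : Q) (k : 'I_4) (c : R).

Definition E1 : W := v4 1 0 0 0.

Lemma nrm_E1 : nrm E1 = 1. Proof. by rewrite nrm4 !v4E nq1 nq0 !addr0. Qed.
Lemma E1_pp : rscale E1 pp = v4 pp 0 0 0.
Proof. by apply: v4P; rewrite rscaleE !v4E ?mul0r ?mul1r. Qed.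

(* The null vectors [vec3 (rscale E1 pp) pp (s * pp)] with [s] not a Hurwitz
   integer belong to the orbit of the line of [rho], those with [s] in the Hurwitz
   integers to that of [frn]. *)
Lemma half_cusp s : hurwitz (s * pp) -> ~ hurwitz s -> 2 * qre s = -1 ->
  exists2 g, Reflec0 L g & exists2 a, hurwitz a & g (vec3 (rscale E1 pp) pp (s * pp)) = rscale rho a.
Proof.
move=> hs ns sE; set n := vec3 _ _ _.
have hp := @hurwitz_pp R.
have Ln : points L n by apply: pts_vec3 => //; rewrite E1_pp -bwFE; exact: bwF_pts.
have n0 : bf n n = 0 by apply: cusp_null; rewrite nrm_E1.
have m0 : mu n != 0 by rewrite vec3E pp_neq0.
have [t [ht tE ht']] : exists t, [/\ hurwitz t, 2 * qre t = 1%:~R & s + t = 0 \/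
    exists f, [/\ hurwitz f, nq f = 1, 2 * qre f = 1 & nq (s + t - f) < 1]].
  apply: near_order6; have -> : qre s + 1%:~R / 2 = 0 by lra.
  by rewrite lexx invr_ge0 ler0n.
have {ht'} [f [hf nf rf lt1]] : exists f, [/\ hurwitz f, nq f = 1, 2 * qre f = 1 & nq (s + t - f) < 1].
  case: ht' => // e; exfalso; apply: ns; rewrite -(addrK t s) e sub0r; exact: hurwitzN.
pose r : V := vec3 0 1 (qconj t).
have Lr : points L r.
  by apply: pts_vec3; [exact: (adm0 aB)|exact: hurwitz1|exact: hurwitz_conj].
have rr : bf r r = 1.
  by rewrite bf_self !vec3E nrm0 qconj1 mul1r qre_conj add0r tE.
have [||g hg] := @refl_reduce R (@bwP R) r n f Lr rr _ m0 hf nf rf.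
- by rewrite vec3E.
- rewrite bf_vec3 // ip0l add0r qconjK !vec3E -mulrA quat_mulxV ?pp_neq0 // mulr1 //.
have [_ _ gB gP] := AutE (Reflec0_Aut aB hg).
have Lg := gP _ Ln; have g0 : bf (g n) (g n) = 0 by rewrite gB.
have /points_lat[_ gm gn] := Lg.
rewrite vec3E nq_pp; have [m mE] := hurwitz_nq gm; rewrite mE ltr_nat => m2.
(* The original height [pp] has norm 2, so a single decrease leaves 0, where the vector is on the
   line of [rho], or 1, where [null_unit] applies. *)
have [m1|m1] : (m = 0 \/ m = 1)%N by lia.
  have gm0 : mu (g n) = 0 by apply/eqP; rewrite -nq_eq0 mE m1.
  exists g => //; exists (nu (g n)) => //.
  apply: vecP; rewrite !vlinE !vec3E ?rscale0l ?mul0r ?mul1r //.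
  exact: null_mu0.
have [|h hh [a ha hE]] := null_unit Lg g0; first by rewrite mE m1.
by exists (h \o g); [exact: Reflec0_comp|exists a].
Qed.

Lemma E1_axis_pts k q : q8 q -> bwP (E1 + axis k q).
Proof.
move=> /q8_props[hq nq_ pq1 pq]; have [h hh hE] := inP_two_l pq.
have hp := @inP_pp R; have h0 := @inP0 R; have hN := inPN hp; have hpp := @hurwitz_pp R.
have pq' : inP (pp * q) by exists q.
have pqp : inP (pp * q - pp) by exact: inPB.
have p1q : inP (pp * (1 + q)) by exists (1 + q); first exact: inP_hurwitz.
have hpq : hurwitz (pp * (1 + q)) by exact: inP_hurwitz.
have eE : pp + pp * q = 2 * h by rewrite -{1}(mulr1 pp) -mulrDr.
have V0 (a b c d : Q) : v4 a b c d =
    v4 (pp^-1 * (pp * a)) (pp^-1 * (pp * b)) (pp^-1 * (pp * c)) (pp^-1 * (pp * d)).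
  by rewrite !ppVK.
elim/forall4: k.
- have -> : E1 + axis o0 q = v4 (1 + q) 0 0 0.
    by apply: v4P; rewrite colD axisE !v4E //= addr0.
  rewrite V0 mulr0; apply: bwP_v4; rewrite ?sub0r //; do ?exact: inPN.
  by exists h => //; rewrite !addr0.
- have -> : E1 + axis o1 q = v4 1 q 0 0.
    by apply: v4P; rewrite colD axisE !v4E //= ?addr0 ?add0r.
  rewrite V0 mulr0 mulr1; apply: bwP_v4; rewrite ?sub0r //.
  by exists h => //; rewrite !addr0.
- have -> : E1 + axis o2 q = v4 1 0 q 0.
    by apply: v4P; rewrite colD axisE !v4E //= ?addr0 ?add0r.
  rewrite V0 mulr0 mulr1; apply: bwP_v4; rewrite ?sub0r //.
  by exists h => //; rewrite !addr0.
- have -> : E1 + axis o3 q = v4 1 0 0 q.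
    by apply: v4P; rewrite colD axisE !v4E //= ?addr0 ?add0r.
  rewrite V0 mulr0 mulr1; apply: bwP_v4; rewrite ?sub0r //.
  by exists h => //; rewrite !addr0.
Qed.

Lemma root_case v l : points L v -> bf v v = 0 -> mu v != 0 -> bwP l ->
  nrm (rscale (la v) (mu v)^-1 - l) <= 1 -> step (nq (mu v)) v.
Proof. by move=> Lv v0 m0 Pl le; have [h|h] := root_step aB Lv v0 m0 Pl le; [left|right]. Qed.

(* The deepest holes, where the comparison with the cusps is not strict; the
   root used has the lattice part [E1 + axis k q]. *)
Lemma hole_case v : points L v -> bf v v = 0 -> mu v != 0 ->
  let x := rscale (la v) (mu v)^-1 in
  nrm (x - E1) = 1 -> hurwitz (ip E1 x + nu v * (mu v)^-1) -> step (nq (mu v)) v.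
Proof.
move=> Lv v0 m0 x n1.
have [B BE] : exists B, B = ip E1 x + nu v * (mu v)^-1 by eexists.
rewrite -BE => hB; have rB : qre B = 0.
  have := null_re v0 m0; rewrite -/x BE qreD => ->.
  by move: n1; rewrite nrmB nrm_E1 -(ipC E1 x) qre_conj; lra.
have [|k yk] := @nrm_coord R (x - E1); first by rewrite n1 oner_eq0.
have le1 : nq ((x - E1) k 0) <= 1.
  by rewrite -n1 /nrm (bigD1 k) //= lerDl sumr_ge0 // => i _; exact: nq_ge0.
have [q q8q hq] := q8_near1 yk le1; have [hqq nq_ _ _] := q8_props q8q.
have Pl := E1_axis_pts k q8q.
case: hq => [lt1|ge]; last first.
  (* A component of at least 1/2 along q brings x within squared distance 1 + 1 - 2 (1/2) = 1 of the
     lattice point E1 + [axis k q]. *)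
  apply: (root_case Lv v0 m0 Pl); rewrite -/x opprD addrA nrmB n1 nrm_axis nq_.
  by rewrite -ipC ip_axis qre_conj; lra.
set l := E1 + axis k q in Pl.
pose d := E1 k 0; have hd : hurwitz d.
  by rewrite /d; elim/forall4: (k); rewrite v4E; do ?exact: hurwitz0; exact: hurwitz1.
(* Since [qomega - qeta = -1], this t makes [bf r v] / [mu v] - [qeta] equal to conj(q) (x - E1)_k -
   1, whose norm is below 1. It is a Hurwitz integer because B is one. *)
have [t tE] : exists t, t = - B - qconj q * d + qomega by eexists.
have ho : hurwitz qomega by rewrite /qomega; hurwitz_tac.
have ht : hurwitz t by rewrite tE; hurwitz_tac.
have lE : ip l x = ip E1 x + qconj q * x k 0 by rewrite ipDl ip_axis.
have nl : nrm l = 2 + 2 * qre (qconj q * d).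
  rewrite nrmD nrm_E1 nrm_axis nq_ -ipC ip_axis qre_conj -/d; lra.
have ro : qre qomega = - 2^-1 by rewrite qomegaE.
have rr : bf (vec3 l 1 (qconj t)) (vec3 l 1 (qconj t)) = 1.
  rewrite bf_self !vec3E qconj1 mul1r qre_conj nl tE (qreD _ qomega) ro (qreD (- B)) (qreN B) (qreN (_ * _)) rB -rq1; congr rq.
  by move: (qre _) => z; lra.
have Lr : points L (vec3 l 1 (qconj t)).
  by apply: pts_vec3 => //; [exact: hurwitz1|exact: hurwitz_conj].
right; apply: (refl_reduce Lr rr _ m0 (@hurwitz_eta R)).
- by rewrite vec3E.
- by rewrite /nq /qeta /=; field.
- by rewrite /qeta /=; field.
rewrite bf_vec3 // -/x lE qconjK.
suff -> : ip E1 x + qconj q * x k 0 + nu v * (mu v)^-1 + t - qeta = qconj q * (x - E1) k 0 - 1 by [].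
rewrite tE colD colN -/d mulrDr mulrN.
have oe : qomega - qeta = -1 by rewrite /qomega -opprD addrC eta_conj.
have -> : qconj q * x k 0 - qconj q * d - 1 = qconj q * x k 0 - qconj q * d + (qomega - qeta).
  by rewrite oe.
rewrite BE; move: (ip E1 x) (nu v * _) (qconj q * x k 0) (qconj q * d) qomega qeta.
by move=> A C F G o e; qring.
Qed.

Lemma even_step v : points L v -> bf v v = 0 -> mu v != 0 ->
  nrm (rscale (la v) (mu v)^-1 - E1) <= 1 -> step (nq (mu v)) v.
Proof.
move=> Lv v0 m0; set x := rscale _ _ => le1.
have [s [hs sE le4 alt]] := approx_im_neg1 (- qconj (ip E1 x + nu v * (mu v)^-1)).
have sN : 2 * qre s = - nrm E1 by rewrite sE nrm_E1; field.
have nE := cusp_bf sN v0 m0; rewrite /= -/x in nE.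
have r0 := nrm_ge0 (x - E1); have pm : 0 < nq (mu v) by rewrite nq_gt0.
have [hs'|nhs] := pselect (hurwitz s).
  (* For a Hurwitz integer s the null vector is a central translate of [frn]; the non-strict
     comparison is enough, because [cusp_step] ends below its starting value. *)
  have ho : hurwitz (qomega - s) by apply: hurwitzB => //; rewrite /qomega; hurwitz_tac.
  have o0' : qre (qomega - s) = 0 by rewrite qreD (qreN s) sE qomegaE subrr.
  have TA : AutL L (translation 0 (qomega - s)).
    by apply: (transl_Aut aB (adm0 aB) o0'); rewrite nrm0 mul0r rq0 subr0.
  apply: (step_aut TA (transl_rho _ _)).
  have [_ _ TB TP] := AutE TA.
  apply: (step_trans _ (cusp_step (TP _ Lv) _)); last by rewrite TB.
  have -> : frn = translation 0 (qomega - s) (vec3 (rscale E1 pp) pp (s * pp)).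
    rewrite translationE !vec3E rscale0l addr0 ip0l nrm0 mul0r rq0 !subr0 mulrBl addrC subrK.
    by rewrite E1_pp.
  rewrite TB nE -[leRHS]mul1r ler_pM2r //.
  by move: (nrm _) (im_dist _ _) r0 le1 le4 => r i; clear; nra.
have strict : nq (bf (vec3 (rscale E1 pp) pp (s * pp)) v) < nq (mu v) -> step (nq (mu v)) v.
  move=> lt; have [|g hg [a ha gn]] := half_cusp hs nhs; first by rewrite sN nrm_E1.
  right; exists g => //; have [_ _ gB _] := AutE (Reflec0_Aut aB hg).
  apply: le_lt_trans lt; rewrite -gB gn bfZl bf_rho nqM nq_conj ler_peMl ?nq_ge0 //.
  apply: hurwitz_nq_ge1 => //; apply/eqP => a0.
  have [g' hg' [gK _]] := Reflec0_inv aB hg.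
  have := congr1 (@mu R) (gK (vec3 (rscale E1 pp) pp (s * pp))).
  have [_ g'Z _ _] := AutE (Reflec0_Aut aB hg').
  rewrite gn a0 g'Z rscale0 vec3E => /esym /eqP; apply/negP.
  by rewrite /mu !mxE pp_neq0.
have sI : im_dist s (- qconj (ip E1 x + nu v * (mu v)^-1)) < 4^-1 -> step (nq (mu v)) v.
  move=> lt; apply: strict; rewrite nE -[X in _ < X]mul1r ltr_pM2r //.
  by move: (nrm _) (im_dist _ _) r0 le1 lt => r i; clear; nra.
case: alt => // -[l [m [n [e1 e2 e3]]]].
(* The imaginary part is now at a deep hole; the comparison is still strict unless x is also at
   distance exactly 1 from [E1]. *)
have [n1|n1] := eqVneq (nrm (x - E1)) 1; last first.
  apply: strict; rewrite nE -[X in _ < X]mul1r ltr_pM2r //.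
  have {n1} : nrm (x - E1) < 1 by rewrite lt_neqAle n1.
  by move: (nrm _) (im_dist _ _) r0 le4 => r i; clear; nra.
apply: hole_case => //; set B := _ + _ in e1 e2 e3 *.
have rB : qre B = 0.
  have := null_re v0 m0; rewrite -/x /B qreD => ->.
  by move: n1; rewrite nrmB nrm_E1 -(ipC E1 x) qre_conj; lra.
have := hurwitz_int R 0 l m n; congr (hurwitz _); apply: quatP => /=.
- by rewrite rB.
- by rewrite -e1 qiN qi_conj opprK.
- by rewrite -e2 qjN qj_conj opprK.
- by rewrite -e3 qkN qk_conj opprK.
Qed.

Lemma rho_step v : points L v -> bf v v = 0 -> mu v != 0 -> step (nq (mu v)) v.
Proof.
move=> Lv v0 m0; set x := rscale (la v) (mu v)^-1.
have [[l Pl le]|[l [e [Pl Pe ne le]]]] := bw_covering x; first exact: (root_case Lv v0 m0 Pl).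
have Pl' := admN aB Pl; have [z z0 hz] := transl_exists aB Pl'.
have TA := transl_Aut aB Pl' z0 hz.
have nep : nrm (rscale e pp) = 2 by rewrite nrmZ ne nq_pp mul1r.
(* Preceded by a translation taking l to 0, this isometry takes e [pp] to [bwF] = E1 [pp], hence e
   to E1, and reduces the situation to [even_step]. *)
have [h [hR hr hm he]] := Weq_F Pe nep; have hA := Reflec_Aut hR.
pose U := h \o translation (- l) z; have UA : AutL L U by exact: Aut_comp.
have Ur : U rho = rho by rewrite /U /= transl_rho.
apply: (step_aut UA Ur); have [_ _ UB UP] := AutE UA.
rewrite -(Aut_mu v UA Ur); apply: even_step.
- exact: UP.
- by rewrite UB.
- by rewrite (Aut_mu v UA Ur).
rewrite (Aut_mu v UA Ur).
have [_ hZ hB _] := AutE hA; set w := translation (- l) z v.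
have mw : mu w = mu v by rewrite mu_transl.
have xw : rscale (la w) (mu v)^-1 = x - l.
  by rewrite la_transl rscaleDl rscaleA quat_mulxV // rscale1.
have E (u : V) : ip E1 (la (h u)) = ip e (la u).
  have -> : ip E1 (la (h u)) = bf (vec3 E1 0 0) (h u).
    by rewrite /bf !vec3E qconj0 !mul0r !addr0.
  have -> : vec3 E1 0 0 = h (vec3 e 0 0).
    have -> : vec3 e 0 0 = rscale (vec3 (rscale e pp) 0 0) pp^-1.
      by rewrite rscale_vec3 rscaleA quat_mulxV ?pp_neq0 // rscale1 !mul0r.
    rewrite hZ he bwFE -E1_pp rscale_vec3 rscaleA quat_mulxV ?pp_neq0 // rscale1 !mul0r //.
  by rewrite hB /bf !vec3E qconj0 !mul0r !addr0.
have N : nrm (la (h w)) = nrm (la w).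
  have m1 : mu (h w) = mu w := Aut_mu w hA hr.
  have n1 : nu (h w) = nu w.
    have B (u : V) : nu u = bf (vec3 0 1 0) u.
      by rewrite /bf !vec3E ip0l qconj0 qconj1 mul1r mul0r add0r addr0.
    by rewrite B -{1}hm hB -B.
  have := hB w w; rewrite !bf_self m1 n1 => /(congr1 (@qre R)); rewrite !rqE; lra.
have -> : la (U v) = la (h w) by [].
rewrite nrmB nrmZ N -nrmZ xw -ipC ipZr E -ipZr xw nrm_E1 ipC.
by move: le; rewrite opprD addrA [in X in X -> _]nrmB ne.
Qed.

Lemma null_orbit v : points L v -> bf v v = 0 ->
  short_perp v \/ exists2 g, Reflec0 L g & exists2 a, hurwitz a & g v = rscale rho a.
Proof.
move=> Lv; have /points_lat[_ hm _] := Lv; have [m mE] := hurwitz_nq hm.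
have [n] := ubnP m; elim: n m v mE Lv {hm} => // n IH m v mE Lv le v0.
have [m0|m0] := eqVneq (mu v) 0.
  right; exists id; first by have [] := Reflec0_group L.
  have /points_lat[_ _ hn] := Lv; exists (nu v) => //.
  by apply: vecP; rewrite !vlinE !vec3E ?rscale0l ?mul0r ?mul1r //; exact: null_mu0.
have [h|[g hg lt]] := rho_step Lv v0 m0; first by left.
have [_ _ gB gP] := AutE (Reflec0_Aut aB hg).
have /points_lat[_ hm _] := gP _ Lv; have [m' m'E] := hurwitz_nq hm.
have lt2 : (m' < n)%N by apply: leq_trans (_ : (m <= n)%N); rewrite // -(ltr_nat R) -mE -m'E.
have [|h|[g' hg' [a ha gE]]] := IH m' (g v) m'E (gP _ Lv) lt2; first by rewrite gB.
  by left; exact: short_perp_aut (Reflec0_Aut aB hg) h.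
by right; exists (g' \o g); [exact: Reflec0_comp|exists a].
Qed.
End FirstPart.

(** * The index of the reflection group *)

Section CuspStabilizer.
Variable R : realType.
Local Notation Q := (quat R).
Local Notation W := 'cV[Q]_4.
Local Notation V := 'cV[Q]_(4 + (1 + 1)).
Local Notation rho := (rho R).
Local Notation L := (lat (@Hn R 4)).
Local Notation aH := (@Hn_adm R).
Implicit Types (x y : W) (v w : V) (a b u : Q) (k : 'I_4) (g h : V -> V).

Definition ev k : V := vec3 (axis k 1) 0 0.
Definition ev0 : V := vec3 0 1 0.

Lemma bf_ev k v : bf (ev k) v = la v k 0.
Proof. by rewrite /bf !vec3E ip_axis qconj1 qconj0 !mul0r !addr0 mul1r. Qed.
Lemma bf_ev0 v : bf ev0 v = nu v.
Proof. by rewrite /bf !vec3E ip0l qconj1 qconj0 mul0r addr0 add0r mul1r. Qed.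

Lemma rho_unit (P : set W) (aP : admissible P) g a : AutL (lat P) g -> hurwitz a ->
  g rho = rscale rho a -> nq a = 1.
Proof.
move=> hg ha ga; have [g' hg' [gK g'K]] := Aut_inv hg.
have [_ gZ _ _] := AutE hg; have [_ _ _ g'P] := AutE hg'.
have /points_lat[_ _ hn] := g'P _ (pts_rho aP).
have : rho = rscale (g' rho) a.
  by apply: (can_inj gK); rewrite gZ g'K ga.
move=> /(congr1 (@nu R)); rewrite nuZ vec3E => /(congr1 (@nq R)); rewrite nq1 nqM.
have [m ->] := hurwitz_nq hn; have [n ->] := hurwitz_nq ha.
by rewrite -natrM => /esym/eqP; rewrite pnatr_eq1 muln_eq1 => /andP[_ /eqP ->].
Qed.

Lemma fix_frame g : AutL L g -> g rho = rho -> g ev0 = ev0 -> (forall k, g (ev k) = ev k) ->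
  g = id.
Proof.
move=> hg gr g0 gk; have [_ _ gB _] := AutE hg; apply: funext => v; apply: vecP.
- apply/matrixP => i j; rewrite ord1; have := gB (ev i) v; rewrite gk bf_ev => ->.
  by rewrite bf_ev.
- exact: (Aut_mu v hg gr).
- by rewrite -bf_ev0 -{1}g0 gB bf_ev0.
Qed.

Lemma unit_vector x : @Hn R 4 x -> nrm x = 1 ->
  exists k u, [/\ hurwitz u, nq u = 1 & x = axis k u].
Proof.
move=> hx n1.
have [|k xk] := @nrm_coord R x; first by rewrite n1 oner_eq0.
have ge1 := hurwitz_nq_ge1 (hx k) xk.
have E : nrm x = nq (x k 0) + \sum_(i | i != k) nq (x i 0) by rewrite /nrm (bigD1 k).
have s0 : 0 <= \sum_(i | i != k) nq (x i 0) by apply: sumr_ge0 => i _; exact: nq_ge0.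
have s0' : \sum_(i | i != k) nq (x i 0) = 0 by lra.
exists k, (x k 0); split=> //; first by lra.
apply/matrixP => i j; rewrite ord1 axisE; case: eqP => [->|/eqP ik] //.
apply/eqP; rewrite -nq_eq0.
move/eqP: s0'; rewrite psumr_eq0 => [/allP h|? _]; last exact: nq_ge0.
by have := h i (mem_index_enum _); rewrite ik.
Qed.

(* The unit vector is moved to the k-th basis vector by a unit reflection or
   by the biflection in their difference. *)
Lemma move_axis k j u : hurwitz u -> nq u = 1 ->
  exists h, [/\ Reflec L h, h rho = rho, h ev0 = ev0, h (vec3 (axis j u) 0 0) = ev k
    & forall i, i != k -> i != j -> h (ev i) = ev i].
Proof.
move=> hu nu_; have uu : qconj u * u = 1 by rewrite mul_conjq nu_.
have h0 := @hurwitz0 R; have h1 := @hurwitz1 R.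
have [->|jk] := eqVneq j k.
  have [Lr rr] := axis_root k h0; exists (reflection L (qconj u) (vec3 (axis k 1) 0 0)).
  have hc := hurwitz_conj hu.
  have E v : reflection L (qconj u) (ev k) v = v - rscale (ev k) ((1 - qconj u) * la v k 0).
    by rewrite refl_short // bf_ev.
  split.
  - by apply: (Reflec0_Reflec aH); apply: refl_Reflec0; rewrite ?nq_conj.
  - by rewrite E vec3E mxE mulr0 rscale0 subr0.
  - by rewrite E vec3E mxE mulr0 rscale0 subr0.
  - rewrite E vec3E axisE eqxx /ev rscale_vec3 rscale_axis !mul0r mul1r mulrBl uu mul1r.
    apply: vecP; rewrite !vlinE !vec3E ?subr0 //.
    by apply/matrixP => a b; rewrite ord1 colD colN !axisE; case: ifP; rewrite ?subr0 // opprB addrC subrK.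
  - by move=> i ik _; rewrite E vec3E axisE eq_sym (negPf ik) mulr0 rscale0 subr0.
pose r : V := vec3 (axis k 1 - axis j u) 0 0.
have Pr : @Hn R 4 (axis k 1 - axis j u) by apply: (admB aH); exact: axis_pts.
have Lr : points L r by exact: pts_vec3.
have kj0 : axis j u k 0 = 0 by rewrite axisE eq_sym (negPf jk).
have rr : bf r r = rq 2.
  rewrite bf_self !vec3E qconj0 mul0r qre0 mulr0 addr0 nrmB !nrm_axis nq1 nu_.
  by rewrite ip_axis kj0 mulr0 qre0 mulr0 subr0.
have rE v : bf r v = la v k 0 - qconj u * la v j 0.
  by rewrite /bf !vec3E qconj0 !mul0r !addr0 ipDl ipNl !ip_axis qconj1 mul1r.
exists (reflection L (-1) r); split.
- exact: (bifl_Reflec aH).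
- by rewrite bifl_E // rE vec3E !mxE mulr0 subrr rscale0 subr0.
- by rewrite bifl_E // rE vec3E !mxE mulr0 subrr rscale0 subr0.
- rewrite bifl_E // rE !vec3E kj0 axisE eqxx uu sub0r rscaleN rscale1 opprK.
  by apply: vecP; rewrite !vlinE !vec3E ?addr0 // addrC subrK.
- move=> i ik ij; rewrite bifl_E // rE vec3E !axisE ![_ == i]eq_sym (negPf ik) (negPf ij).
  by rewrite mulr0 subrr rscale0 subr0.
Qed.

Lemma frame_step g (n : nat) (lt_n4 : (n < 4)%N) : AutL L g -> g rho = rho -> g ev0 = ev0 ->
  (forall k, (k < n)%N -> g (ev k) = ev k) ->
  exists2 h, Reflec L h & [/\ (h \o g) rho = rho, (h \o g) ev0 = ev0
    & forall k, (k < n.+1)%N -> (h \o g) (ev k) = ev k].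
Proof.
move=> hg gr g0 gk; have [_ _ gB gP] := AutE hg.
pose m : 'I_4 := Ordinal lt_n4.
have [Lm rm] := axis_root m (@hurwitz0 R).
have /points_lat[hl _ _] := gP _ Lm; rewrite -/(ev m) in hl rm.
have m0 : mu (g (ev m)) = 0 by rewrite (Aut_mu _ hg gr) vec3E.
have n0 : nu (g (ev m)) = 0 by rewrite -bf_ev0 -{1}g0 gB bf_ev0 vec3E.
have nl : nrm (la (g (ev m))) = 1.
  have := gB (ev m) (ev m); rewrite rm bf_self m0 qconj0 mul0r qre0 mulr0 addr0.
  by move=> /(congr1 (@qre R)).
have [j [u [hu nu_ lE]]] := unit_vector hl nl.
have gE : g (ev m) = vec3 (axis j u) 0 0 by rewrite -lE -[LHS]vec3_eta m0 n0.
(* The image of the new basis vector stays orthogonal to those already fixed, so [move_axis] does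
   not disturb them. *)
have nj (i : 'I_4) : (i < n)%N -> i != j.
  move=> lt_in; apply/eqP => ij; have := gB (ev i) (ev m); rewrite gk // gE !bf_ev !vec3E.
  rewrite ij !axisE eqxx -ij; case: eqP => [im|_ u0]; first by rewrite im ltnn in lt_in.
  by move: nu_; rewrite u0 nq0 => /esym/eqP; rewrite oner_eq0.
have [h [hR hr h0 hm hi]] := move_axis m j hu nu_.
exists h => //; split=> [||k] /=; rewrite ?gr ?g0 //.
rewrite ltnS leq_eqVlt => /orP[/eqP kn|lt].
  by have -> : k = m by [apply: val_inj]; rewrite gE hm.
by rewrite gk // hi ?nj //; apply/eqP => km; rewrite km ltnn in lt.
Qed.

Lemma frame_Reflec g : AutL L g -> g rho = rho -> g ev0 = ev0 -> Reflec L g.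
Proof.
move=> hg gr g0.
have H n : (n <= 4)%N -> exists2 h, Reflec L h & [/\ (h \o g) rho = rho, (h \o g) ev0 = ev0
    & forall k, (k < n)%N -> (h \o g) (ev k) = ev k].
  elim: n => [_|n IH lt_n4]; first by exists id; [have [] := Reflec_group L|].
  have [h hR [h1 h2 h3]] := IH (ltnW lt_n4).
  have [h' hR' h'E] := frame_step lt_n4 (Aut_comp (Reflec_Aut hR) hg) h1 h2 h3.
  by exists (h' \o h) => //; exact: Reflec_comp.
have [h hR [h1 h2 h3]] := H 4%N isT.
have hid := fix_frame (Aut_comp (Reflec_Aut hR) hg) h1 h2 (fun k => h3 k (ltn_ord k)).
by apply: (Reflec_cancel hR); rewrite hid; have [] := Reflec_group L.
Qed.

Lemma stab_rho_Reflec g a : AutL L g -> hurwitz a -> g rho = rscale rho a -> Reflec L g.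
Proof.
move=> hg ha ga; have na := rho_unit aH hg ha ga.
have [d hd [dr _]] := unit_rho aH (hurwitz_conj ha) (etrans (nq_conj a) na).
have hdg := Aut_comp (Reflec0_Aut aH hd) hg.
have dg : (d \o g) rho = rho.
  have [_ dZ _ _] := AutE (Reflec0_Aut aH hd).
  by rewrite /= ga dZ dr rscaleA mul_conjq na rscale1.
have [_ _ gB gP] := AutE hdg.
have L0 : points L ev0.
  by apply: pts_vec3; [exact: (adm0 aH)|exact: hurwitz1|exact: hurwitz0].
have /points_lat[Px hm hn] := gP _ L0; set x := la _ in Px; set n := nu _ in hn.
have m1 : mu ((d \o g) ev0) = 1 by rewrite (Aut_mu _ hdg dg) vec3E.
have nE : 2 * qre n = - nrm x.
  have := gB ev0 ev0; rewrite !bf_self m1 !vec3E nrm0 qconj1 !mul1r -/x -/n qre0.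
  by move=> /(congr1 (@qre R)); rewrite !rqE; lra.
have [z zE] : exists z, z = n + rq (nrm x / 2) by eexists.
have z0 : qre z = 0 by rewrite zE qreD rqE; lra.
have hz : hurwitz (z - rq (nrm x / 2)) by rewrite zE addrK.
have hT := standard_transl Px z0 hz.
have [t ht [tK Kt]] := Reflec0_inv aH hT.
have [_ _ tB _] := AutE (Reflec0_Aut aH ht).
have hR : Reflec L (t \o (d \o g)).
  apply: frame_Reflec.
  - exact: Aut_comp (Reflec0_Aut aH ht) hdg.
  - by rewrite /= -[d (g rho)]/((d \o g) rho) dg -{1}(transl_rho x z) tK.
  - apply: (can_inj tK); rewrite -[(t \o _) ev0]/(t ((d \o g) ev0)) Kt translationE !vec3E.
    apply: vecP; rewrite !vec3E ?m1 ?rscale1 ?add0r //.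
    by rewrite ip0r oppr0 add0r mulr1 zE addrK.
apply: (Reflec_cancel (Reflec0_Reflec aH hd)).
exact: (Reflec_cancel (Reflec0_Reflec aH ht)).
Qed.
End CuspStabilizer.

Section SecondPart.
Variable R : realType.
Local Notation Q := (quat R).
Local Notation W := 'cV[Q]_4.
Local Notation V := 'cV[Q]_(4 + (1 + 1)).
Local Notation pp := (pp R).
Local Notation rho := (rho R).
Local Notation qeta := (qeta R).
Local Notation qomega := (qomega R).
Local Notation L := (lat (@bwP R)).
Local Notation hL := (lat (@Hn R 4)).
Local Notation aB := (@bw_adm R).
Implicit Types (x y : W) (v w : V) (a b u z : Q) (k : 'I_4) (f g h : V -> V).

Lemma rho_no_short_perp : ~ short_perp rho.
Proof.
move=> [r [/points_lat[Pl _ _] rr rv]].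
have m0 : mu r = 0 by rewrite -bf_rho -bfC rv qconj0.
move: rr; rewrite bf_self m0 qconj0 mul0r qre0 mulr0 addr0 => /(congr1 (@qre R)).
exact: bw_nrm1 Pl.
Qed.

Lemma central_Aut z : hurwitz z -> qre z = 0 -> AutL L (translation 0 z).
Proof.
by move=> hz z0; apply: (transl_Aut aB (adm0 aB) z0); rewrite nrm0 mul0r rq0 subr0.
Qed.

(* An isometry fixing the hyperbolic plane and the root
   [bwF] fixes the null vector [frn] of the standard cusp. *)
Lemma frame_fixed_Reflec g : AutL L g -> g rho = rho -> g (ev0 R) = ev0 R ->
  g (vec3 (bwF R) 0 0) = vec3 (bwF R) 0 0 -> Reflec L g.
Proof.
move=> hg gr g0 gF; have [gD gZ _ _] := AutE hg.
have gn : g (frn R) = frn R.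
  have -> : frn R = vec3 (bwF R) 0 0 + rscale (ev0 R) pp + rscale rho (qomega * pp).
    rewrite !rscale_vec3; apply: vecP; rewrite !vlinE !vec3E.
    + by rewrite !rscale0l !addr0 bwFE.
    + by rewrite mul1r mul0r addr0 add0r.
    + by rewrite mul0r mul1r !add0r.
  by rewrite !gD !gZ gF g0 gr.
have hg' : AutL hL (@toH R \o g \o @ofH R).
  apply: isometry_comp (toH_isometry R).
  apply: isometry_comp hg.
  exact: isom_inv (toH_isometry R) (@ofH_toH R) (@toH_ofH R).
have toHn : toH (frn R) = rho.
  have [[_ _ _ _] [b5 _]] := frame_gram1 R; have [[_ _ _ c5] _] := frame_gram2 R.
  have [_ _ d5 _] := frame_gram3 R; have [[_ e5 _] [n0 nm _]] := frame_gram4 R.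
  rewrite /toH b5 c5 d5 e5 n0 -[bf (frm R) _]bfC nm qconj1 /Defs.rho.
  by rewrite -v4_0.
have gr' : (@toH R \o g \o @ofH R) rho = rscale rho 1.
  by rewrite rscale1 /= -{1}toHn ofH_toH gn.
have hR := stab_rho_Reflec hg' (@hurwitz1 R) gr'.
have := Reflec_isom (isom_inv (toH_isometry R) (@ofH_toH R) (@toH_ofH R)) (@toH_ofH R) (@ofH_toH R) hR.
by congr (Reflec L); apply: funext => v; rewrite /= !ofH_toH.
Qed.

Lemma Aut_decomp g : AutL L g -> exists z, [/\ hurwitz z, qre z = 0 &
  Reflec L (translation 0 z \o g)].
Proof.
move=> hg; have [_ _ gB gP] := AutE hg.
have grr : bf (g rho) (g rho) = 0 by rewrite gB bf_rho vec3E.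
have [h|[d hd [a ha da]]] := null_orbit (gP _ (pts_rho aB)) grr.
  by case: rho_no_short_perp; exact: short_perp_aut hg h.
have hdg := Aut_comp (Reflec0_Aut aB hd) hg.
have na := rho_unit aB hdg ha da.
have [e he [er _]] := unit_rho aB (hurwitz_conj ha) (etrans (nq_conj a) na).
have [e' he' e'E] : exists2 e', Reflec L e' & forall v, e' v = e (d v).
  exists (e \o d) => //.
  exact: Reflec_comp (Reflec0_Reflec aB he) (Reflec0_Reflec aB hd).
have g1r : e' (g rho) = rho.
  have [_ eZ _ _] := AutE (Reflec0_Aut aB he).
  by rewrite e'E da eZ er rscaleA mul_conjq na rscale1.
have [_ _ eB eP] := AutE (Reflec_Aut he').
have [[Lr _ _ _] _] := frame_points R; have [[r1 _ _ _] _] := frame_gram1 R.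
set r := fr1 R in Lr r1.
(* The image of the short root r = (0; 1, [qeta]) is brought back to r, first in its lattice part by
   a reflective translation, then in its last coordinate by a central one. This also fixes [ev0],
   which is r - [rho] [qeta]. *)
have /points_lat[Px _ _] := eP _ (gP _ Lr); set x := la _ in Px.
have [w w0 hw] := transl_Reflec aB (admN aB Px).
have hge := Aut_comp (Reflec_Aut hw) (Aut_comp (Reflec_Aut he') hg).
set g2 := _ \o _ in hge.
have g2r : g2 rho = rho by rewrite /g2 /= g1r transl_rho.
have [_ _ g2B g2P] := AutE hge.
have m2 : mu (g2 r) = 1 by rewrite (Aut_mu _ hge g2r) vec3E.
have l2 : la (g2 r) = 0.
  rewrite /g2 /= la_transl -/x (_ : mu (e' (g r)) = 1) ?rscale1 ?subrr //.
  by rewrite -m2 /g2 /= mu_transl.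
have /points_lat[_ _ hn] := g2P _ Lr.
have re : qre (nu (g2 r)) = qre qeta.
  have := g2B r r; rewrite r1 bf_self m2 l2 nrm0 qconj1 mul1r => /(congr1 (@qre R)).
  by rewrite qre1 rqE /=; lra.
have [z zE] : exists z, z = qeta - nu (g2 r) by eexists.
have hz : hurwitz z by rewrite zE; apply: hurwitzB => //; exact: hurwitz_eta.
have z0 : qre z = 0 by rewrite zE qreD qreN re subrr.
exists z; split=> //.
have hTA := central_Aut hz z0.
have hg3 := Aut_comp hTA hge; set g3 := _ \o g2 in hg3.
have g3r : g3 rho = rho by rewrite /g3 /= g2r transl_rho.
have g3f : g3 r = r.
  rewrite /g3 /= translationE m2 l2 rscale0l addr0 ip0l nrm0 mul0r rq0 !subr0 mulr1.
  by rewrite zE addrC subrK.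
have [g3D g3Z g3B g3P] := AutE hg3.
have g30 : g3 (ev0 R) = ev0 R.
  have -> : ev0 R = r - rscale rho qeta.
    rewrite rscale_vec3; apply: vecP; rewrite !vlinE !vec3E ?mul1r ?mul0r ?subr0 ?subrr //.
    by rewrite rscale0l subr0.
  by rewrite g3D -rscaleN g3Z g3f g3r.
have LF : points L (vec3 (bwF R) 0 0).
  by apply: pts_vec3; [exact: bwF_pts|exact: hurwitz0|exact: hurwitz0].
have /points_lat[Pl _ _] := g3P _ LF; set l := la _ in Pl.
have gl : g3 (vec3 (bwF R) 0 0) = vec3 l 0 0.
  apply: vecP; first by rewrite la_vec3.
    by rewrite (Aut_mu _ hg3 g3r) !mu_vec3.
  by rewrite nu_vec3 -bf_ev0 -{1}g30 g3B bf_ev0 nu_vec3.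
have nl : nrm l = 2.
  have := g3B (vec3 (bwF R) 0 0) (vec3 (bwF R) 0 0).
  rewrite gl !bf_self !vec3E qconj0 mul0r qre0 mulr0 !addr0 nrm_bwF.
  by move=> /(congr1 (@qre R)).
have [h [hR hr h0 hl]] := Weq_F Pl nl.
have hfix : Reflec L (h \o g3).
  apply: frame_fixed_Reflec => /=; rewrite ?g3r ?g30 ?gl //.
  exact: Aut_comp (Reflec_Aut hR) hg3.
have h3 := Reflec_cancel hR hfix.
have hf : Reflec L (translation (- x) w \o e') by exact: Reflec_comp.
have TK : cancel (translation 0 z) (translation 0 (- z)).
  by move=> v; rewrite central_comp addNr transl0.
have KT : cancel (translation 0 (- z)) (translation 0 z).
  by move=> v; rewrite central_comp subrr transl0.
(* In g3 the reflective factor [translation (- x) w \o e'] stands between the central translation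
   and g; conjugating it by the central translation moves it outside. *)
apply: (Reflec_cancel (Reflec_normal hTA TK KT hf)).
by move: h3; congr (Reflec L); apply: funext => v; rewrite /g3 /g2 /= TK.
Qed.

(** Every Hurwitz integer q is a pairing of lattice vectors: [pp]^-1 (1, 1, 1, 1) and [pp]^-1 (2q,
    0, 0, 0) pair to q. *)
Lemma central_Reflec (q : Q) : hurwitz q -> Reflec L (translation 0 (- 2 * imq q)).
Proof.
move=> hq; have h1 := @hurwitz1 R; have h0 := @inP0 R.
pose x : W := v4 (pp^-1 * 1) (pp^-1 * 1) (pp^-1 * 1) (pp^-1 * 1).
pose y : W := v4 (pp^-1 * (2 * q)) (pp^-1 * 0) (pp^-1 * 0) (pp^-1 * 0).
have Px : bwP x.
  apply: bwP_v4; rewrite ?subrr //; exists 2%:R; first exact: hurwitz_nat.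
  by rewrite -mulr2n -!mulrSr -natrM.
have h2q := inP_two hq.
have Py : bwP y.
  apply: bwP_v4; rewrite ?sub0r; do ?exact: inPN.
    exact: inP_hurwitz.
  by exists q; rewrite ?addr0.
have := transl_center aB Px Py; congr (Reflec L (translation 0 (_ * imq _))).
rewrite ip_bw !mulr0 !addr0 qconj1 mul1r (natq R 2) (rqC 2 q) -mulrA -rqM mulfV ?pnatr_eq0 //.
by rewrite rq1 mulr1.
Qed.

Definition rep (n : nat) : Q := nth 0 [:: 0; qI R; qJ R; qK R] n.

(** The values i, j, k and [qeta] of q yield 2i, 2j, 2k and i+j+k up to sign. The integral imaginary
    quaternions modulo their span form the quotient of (Z/2)^3 by (1, 1, 1), represented by 0, i, j,
    k. *)
Lemma central_rep z : hurwitz z -> qre z = 0 -> exists2 n, (n < 4)%N &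
  Reflec L (translation 0 (z - rep n)).
Proof.
move=> hz z0; have [l [m [n zE]]] : exists l m n : int, z = Quat 0 l%:~R m%:~R n%:~R.
  have /hurwitzP[a [b [c [d zE]]]] := hz.
  have [A aE] : exists A : int, a = 2 * A.
    have [A [|aE]] := int_parity a; first by exists A.
    exfalso; move: z0; rewrite zE /hquat aE /= => /eqP.
    by rewrite mulf_eq0 invr_eq0 pnatr_eq0 /= orbF intr_eq0; lia.
  exists b, c, d; rewrite zE; move: z0; rewrite zE /hquat /= => z0.
  by apply: quatP => /=; lra.
have H (i j k e : int) : Reflec L (translation 0
    (Quat 0 (2 * i + e)%:~R (2 * j + e)%:~R (2 * k + e)%:~R)).
  have -> : Quat 0 (2 * i + e)%:~R (2 * j + e)%:~R (2 * k + e)%:~R =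
    (- 2 * imq (qI R)) *~ (- i) + (- 2 * imq (qJ R)) *~ (- j) + (- 2 * imq (qK R)) *~ (- k)
     + (- 2 * imq qeta) *~ (- e) :> Q.
    have E (s t u v : R) : - 2 * imq (Quat s t u v) = Quat 0 (- 2 * t) (- 2 * u) (- 2 * v) :> Q.
      by rewrite (natq R 2) /imq /rq !(oppqE, addqE, mulqE) /=; congr Quat; ring.
    rewrite /qI /qJ /qK /qeta !E !mulrzqE !addqE !(rmorphD, rmorphM, rmorphN) /=.
    by congr Quat; field.
  have gL := Reflec_group L.
  apply: (central_add gL); [apply: (central_add gL); [apply: (central_add gL)|]|];
    apply: (central_mul _ gL); apply: central_Reflec;
    first [exact: hurwitzI|exact: hurwitzJ|exact: hurwitzK|exact: hurwitz_eta].
have S t (u v w i j k e : int) : (t < 4)%N -> rep t = Quat 0 u%:~R v%:~R w%:~R ->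
    l = 2 * i + e + u -> m = 2 * j + e + v -> n = 2 * k + e + w ->
    exists2 t, (t < 4)%N & Reflec L (translation 0 (z - rep t)).
  move=> t4 tE lE mE nE; exists t => //; rewrite zE tE oppqE addqE subrr -!rmorphB lE mE nE.
  by rewrite !addrK; exact: H.
have [i [li|li]] := int_parity l; have [j [mj|mj]] := int_parity m;
  have [k [nk|nk]] := int_parity n.
- by apply: (S 0%N 0 0 0 i j k 0) => //; lia.
- by apply: (S 3%N 0 0 1 i j k 0) => //; lia.
- by apply: (S 2%N 0 1 0 i j k 0) => //; lia.
- by apply: (S 1%N 1 0 0 (i - 1) j k 1) => //; lia.
- by apply: (S 1%N 1 0 0 i j k 0) => //; lia.
- by apply: (S 2%N 0 1 0 i (j - 1) k 1) => //; lia.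
- by apply: (S 3%N 0 0 1 i j (k - 1) 1) => //; lia.
- by apply: (S 0%N 0 0 0 i j k 1) => //; lia.
Qed.
End SecondPart.

(** * Cosets and their representatives *)

Section Cosets.
Variable R : realType.
Local Notation Q := (quat R).
Local Notation V := 'cV[Q]_(4 + (1 + 1)).
Local Notation L := (lat (@bwP R)).
Local Notation H := (Reflec L).
Implicit Types (f g h : V -> V) (m n : nat).

Definition rep_transl n : V -> V := translation 0 (rep R n).

Lemma rep_transl_in n : (n < 4)%N ->
  rep_transl n \in [set translation 0 z | z in [set 0; qI R; qJ R; qK R]].
Proof.
move=> n4; apply/mem_set; exists (rep R n) => //.
move: n n4 => [|[|[|[|n]]]] // _; rewrite /rep /=.
- by left; left; left.
- by left; left; right.
- by left; right.
- by right.
Qed.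

Lemma rep_transl_Aut n : (n < 4)%N -> AutL L (rep_transl n).
Proof.
by move: n => [|[|[|[|n]]]] // _; apply: central_Aut => //; rewrite /rep /=;
  [exact: hurwitz0|exact: hurwitzI|exact: hurwitzJ|exact: hurwitzK].
Qed.

Lemma lcoset_refl g : lcoset H g g.
Proof. by exists id => //; have [] := Reflec_group L. Qed.

Lemma lcoset_eq f g : lcoset H g f -> lcoset H f = lcoset H g.
Proof.
move=> [k hk <-]; apply/seteqP; split=> [_ [h hh <-]|_ [h hh <-]].
  by exists (k \o h) => //; exact: Reflec_comp.
have [k' hk' [kK k'K]] := Reflec_inv hk.
exists (k' \o h); first exact: Reflec_comp.
by apply: funext => v; rewrite /= k'K.
Qed.

Lemma lcosetsE C : lcosets (AutL L) H C -> exists2 n, (n < 4)%N & C = lcoset H (rep_transl n).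
Proof.
move=> [g hg <-]; have [z [hz z0 hR]] := Aut_decomp hg.
have [|n n4 hn] := central_rep (hurwitzN hz); first by rewrite qreN z0 oppr0.
exists n => //; apply: lcoset_eq; exists (translation 0 (- z - rep R n) \o (translation 0 z \o g)).
  exact: Reflec_comp.
apply: funext => v; rewrite /= /rep_transl !central_comp.
by rewrite [- z - _]addrC addrA subrr add0r addNr transl0.
Qed.

Lemma Aut_index : index_le (AutL L) H 4.
Proof.
apply: (card_le_trans _ (card_image_le (fun n => lcoset H (rep_transl n)) `I_4)).
by apply: subset_card_le => C /lcosetsE[n n4 ->]; exists n.
Qed.

Lemma lat_reflective : reflective L.
Proof.
apply: (@sub_finite_set _ _ [set lcoset H (rep_transl n) | n in `I_4]).
  by move=> C /lcosetsE[n n4 ->]; exists n.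
by apply: finite_image; exact: finite_II.
Qed.

Lemma Aut_representatives : exists S : set (V -> V),
  S `<=` [set translation 0 z | z in [set 0; qI R; qJ R; qK R]] /\
  coset_representatives (AutL L) H S.
Proof.
(* Some of the four cosets might coincide, whereas representatives must be unique, so only the least
   index of each coset is kept. *)
pose S : set (V -> V) := [set rep_transl n | n in
  [set n | (n < 4)%N /\ forall m, (m < n)%N -> ~ lcoset H (rep_transl m) (rep_transl n)]].
exists S; split; first by move=> _ [n [n4 _] <-]; exact/set_mem/rep_transl_in.
split=> [_ [n [n4 _] <-]|C /lcosetsE[n n4 CE]]; first exact: rep_transl_Aut.
have ex : exists m, `[< C (rep_transl m) >].
  by exists n; apply/asboolP; rewrite CE; exact: lcoset_refl.
case: (ex_minnP ex) => m /asboolP Cm mmin.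
have CmE : C = lcoset H (rep_transl m) by rewrite CE; apply/esym/lcoset_eq; rewrite -CE.
have m4 : (m < 4)%N.
  apply: leq_ltn_trans n4; apply: mmin; apply/asboolP; rewrite CE; exact: lcoset_refl.
exists (rep_transl m); split.
  split=> //; exists m => //; split=> // k km /lcoset_eq e.
  have : (m <= k)%N by apply: mmin; apply/asboolP; rewrite CmE e; exact: lcoset_refl.
  by rewrite leqNgt km.
move=> _ [[k [k4 kmin] <-] Ck].
have mk : (m <= k)%N by apply: mmin; apply/asboolP.
move: mk; rewrite leq_eqVlt => /orP[/eqP -> //|lt].
by case: (kmin _ lt); rewrite -CmE.
Qed.
End Cosets.

Theorem theorem6p14 (R : realType) :
  let L := bw_hyperbolic R in
  isometric L (I51 R) /\
  (forall v : 'cV[quat R]_(4 + (1 + 1)),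
     primitive L v -> isotropic L v ->
     ~ (exists g, Reflec0 L g /\
          exists2 a, hurwitz a & g v = rscale (rho R) a) ->
     exists C, quot_short_root L v C) /\
  (index_le (AutL L) (Reflec L) 4 /\
   reflective L /\
   exists S : set ('cV[quat R]_(4 + (1 + 1)) -> 'cV[quat R]_(4 + (1 + 1))),
     S `<=` [set translation 0 z | z in [set 0; qI R; qJ R; qK R]] /\
     coset_representatives (AutL L) (Reflec L) S).
Proof.
split; first exact: bw_hyperbolic_I51.
split; last first.
  by split; [exact: Aut_index|split; [exact: lat_reflective|exact: Aut_representatives]].
move=> v [Lv _ _] v0 nv; have v0' : bf v v = 0 by rewrite -(hform_lat (@bwP R)).
have [[r [Lr rr rv]]|[g hg ga]] := null_orbit Lv v0'; last by case: nv; exists g.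
have vr : perp (bw_hyperbolic R) v r.
  by split=> //; rewrite bw_lat hform_lat -bfC rv qconj0.
exists (quot_coset v r); split; first by exists r.
rewrite (quot_formE (@bw_hyperbolic_gramC R) v0 vr vr).
by rewrite bw_lat hform_lat.
Qed.
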